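(* Let $1\le p<\infty$ and let $(\Omega,d,\mu)$ be an unbounded, locally compact, non-complete metric measure space that is doubling and supports a $p$-Poincaré inequality, and suppose that $\Omega$ is a uniform domain in its completion $\overline{\Omega}$. Suppose also that $\partial\Omega:=\overline{\Omega}\setminus\Omega$ is unbounded and supports a non-atomic Borel regular measure $\nu$ satisfying the following $\theta$-codimensional condition for some $0<\theta<p$: there is a constant $C\ge 1$ such that for each $\zeta\in\partial\Omega$ and $r>0$, \[ \frac{1}{C}\,\nu(B(\zeta,r)\cap\partial\Omega)\le \frac{\mu(B(\zeta,r)\cap\Omega)}{r^\theta}\le C\,\nu(B(\zeta,r)\cap\partial\Omega). \] Then there is a bounded linear trace operator $T:D^{1,p}(\Omega)\to HB^{1-\theta/p}_{p,p}(\partial\Omega)$ such that for every $u\in D^{1,p}(\Omega)$, \[ \lim_{r\to 0^+}\frac{1}{\mu(B(\zeta,r)\cap\Omega)}\int_{B(\zeta,r)\cap\Omega}|u-Tu(\zeta)|\,d\mu=0 \] for $\nu$-a.e. $\zeta\in\partial\Omega$. Moreover, there is a bounded linear extension operator $E:HB^{1-\theta/p}_{p,p}(\partial\Omega)\to D^{1,p}(\Omega)$ such that $T\circ E$ is the identity operator on $HB^{1-\theta/p}_{p,p}(\partial\Omega)$.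
   Context: Throughout, balls have positive and finite $\mu$-measure (the usual convention for doubling measures). $B(\zeta,r)$ denotes the ball of center $\zeta$ and radius $r$ in $\overline{\Omega}$, the metric completion of $\Omega$, with metric still denoted $d$. Doubling: a metric measure space $(Z,d_Z,\mu_Z)$ is doubling if there is $C\ge1$ with $\mu_Z(B(z,2r))\le C\mu_Z(B(z,r))$ for all $z\in Z$, $r>0$. Upper gradients: a non-negative Borel function $g$ on $Z$ is an upper gradient of a measurable function $u$ if $|u(y)-u(x)|\le\int_\gamma g\,ds$ for all rectifiable curves $\gamma$ in $Z$ joining $x$ to $y$ (the right-hand side is interpreted as $\infty$ if $u(x)$ or $u(y)$ is infinite). It is a $p$-weak upper gradient if the family $\Gamma$ of rectifiable curves on which this inequality fails has $p$-modulus zero, i.e. there is a non-negative Borel $\rho\in L^p(Z)$ with $\int_\gamma\rho\,ds=\infty$ for every $\gamma\in\Gamma$. If $u$ has a $p$-weak upper gradient in $L^p(Z)$, then $g_u$ denotes the minimal one (the one of smallest $L^p$-norm). The Dirichlet-Sobolev space $D^{1,p}(Z)$ consists of the measurable functions $u$ on $Z$ for which the semi-norm $\|u\|_{D^{1,p}}:=\|g_u\|_{L^p(Z)}$ is finite. $p$-Poincaré inequality: there are constants $C>0$, $\lambda\ge1$ such that for all balls $B=B(z,r)\subset Z$ and all upper gradients $g$ of functions $u\in D^{1,p}(Z)$, \[\frac1{\mu_Z(B)}\int_B|u-u_B|\,d\mu_Z\le C\,r\left(\frac{1}{\mu_Z(\lambda B)}\int_{\lambda B}g^p\,d\mu_Z\right)^{1/p},\]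 where $u_B=\frac1{\mu_Z(B)}\int_B u\,d\mu_Z$ and $\lambda B=B(z,\lambda r)$. Uniform domain: with $d_\Omega(z):=\operatorname{dist}(z,\partial\Omega)$, $\Omega$ is a uniform domain in $\overline\Omega$ if there is $A\ge1$ such that every $x,y\in\Omega$ can be joined by a curve $\gamma$ in $\Omega$ with length $\ell(\gamma)\le A\,d(x,y)$ and $\min\{\ell(\gamma_{x,z}),\ell(\gamma_{z,y})\}\le A\,d_\Omega(z)$ for each point $z$ on $\gamma$, where $\gamma_{x,z}$, $\gamma_{z,y}$ denote any segments of $\gamma$ with the indicated end points. Homogeneous Besov space: with $\alpha=1-\theta/p$, $HB^{\alpha}_{p,p}(\partial\Omega)$ is the space of $f\in L^p_{\mathrm{loc}}(\partial\Omega,\nu)$ for which the semi-norm \[\|f\|_{HB^{\alpha}_{p,p}}:=\left(\int_0^\infty\int_{\partial\Omega}\frac{1}{\nu(B(y,r)\cap\partial\Omega)}\int_{B(y,r)\cap\partial\Omega}\frac{|f(y)-f(x)|^p}{r^{\alpha p}}\,d\nu(x)\,d\nu(y)\,\frac{dr}{r}\right)^{1/p}\] is finite; functions on $\partial\Omega$ agreeing $\nu$-a.e. are identified. ''Bounded'' for $T$ and $E$ means bounded with respect to these semi-norms: $\|Tu\|_{HB^{1-\theta/p}_{p,p}}\le C'\|u\|_{D^{1,p}}$ and $\|Ef\|_{D^{1,p}}\le C'\|f\|_{HB^{1-\theta/p}_{p,p}}$ for a constant $C'$ independent of $u$, $f$. *)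

(* Defs.v *)
From HB Require Import structures.
From mathcomp Require Import all_boot all_order all_algebra.
From mathcomp Require Import all_classical all_reals all_analysis measurable_realfun.

Set Implicit Arguments.
Unset Strict Implicit.
Unset Printing Implicit Defensive.

Import Order.TTheory GRing.Theory Num.Theory.
Import numFieldNormedType.Exports.

Local Open Scope classical_set_scope.
Local Open Scope ring_scope.

(* A metric space with a sigma-algebra that is a priori unrelated to the
   metric; [borel_regular] below ties the two together. *)
#[short(type="metricMeasurableType")]
HB.structure Definition MetricMeasurable (d : measure_display)
  (R : numDomainType) := {T of Metric R T & Measurable d T}.

Section metric.
Context {R : realType}.

Definition unbounded_space (Z : metricType R) : Prop :=
  forall M : R, exists x y : Z, M < mdist x y.

Definition complete_space (Z : metricType R) : Prop :=
  forall F : set_system Z, ProperFilter F -> cauchy F -> exists z : Z, F --> z.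

Definition isometric (Y Z : metricType R) (i : Y -> Z) : Prop :=
  forall x y, mdist (i x) (i y) = mdist x y.

Definition is_completion (Y Z : metricType R) (i : Y -> Z) : Prop :=
  [/\ isometric i, dense (range i) & complete_space Z].

Definition bdry (Y Z : metricType R) (i : Y -> Z) : set Z := ~` range i.

Definition dist_bdry (Y Z : metricType R) (i : Y -> Z) (y : Y) : \bar R :=
  ereal_inf [set (mdist (i y) z)%:E | z in bdry i].

Definition borel_set (Z : metricType R) : set (set Z) := <<s [set U : set Z | open U] >>.

Definition borel_fun (Z : metricType R) (g : Z -> \bar R) : Prop :=
  forall U : set (\bar R), open U -> borel_set (g @^-1` U).

End metric.

Section curves.
Context {R : realType}.

Record curve (Z : metricType R) := Curve {
  path_of :> R -> Z ;
  cbeg : R ;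
  cend : R ;
  cbeg_le_cend : cbeg <= cend ;
  path_continuous : {within `[cbeg, cend], continuous path_of} }.

Context {Z : metricType R}.

Definition path_length (f : R -> Z) (a b : R) : \bar R :=
  ereal_sup [set (\sum_(0 <= k < size s)
                    mdist (f (nth b (a :: s) k)) (f (nth b s k)))%:E
            | s in [set s : seq R | itv_partition a b s]].

Definition curve_length (c : curve Z) : \bar R :=
  path_length c (cbeg c) (cend c).

Definition joins (c : curve Z) (x y : Z) : Prop :=
  c (cbeg c) = x /\ c (cend c) = y.

(* Constant curves are left out: for finite-valued functions they carry no
   information, and a function taking an infinite value at a point could never
   satisfy the upper gradient inequality along the constant curve there. *)
Definition rectifiable (c : curve Z) : Prop :=
  (0 < curve_length c < +oo)%E.

(* The choice of the parameter t is immaterial: c is constant on each level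
   set of its arc-length function. *)
Definition arclength_param (c : curve Z) (s : R) : Z :=
  c (xget (cbeg c) [set t | t \in `[cbeg c, cend c] /\
                            path_length c (cbeg c) t = s%:E]).

Definition line_integral (c : curve Z) (g : Z -> \bar R) : \bar R :=
  (\int[lebesgue_measure]_(s in `[0%R, fine (curve_length c)])
     g (arclength_param c s))%E.

(* When u is infinite at an end point of c, the left-hand side is +oo with the
   conventions of \bar R (in which |+oo - +oo| = +oo), so that the inequality
   requires the line integral to be +oo. *)
Definition gradient_ineq (u g : Z -> \bar R) (c : curve Z) : Prop :=
  (`|u (c (cend c)) - u (c (cbeg c))| <= line_integral c g)%E.

Definition upper_gradient (u g : Z -> \bar R) : Prop :=
  [/\ forall x, (0 <= g x)%E, borel_fun g &
      forall c, rectifiable c -> gradient_ineq u g c].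

End curves.

Section metric_measure.
Context {R : realType} {d : measure_display} {Z : metricMeasurableType d R}.
Variables (mu : {measure set Z -> \bar R}) (p : R).
Local Open Scope ereal_scope.

(* Both the Borel sigma-algebra and its mu-completion are allowed. *)
Definition borel_regular : Prop :=
  (forall U : set Z, open U -> measurable U) /\
  (forall A : set Z, measurable A ->
     exists B : set Z, [/\ borel_set B, A `<=` B & mu B = mu A]).

Definition nonatomic : Prop :=
  forall A : set Z, measurable A -> 0 < mu A ->
    exists B : set Z, [/\ measurable B, B `<=` A & 0 < mu B < mu A].

Definition positive_finite_balls : Prop :=
  forall (z : Z) (r : R), (0 < r)%R -> 0 < mu (ball z r) < +oo.

Definition doubling : Prop :=
  exists C : R, (1 <= C)%R /\
    forall (z : Z) (r : R), (0 < r)%R ->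
      mu (ball z (2 * r)%R) <= C%:E * mu (ball z r).

Definition average (A : set Z) (u : Z -> \bar R) : \bar R :=
  (mu A)^-1 * \int[mu]_(x in A) u x.

Definition modulus_zero (G : set (curve Z)) : Prop :=
  exists rho : Z -> \bar R,
    [/\ forall x, 0 <= rho x, borel_fun rho, 'N[mu]_p%:E[rho] < +oo &
        forall c, G c -> line_integral c rho = +oo].

Definition weak_upper_gradient (u g : Z -> \bar R) : Prop :=
  [/\ forall x, 0 <= g x, borel_fun g &
      modulus_zero [set c | rectifiable c /\ ~ gradient_ineq u g c]].

Definition is_minimal_wug (u g : Z -> \bar R) : Prop :=
  [/\ weak_upper_gradient u g, 'N[mu]_p%:E[g] < +oo &
      forall h, weak_upper_gradient u h -> 'N[mu]_p%:E[g] <= 'N[mu]_p%:E[h]].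

(* Minimal p-weak upper gradients exist for every u in D^{1,p} and are unique
   up to mu-null sets, so the default value and the choice do not matter. *)
Definition minimal_wug (u : Z -> \bar R) : Z -> \bar R :=
  xget (cst +oo) [set g | is_minimal_wug u g].

Definition dirichlet (u : Z -> \bar R) : Prop :=
  measurable_fun [set: Z] u /\
  exists g, weak_upper_gradient u g /\ 'N[mu]_p%:E[g] < +oo.

Definition dirichlet_norm (u : Z -> \bar R) : \bar R :=
  'N[mu]_p%:E[minimal_wug u].

(* If u is not integrable on a ball B then [average B u] is infinite and the
   left-hand side is +oo. *)
Definition poincare : Prop :=
  exists C lam : R, [/\ (0 < C)%R, (1 <= lam)%R &
    forall (z : Z) (r : R) (u g : Z -> \bar R), (0 < r)%R ->
      dirichlet u -> upper_gradient u g ->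
      average (ball z r) (fun x => `|u x - average (ball z r) u|) <=
      (C * r)%:E * (average (ball z (lam * r)%R) (fun x => g x `^ p)) `^ p^-1].

Definition Lp_loc (f : Z -> R) : Prop :=
  measurable_fun [set: Z] f /\
  forall y : Z, exists r : R, (0 < r)%R /\
    \int[mu]_(x in ball y r) (`|f x| `^ p)%:E < +oo.

Definition besov_norm (alpha : R) (f : Z -> R) : \bar R :=
  (\int[lebesgue_measure]_(r in `]0%R, +oo[)
     ((\int[mu]_y
         average (ball y r) (fun x => (`|f y - f x| `^ p / r `^ (alpha * p))%:E))
      * (r^-1)%:E)) `^ p^-1.

Definition besov (alpha : R) (f : Z -> R) : Prop :=
  Lp_loc f /\ besov_norm alpha f < +oo.

End metric_measure.

(* Each point of the curve may be visited several times, hence the two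
   parameters t and t' of the same point. *)
Definition uniform_domain {R : realType} (Y Z : metricType R) (i : Y -> Z) : Prop :=
  exists A : R, 1 <= A /\
    forall x y : Y, exists c : curve Y,
      [/\ joins c x y,
          (curve_length c <= (A * mdist x y)%:E)%E &
          forall t t', t \in `[cbeg c, cend c] -> t' \in `[cbeg c, cend c] ->
            c t = c t' ->
            (Order.min (path_length c (cbeg c) t) (path_length c t' (cend c))
             <= A%:E * dist_bdry i (c t))%E].

(* The codimension condition, for i and j the inclusions of the domain and of
   its boundary into the completion. *)
Definition codimensional {R : realType} {d1 d2 : measure_display}
    (Y : metricMeasurableType d1 R) (Z : metricType R)
    (D : metricMeasurableType d2 R) (i : Y -> Z) (j : D -> Z)
    (mu : {measure set Y -> \bar R}) (nu : {measure set D -> \bar R})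
    (theta : R) : Prop :=
  exists C : R, 1 <= C /\
    forall (zeta : D) (r : R), 0 < r ->
      ((C^-1)%:E * nu (j @^-1` ball (j zeta) r)
         <= mu (i @^-1` ball (j zeta) r) * ((r `^ theta)^-1)%:E
         <= C%:E * nu (j @^-1` ball (j zeta) r))%E.

(* Main.v *)
(* Everything is discretized along the dyadic scales [sc k = 2 ^ k] and, at each
   scale, along a maximal separated net [y k l] of the boundary, each net point
   coming with a corkscrew point [z k l] of the domain at depth comparable to
   [sc k]; sums over nets are controlled by bounded overlap.

   Trace.  The trace of [u] is the limit as k tends to -oo of its averages over
   small balls around the corkscrew points.  A uniform curve joining two nearby
   corkscrew points is covered by boundedly many balls away from the boundary,
   so by the Poincare inequality the p-th power of the jump between two such
   averages is at most a constant times [sc k `^ (p - theta) / nu (ball)] times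
   the energy of an upper gradient at depth comparable to [sc k].  Summing over
   the net and over the scales, each point of the domain is counted boundedly
   often, and a discrete Hardy inequality with geometric weights gives the Besov
   bound.  The same sums, finite almost everywhere, give the convergence of the
   averages and the Lebesgue point property.

   Extension.  [ext f] averages [f] against the tent
   [max 0 (3 delta(x) - d(x, b))], so it is linear in [f] and locally Lipschitz
   with slope at most a constant times the mean oscillation of [f] at scale
   [delta x] divided by [delta x]; the l^p sum of these slopes is an upper
   gradient.  The oscillations summed over all scales are bounded by the Besov
   energy, and since they tend to 0 almost everywhere, the trace of [ext f] is
   [f].  Finally, finite-valued functions with a weak upper gradient of finite
   norm have a minimal one, because on almost every curve the minimum of two
   upper gradients is again one. *)
Require Import Defs.
From HB Require Import structures.
From mathcomp Require Import all_boot all_order all_algebra.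
From mathcomp Require Import all_classical all_reals all_analysis measurable_realfun.
From mathcomp Require Import ring lra zify.
Set Implicit Arguments.
Unset Strict Implicit.
Unset Printing Implicit Defensive.
Import Order.TTheory GRing.Theory Num.Theory.
Import numFieldNormedType.Exports.
Local Open Scope classical_set_scope.
Local Open Scope ring_scope.

(** * Length of curves *)

(** Integrals of non-negative functions are lower integrals, hence monotone without measurability.
    The Besov energy is accordingly estimated by pointwise comparison only, with step functions in
    the radius and with countable sums over nets, which are visibly measurable. Since $p=1$ is
    included, Hoelder and Jensen are replaced by $t\le e+e^{1-p}t^p$; the loss of a factor $2^p$ is
    harmless for boundedness.

    The Poincare inequality speaks of genuine upper gradients, the Dirichlet norm of weak ones:
    adding a small multiple of a function with infinite integral along the exceptional curves passes
    from one to the other.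

    Chains between corkscrew points stay at depth comparable to the scale, so their energies overlap
    boundedly over all scales at once; this gives the trace bound. The balls of the Lebesgue point
    property reach the boundary and overlap at all smaller scales; there the decay of $r^{p-\theta}$
    as $r\to0$ makes the sums converge. *)

Section path_length_theory.
Context {R : realType} {Z : metricType R}.
Implicit Types (f : R -> Z) (a b c t : R) (s : seq R).

Fixpoint chain_length f a s : R :=
  if s is x :: s' then mdist (f a) (f x) + chain_length f x s' else 0.

Lemma chain_lengthE f a b s :
  \sum_(0 <= k < size s) mdist (f (nth b (a :: s) k)) (f (nth b s k)) =
  chain_length f a s.
Proof.
elim: s a => [a|x s ih a]; first by rewrite big_nil.
by rewrite /= big_nat_recl//= -ih.
Qed.

Lemma chain_length_ge0 f a s : 0 <= chain_length f a s.
Proof. by elim: s a => //= x s ih a; rewrite addr_ge0// mdist_ge0. Qed.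

Lemma chain_length_cat f a s s' :
  chain_length f a (s ++ s') = chain_length f a s + chain_length f (last a s) s'.
Proof.
elim: s a => [a|x s ih a] /=; first by rewrite add0r.
by rewrite ih addrA.
Qed.

Lemma path_lengthE f a b :
  path_length f a b =
  ereal_sup [set (chain_length f a s)%:E | s in [set s | itv_partition a b s]].
Proof.
rewrite /path_length; congr ereal_sup; apply: eq_imagel => s _.
by rewrite chain_lengthE.
Qed.

Lemma chain_le_path_length f a b s : itv_partition a b s ->
  ((chain_length f a s)%:E <= path_length f a b)%E.
Proof. by move=> ps; rewrite path_lengthE; apply: ereal_sup_ubound; exists s. Qed.

Lemma path_length_ge0 f a b : a <= b -> (0 <= path_length f a b)%E.
Proof.
rewrite le_eqVlt => /predU1P[->|ab].
  apply: (@le_trans _ _ (chain_length f b [::])%:E) => //.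
  exact: chain_le_path_length.
apply: (@le_trans _ _ (chain_length f a [:: b])%:E).
  by rewrite lee_fin chain_length_ge0.
exact/chain_le_path_length/itv_partition1.
Qed.

Lemma path_lengthxx f a : path_length f a a = 0%E.
Proof.
apply/eqP; rewrite eq_le path_length_ge0// andbT path_lengthE.
by apply: ge_ereal_sup => _ [s /= /itv_partitionxx -> <-].
Qed.

Lemma mdist_le_path_length f a b : a <= b ->
  ((mdist (f a) (f b))%:E <= path_length f a b)%E.
Proof.
rewrite le_eqVlt => /predU1P[->|ab]; first by rewrite mdistxx path_length_ge0.
apply: (le_trans _ (chain_le_path_length f (itv_partition1 ab))).
by rewrite /= addr0.
Qed.

Lemma ex_itv_partition a b : a <= b -> exists s, itv_partition a b s.
Proof.
rewrite le_eqVlt => /predU1P[->|ab]; first by exists [::].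
by exists [:: b]; exact: itv_partition1.
Qed.

(** Partitions of the two pieces concatenate. The two suprema are taken one after the other, moving
    the other summand across by subtraction. *)
Lemma path_length_superadd f a b c : a <= c -> c <= b ->
  (path_length f a c + path_length f c b <= path_length f a b)%E.
Proof.
move=> ac cb.
have H s s' : itv_partition a c s -> itv_partition c b s' ->
    ((chain_length f a s)%:E + (chain_length f c s')%:E <= path_length f a b)%E.
  move=> ps ps'; rewrite -EFinD.
  apply: (le_trans _ (chain_le_path_length f (itv_partition_cat ps ps'))).
  by case: ps => _ /eqP lc; rewrite chain_length_cat lc.
have [->|Lfin] := eqVneq (path_length f a b) +oo%E; first exact: leey.
have Lf : path_length f a b \is a fin_num.
  by rewrite ge0_fin_numE ?ltey// path_length_ge0// (le_trans ac).
have H1 s : itv_partition a c s ->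
    (path_length f c b <= path_length f a b - (chain_length f a s)%:E)%E.
  move=> ps; rewrite [leLHS]path_lengthE; apply: ge_ereal_sup => _ [s' /= ps' <-].
  by rewrite EFinN leeBrDr// addeC; exact: H.
(* Subtraction in [\bar R] needs a finite second length; a single partition of the first piece
   already bounds it. *)
have Lcb : path_length f c b \is a fin_num.
  have [s ps] := ex_itv_partition ac.
  rewrite ge0_fin_numE ?path_length_ge0//; apply: (le_lt_trans (H1 _ ps)).
  by rewrite -ge0_fin_numE ?fin_numB ?Lf// (le_trans _ (H1 _ ps))// path_length_ge0.
rewrite -leeBrDr// path_lengthE; apply: ge_ereal_sup => _ [s /= ps <-].
by rewrite leeBrDr// addeC -leeBrDr//; exact: H1.
Qed.

(** Inserting [c] into the step of a partition that straddles it only lengthens the chain, by the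
    triangle inequality; the induction walks to that step. *)
Lemma path_lengthD f a b c : a <= c -> c <= b ->
  path_length f a b = (path_length f a c + path_length f c b)%E.
Proof.
move=> ac cb; apply/eqP; rewrite eq_le path_length_superadd// andbT.
rewrite [leLHS]path_lengthE; apply: ge_ereal_sup => _ [s /= ps <-].
elim: s a ac ps => [a ac /itv_partition_nil ab|x s ih a ac ps].
  by rewrite adde_ge0// path_length_ge0.
have ax : a < x by case: ps => /= /andP[].
have pxs := itv_partition_cons ps.
have [xc|cx] := leP x c.
  rewrite /= EFinD; apply: (@le_trans _ _ ((mdist (f a) (f x))%:E +
     (path_length f x c + path_length f c b))%E); first by rewrite leeD2l// ih.
  rewrite addeA leeD2r//; apply: le_trans (path_length_superadd _ (ltW ax) xc).
  by rewrite leeD2r// mdist_le_path_length// ltW.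
apply: (@le_trans _ _ ((mdist (f a) (f c))%:E + (chain_length f c (x :: s))%:E)%E).
  by rewrite -EFinD lee_fin /= addrA lerD2r metric_triangle.
apply: leeD; first exact: mdist_le_path_length.
apply: chain_le_path_length; case: ps => /= /andP[_ xs] lx; split => //=.
by rewrite cx.
Qed.

End path_length_theory.

Section curve_theory.
Context {R : realType} {Z : metricType R}.
Implicit Types (c : curve Z) (t s e : R).

Lemma curve_cont c t e : t \in `[cbeg c, cend c] -> 0 < e ->
  exists2 d, 0 < d & forall t', t' \in `[cbeg c, cend c] -> `|t' - t| < d ->
    mdist (c t) (c t') < e.
Proof.
move=> tc e0; have := @path_continuous _ _ c.
move=> /subspace_continuousP /(_ t tc)/cvg_ballP /(_ _ e0).
rewrite near_withinE => /nbhs_ballP[d /= d0 H]; exists d => // t' tc' td.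
have := H t'; rewrite /= ballEmdist /=; apply => //.
by rewrite /ball /= distrC.
Qed.

(** Take a partition starting at [t] that attains the remaining length up to $e/2$. Moving its start
    to a nearby [t'] changes the chain by less than $e/2$, as [c] is continuous, so the piece
    between [t] and [t'] has length at most $e$. To the left of [t] the last step of a partition
    ending at [t] plays this role. *)
Lemma path_length_cont c t e : (curve_length c < +oo)%E ->
  t \in `[cbeg c, cend c] -> 0 < e ->
  exists2 d, 0 < d & forall t', t' \in `[cbeg c, cend c] -> `|t' - t| < d ->
    (if (t <= t')%R then path_length c t t' <= e%:E
     else path_length c t' t <= e%:E)%E.
Proof.
move=> Lc tc e0.
have fin x y : cbeg c <= x -> x <= y -> y <= cend c ->
    path_length c x y \is a fin_num.
  move=> cx xy yc; rewrite ge0_fin_numE ?path_length_ge0//.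
  apply: le_lt_trans Lc; rewrite /curve_length.
  rewrite (path_lengthD c cx (le_trans xy yc)) (path_lengthD c xy yc).
  rewrite addeC -addeA leeDl// adde_ge0// path_length_ge0//.
have e20 : 0 < e / 2 by rewrite divr_gt0.
have [d1 d10 H1] := curve_cont tc e20.
have /andP[ct tc'] : cbeg c <= t <= cend c by rewrite in_itv/= in tc.
have [d2 d20 H2] : exists2 d, 0 < d & forall t', t' \in `[cbeg c, cend c] ->
    t' - t < d -> t <= t' -> (path_length c t t' <= e%:E)%E.
  move: tc'; rewrite le_eqVlt => /predU1P[tc'|tc'].
    exists 1 => // t' /[!in_itv]/= /andP[_ t'c] _ tt'.
    have -> : t' = t by apply/eqP; rewrite eq_le tt' tc' t'c.
    by rewrite path_lengthxx lee_fin ltW.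
  have Lf := fin _ _ ct (ltW tc') (lexx _).
  move: (Lf); rewrite path_lengthE => /(ub_ereal_sup_adherent e20).
  rewrite -path_lengthE => -[_ [[|x s] /= ps <-]].
    by move/itv_partition_nil: ps => ps; rewrite ps ltxx in tc'.
  move=> Hs; have tx : t < x by case: ps => /= /andP[].
  exists (Num.min d1 (x - t)); first by rewrite lt_min d10 subr_gt0.
  move=> t' t'c; rewrite lt_min => /andP[td1 tx'] tt'.
  have t'b : t' <= cend c by move: t'c; rewrite in_itv/= => /andP[].
  have dtt : mdist (c t) (c t') < e / 2 by apply: H1 => //; rewrite ger0_norm ?subr_ge0.
  have L2 := fin _ _ (le_trans ct tt') t'b (lexx _).
  have L1 := fin _ _ ct tt' t'b.
  move: Hs; rewrite (path_lengthD c tt' t'b).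
  have : ((chain_length c t' (x :: s))%:E <= path_length c t' (cend c))%E.
    apply: chain_le_path_length; case: ps => /= /andP[_ xs'] xl; split; rewrite //= xs' andbT.
    by rewrite -(ltrD2r (- t)).
  rewrite -(fineK L1) -(fineK L2) /= -!EFinD !lee_fin lte_fin.
  have := metric_triangle (c t) (c t') (c x).
  lra.
have [d3 d30 H3] : exists2 d, 0 < d & forall t', t' \in `[cbeg c, cend c] ->
    t - t' < d -> t' <= t -> (path_length c t' t <= e%:E)%E.
  move: ct; rewrite le_eqVlt => /predU1P[ct|ct].
    exists 1 => // t' /[!in_itv]/= /andP[t'c _] _ tt'.
    have -> : t' = t by apply/eqP; rewrite eq_le tt' -ct t'c.
    by rewrite path_lengthxx lee_fin ltW.
  have Lf := fin _ _ (lexx _) (ltW ct) tc'.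
  move: (Lf); rewrite path_lengthE => /(ub_ereal_sup_adherent e20).
  rewrite -path_lengthE => -[_ [s /= ps <-]].
  case/lastP: s ps => [/itv_partition_nil ps|s z ps].
    by rewrite ps ltxx in ct.
  have zt : z = t by case: ps => _ /eqP; rewrite last_rcons.
  rewrite {}zt in ps *.
  have [ps1 ps2] : path <%R (cbeg c) s /\ last (cbeg c) s < t.
    by case: ps; rewrite rcons_path => /andP[].
  rewrite -cats1 chain_length_cat/= addr0 => Hs.
  exists (Num.min d1 (t - last (cbeg c) s)); first by rewrite lt_min d10 subr_gt0.
  move=> t' t'c; rewrite lt_min => /andP[td1 tx'] tt'.
  have t'b : cbeg c <= t' by move: t'c; rewrite in_itv/= => /andP[].
  have dtt : mdist (c t) (c t') < e / 2.
    by apply: H1 => //; rewrite distrC ger0_norm ?subr_ge0.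
  have L2 := fin _ _ t'b tt' tc'.
  have L1 := fin _ _ (lexx _) t'b (le_trans tt' tc').
  move: Hs; rewrite (path_lengthD c t'b tt').
  have : ((chain_length c (cbeg c) (rcons s t'))%:E <= path_length c (cbeg c) t')%E.
    apply: chain_le_path_length; split; last by rewrite last_rcons.
    rewrite rcons_path ps1/=; move: tx'; rewrite ltrBlDr; lra.
  rewrite -cats1 chain_length_cat/= addr0.
  rewrite -(fineK L1) -(fineK L2) /= -!EFinD !lee_fin lte_fin.
  have := metric_triangle (c (last (cbeg c) s)) (c t') (c t).
  rewrite (metric_sym (c t')) in dtt *.
  lra.
exists (Num.min d2 d3); first by rewrite lt_min d20.
move=> t' t'c; rewrite lt_min => /andP[td2 td3]; case: leP => [tt'|t't].
  by apply: H2 => //; apply: le_lt_trans td2; exact: ler_norm.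
apply: H3 => //; last exact: ltW.
by apply: le_lt_trans td3; rewrite distrC; exact: ler_norm.
Qed.

Lemma path_length_fin c t t' : (curve_length c < +oo)%E ->
  cbeg c <= t -> t <= t' -> t' <= cend c -> path_length c t t' \is a fin_num.
Proof.
move=> Lc cx xy yc; rewrite ge0_fin_numE ?path_length_ge0//.
apply: le_lt_trans Lc; rewrite /curve_length.
rewrite (path_lengthD c cx (le_trans xy yc)) (path_lengthD c xy yc).
by rewrite addeC -addeA leeDl// adde_ge0// path_length_ge0.
Qed.

Lemma ex_arclength c s : (curve_length c < +oo)%E ->
  0 <= s <= fine (curve_length c) ->
  exists2 t, t \in `[cbeg c, cend c] & path_length c (cbeg c) t = s%:E.
Proof.
move=> Lc s0.
have bec := cbeg_le_cend c.
pose V t := fine (path_length c (cbeg c) t).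
have VE t : t \in `[cbeg c, cend c] -> path_length c (cbeg c) t = (V t)%:E.
  by rewrite in_itv/= => /andP[? ?]; rewrite fineK// path_length_fin.
have cV : {within `[cbeg c, cend c], continuous V}.
  apply/subspace_continuousP => t tc; apply/cvgrPdist_lt => e e0.
  have e20 : 0 < e / 2 by rewrite divr_gt0.
  have [d d0 H] := path_length_cont Lc tc e20.
  rewrite near_withinE; apply/nbhs_ballP; exists d => //= t'.
  rewrite /ball/= distrC => tt' t'c; have := H _ t'c tt'.
  have /andP[ct tc'] : cbeg c <= t <= cend c by have := tc; rewrite /= in_itv.
  have /andP[ct' tc''] : cbeg c <= t' <= cend c by have := t'c; rewrite /= in_itv/=.
  case: (leP t t') => [le_tt'|/ltW le_t't].
    have F := path_length_fin Lc ct le_tt' tc''.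
    have := path_lengthD c ct le_tt'.
    rewrite !VE// -(fineK F) -EFinD => -[E1]; rewrite lee_fin => H'.
    rewrite -/(V t) -/(V t'); change (`|V t - V t'| < e); rewrite E1.
    rewrite opprD addrA subrr add0r normrN ger0_norm ?fine_ge0 ?path_length_ge0//.
    lra.
  have F := path_length_fin Lc ct' le_t't tc'.
  have := path_lengthD c ct' le_t't.
  rewrite !VE// -(fineK F) -EFinD => -[E1]; rewrite lee_fin => H'.
    rewrite -/(V t) -/(V t'); change (`|V t - V t'| < e); rewrite E1.
  rewrite addrAC subrr add0r ger0_norm ?fine_ge0 ?path_length_ge0//.
  lra.
have V0 : V (cbeg c) = 0 by rewrite /V path_lengthxx.
have := @IVT _ V (cbeg c) (cend c) s bec cV; rewrite V0.
have V1 : 0 <= V (cend c) by rewrite fine_ge0// path_length_ge0.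
case; first by rewrite min_l// max_r.
by move=> t tc ts; exists t => //; rewrite VE// ts.
Qed.

Lemma mdist_same_length c t t' : (curve_length c < +oo)%E ->
  t \in `[cbeg c, cend c] -> t' \in `[cbeg c, cend c] ->
  mdist (c t) (c t') <=
  `|fine (path_length c (cbeg c) t) - fine (path_length c (cbeg c) t')|.
Proof.
move=> Lc; wlog tt' : t t' / t <= t'.
  move=> H tc tc'; have [tt'|/ltW tt'] := leP t t'; first exact: H.
  by rewrite metric_sym distrC; exact: H.
rewrite !in_itv/= => /andP[ct tc] /andP[ct' t'c].
have F1 := path_length_fin Lc (lexx _) ct tc.
have F2 := path_length_fin Lc ct tt' t'c.
rewrite (path_lengthD c ct tt') fineD//.
rewrite opprD addrA subrr add0r normrN ger0_norm ?fine_ge0 ?path_length_ge0//.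
by rewrite -lee_fin fineK// mdist_le_path_length.
Qed.

Lemma arclength_paramE c s t : (curve_length c < +oo)%E ->
  t \in `[cbeg c, cend c] -> path_length c (cbeg c) t = s%:E ->
  arclength_param c s = c t.
Proof.
move=> Lc tc ts; rewrite /arclength_param; case: xgetP => [t' _ [t'c t's]|].
  apply: mdist_positivity; apply/eqP; rewrite eq_le mdist_ge0 andbT.
  by apply: (le_trans (mdist_same_length Lc t'c tc)); rewrite t's ts subrr normr0.
by move=> /(_ t) /=; case.
Qed.

(** Clamping the parameter to $[0,L]$ extends the arc-length parametrization to a 1-Lipschitz map on
    the whole line, along which Borel functions are measurable. *)
Lemma ex_arclength_lipschitz c : rectifiable c ->
  exists g : R -> Z, [/\ forall s t, mdist (g s) (g t) <= `|s - t|,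
    forall s, 0 <= s <= fine (curve_length c) -> arclength_param c s = g s,
    g 0 = c (cbeg c) & g (fine (curve_length c)) = c (cend c)].
Proof.
move=> /andP[L0 Lc]; set L := fine (curve_length c).
have bec := cbeg_le_cend c.
have L0' : 0 <= L by rewrite fine_ge0// ltW.
pose k s := Num.min (Num.max 0 s) L.
have k01 s : 0 <= k s <= L.
  by rewrite /k ge_min le_min le_max lexx L0'/= lexx orbT.
have kid s : 0 <= s <= L -> k s = s.
  by move=> /andP[s0 sL]; rewrite /k max_r// min_l.
have klip s t : `|k s - k t| <= `|s - t|.
  wlog ts : s t / t <= s.
    by move=> H; have [/H//|/ltW/H] := leP t s; rewrite !(distrC t, distrC (k t)).
  have : 0 <= k s - k t <= s - t.
    rewrite /k; have [t0|t0] := leP 0 t; have [s0|s0] := leP 0 s;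
      have [?|?] := leP t L; have [?|?] := leP s L; have [?|?] := leP 0 L;
      apply/andP; split; lra.
  by move=> /andP[k0 kst]; rewrite !ger0_norm// subr_ge0.
exists (fun s => arclength_param c (k s)); split.
- move=> s t; apply: le_trans (klip s t).
  have [x xc xs] := ex_arclength Lc (k01 s).
  have [y yc ys] := ex_arclength Lc (k01 t).
  rewrite (arclength_paramE Lc xc xs) (arclength_paramE Lc yc ys).
  by apply: (le_trans (mdist_same_length Lc xc yc)); rewrite xs ys.
- by move=> s sL; rewrite kid.
- rewrite kid ?lexx//; apply: arclength_paramE => //.
    by rewrite in_itv/= lexx.
  exact: path_lengthxx.
- rewrite kid ?lexx ?L0'//; apply: arclength_paramE => //.
    by rewrite in_itv/= lexx bec.
  by rewrite /L fineK// ge0_fin_numE// ltW.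
Qed.

(** Restriction to a subcurve is a translation of the arc-length parameter. It makes the gradient
    inequality available on every subinterval of a curve, and not only between its end points. *)
Lemma ex_subcurve c s t : rectifiable c ->
  0 <= s -> s < t -> t <= fine (curve_length c) ->
  exists c', [/\ rectifiable c', fine (curve_length c') = t - s,
    c' (cbeg c') = arclength_param c s, c' (cend c') = arclength_param c t &
    forall x, 0 <= x <= t - s ->
      arclength_param c' x = arclength_param c (s + x)].
Proof.
move=> /andP[L0 Lc] s0 st tL.
have bec := cbeg_le_cend c.
have [x xc xs] := ex_arclength Lc (introT andP (conj s0 (ltW (lt_le_trans st tL)))).
have [y yc yt] := ex_arclength Lc (introT andP (conj (le_trans s0 (ltW st)) tL)).
have /andP[cx xc'] : cbeg c <= x <= cend c by rewrite in_itv/= in xc.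
have /andP[cy yc'] : cbeg c <= y <= cend c by rewrite in_itv/= in yc.
have xy : x <= y.
  rewrite leNgt; apply/negP => /ltW yx; have := path_lengthD c cy yx.
  rewrite xs yt -(fineK (path_length_fin Lc cy yx xc')) -EFinD => -[].
  have : 0 <= fine (path_length c y x) by rewrite fine_ge0// path_length_ge0.
  lra.
have cc : {within `[x, y], continuous c}.
  apply: continuous_subspaceW (@path_continuous _ _ c).
  by apply: subset_itv; rewrite bnd_simp.
pose c' := Curve xy cc.
have Lc' : curve_length c' = (t - s)%:E.
  rewrite /curve_length/=; have := path_lengthD c cx xy.
  rewrite xs yt -(fineK (path_length_fin Lc cx xy yc')) -EFinD => -[] ->.
  by rewrite addrAC subrr add0r.
have fLc' : (curve_length c' < +oo)%E by rewrite Lc' ltey.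
exists c'; split.
- by rewrite /rectifiable Lc' ltey lte_fin subr_gt0 st.
- by rewrite Lc'.
- by rewrite (arclength_paramE Lc xc xs).
- by rewrite (arclength_paramE Lc yc yt).
- move=> z /andP[z0 zts].
  have [|w wc wz] := @ex_arclength c' z fLc'; first by rewrite Lc'/= z0.
  rewrite (arclength_paramE fLc' wc wz)/=.
  move: (wc); rewrite in_itv/= => /andP[xw wy].
  symmetry; apply: arclength_paramE => //.
    by rewrite in_itv/= (le_trans cx)//= (le_trans wy).
  by rewrite (path_lengthD c cx xw) xs; move: wz => /= ->.
Qed.

End curve_theory.

(** * Integrals along intervals *)

Section integral_prelim.
Context {d : measure_display} {T : measurableType d} {R : realType}.
Variable mu : {measure set T -> \bar R}.

(* The integral of a nonnegative function is a lower integral, so it is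
   monotone without any measurability. *)
Lemma le_lower_integral (D : set T) (f g : T -> \bar R) :
  (forall x, D x -> 0 <= f x)%E -> (forall x, D x -> f x <= g x)%E ->
  (\int[mu]_(x in D) f x <= \int[mu]_(x in D) g x)%E.
Proof.
move=> f0 fg; have g0 x : D x -> (0 <= g x)%E.
  by move=> Dx; exact: le_trans (f0 _ Dx) (fg _ Dx).
rewrite !ge0_integralE//; apply: ereal_sup_le => _ [h /= hf <-].
exists h => //= x; apply: le_trans (hf x) _.
by rewrite !patchE; case: ifPn => // /set_mem; exact: fg.
Qed.

End integral_prelim.

Section borel_functions.
Context {R : realType}.

Lemma open_ereal_measurable (U : set (\bar R)) : open U -> measurable U.
Proof.
move=> oU.
have oV : open (EFin @^-1` U).
  rewrite openE => x Ux.
  have : nbhs x%:E U by exact: open_nbhs_nbhs.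
  by rewrite /nbhs /= /ereal_nbhs /=.
have -> : U = (EFin @` (EFin @^-1` U)) `|` ((U `&` [set +oo%E]) `|` (U `&` [set -oo%E])).
  apply/seteqP; split => [[x| |] Ux|x [[y Uy <-//]|[[]|[]]//]].
  - by left; exists x.
  - by right; left.
  - by right; right.
have mpt (x : \bar R) : measurable (U `&` [set x]).
  have [Ux|nUx] := pselect (U x).
    rewrite (_ : _ `&` _ = [set x]); first exact: emeasurable_set1.
    by apply/seteqP; split => [y []//|y /= ->].
  rewrite (_ : _ `&` _ = set0); first exact: measurable0.
  by apply/seteqP; split => [y [Uy /= yx]|//]; apply: nUx; rewrite -yx.
apply: measurableU; first by apply: measurable_image_EFin; exact: open_measurable.
by apply: measurableU.
Qed.

Context {dZ : measure_display} {Z : metricMeasurableType dZ R}.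

(** The sigma-algebra carried by [Z] may be larger than the Borel one. Borel functions are therefore
    viewed as measurable functions on the type generated by the open sets, where closure properties
    are available. *)
Lemma borel_funP (g : Z -> \bar R) : borel_fun g <->
  measurable_fun [set: g_sigma_algebraType (@open Z)] (g : g_sigma_algebraType (@open Z) -> \bar R).
Proof.
split => [bg|mg U oU].
  apply: (measurability _ (ErealGenOInfty.measurableE R)) => _ [_ [x ->] <-].
  rewrite setTI; apply: bg; rewrite set_itvE; exact: open_ereal_gt_ereal.
rewrite /borel_set -[_ @^-1` _]setTI; apply: mg => //.
exact: open_ereal_measurable.
Qed.

Lemma measurable_comp_borel d (T : measurableType d) (h : T -> Z) (g : Z -> \bar R) :
  (forall U : set Z, open U -> measurable (h @^-1` U)) -> borel_fun g ->
  measurable_fun [set: T] (g \o h).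
Proof.
move=> mh /borel_funP mg.
have mh' : measurable_fun [set: T] (h : T -> g_sigma_algebraType (@open Z)).
  apply: (@measurability _ _ T (g_sigma_algebraType (@open Z)) setT h (@open Z) erefl) => _ [U oU <-]; rewrite setTI; exact: mh.
exact: (measurableT_comp mg mh').
Qed.

End borel_functions.

Section lebesgue_prelim.
Context {R : realType}.
Local Notation leb := (@lebesgue_measure R).

Lemma lebesgue_measure_shift (a : R) (A : set R) : measurable A ->
  pushforward leb ((fun x => a + x) : measurableTypeR R -> measurableTypeR R) A = leb A.
Proof.
move=> mA.
have mf : measurable_fun setT ((fun x => a + x) : measurableTypeR R -> measurableTypeR R).
  by apply: measurable_funD => //; exact: measurable_cst.
pose phi : {mfun measurableTypeR R >-> measurableTypeR R} :=
  HB.pack ((fun x => a + x) : measurableTypeR R -> measurableTypeR R) (isMeasurableFun.Build _ _ _ _ _ mf).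
apply/esym; apply: (@lebesgue_measure_unique R (pushforward leb phi)) => //= _ [[x y]] _ <-.
rewrite /pushforward (_ : _ @^-1` _ = `]x - a, y - a]%classic); last first.
  by apply/seteqP; split => z /=; rewrite !in_itv/= ltrBlDl lerBrDl.
rewrite !lebesgue_measure_itv/= !lte_fin ltrD2r; case: ifP => // _.
by rewrite -!EFinB opprB addrA addrNK.
Qed.

Lemma integral_shift (s t : R) (f : R -> \bar R) : measurable_fun setT f ->
  (forall x, 0 <= f x)%E ->
  (\int[leb]_(x in `[0%R, (t - s)%R]) f (s + x)%R = \int[leb]_(x in `[s, t]) f x)%E.
Proof.
move=> mf f0.
have mphi : measurable_fun setT ((fun x => s + x) : measurableTypeR R -> measurableTypeR R).
  by apply: measurable_funD => //; exact: measurable_cst.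
have := @ge0_integral_pushforward _ _ _ _ R _ mphi leb `[s, t]%classic f.
rewrite (_ : _ @^-1` _ = `[0, t - s]%classic); last first.
  by apply/seteqP; split => z /=; rewrite !in_itv/= lerDl lerBrDl.
move=> <- //; first last.
  exact: measurable_funTS.
by apply: eq_measure_integral => A mA _; first [exact: lebesgue_measure_shift|exact/esym/lebesgue_measure_shift].
Qed.

Lemma integral_itv_cat (a s t : R) (f : R -> \bar R) : s <= a -> a <= t ->
  measurable_fun setT f -> (forall x, 0 <= f x)%E ->
  (\int[leb]_(x in `[s, t]) f x =
   \int[leb]_(x in `[s, a]) f x + \int[leb]_(x in `[a, t]) f x)%E.
Proof.
move=> sa at' mf f0.
rewrite -[X in (_ + X)%E]integral_itv_obnd_cbnd; last exact: measurable_funTS.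
rewrite -ge0_integral_setU//=; last 2 first.
- exact: measurable_funTS.
- rewrite disj_set2E; apply/eqP/seteqP; split => // x [] /=.
  by rewrite !in_itv/= => /andP[_ xa] /andP[ax _]; rewrite ltNge xa in ax.
congr integral; apply/seteqP; split => x /=; rewrite !in_itv/=.
  move=> /andP[sx xt]; have [xa|ax] := leP x a; [left|right]; by rewrite ?sx ?xt.
move=> [/andP[-> xa]|/andP[ax ->]]; first by rewrite (le_trans xa).
by rewrite andbT (le_trans sa)// ltW.
Qed.

End lebesgue_prelim.

(** * Infima of functions that dominate an oscillation *)

Section dominated_oscillation.
Context {R : realType}.
Local Notation leb := (@lebesgue_measure R).
Variables (h : R -> R) (L : R).

(** One-dimensional model of an upper gradient: [h] is a function along an arc-length parametrized
    curve. The condition amounts to $|h'|\le\varphi$ almost everywhere, but is kept in integral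
    form. *)
Definition dominates (phi : R -> \bar R) :=
  [/\ measurable_fun setT phi, (forall x, 0 <= phi x)%E,
    (\int[leb]_(x in `[0%R, L]) phi x < +oo)%E &
    forall s t, 0 <= s -> s <= t -> t <= L ->
      ((`|h t - h s|)%:E <= \int[leb]_(x in `[s, t]) phi x)%E].

Definition gate (B : set R) (phi psi : R -> \bar R) x :=
  if x \in B then phi x else psi x.

(* Sets on which one may switch from psi to phi: they form a sigma-algebra
   containing the half-lines. *)
Definition switching (B : set R) :=
  measurable B /\
  forall phi psi, dominates phi -> dominates psi -> dominates (gate B phi psi).

Lemma measurable_gate (B : set R) phi psi : measurable B ->
  measurable_fun setT phi -> measurable_fun setT psi ->
  measurable_fun setT (gate B phi psi).
Proof.
move=> mB mphi mpsi; apply: measurable_fun_ifT => //.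
apply: (measurable_fun_bool true); rewrite setTI.
by rewrite (_ : _ @^-1` _ = B)//; apply/seteqP; split => [x /= /set_mem|x /= /mem_set].
Qed.

Lemma gate_ge0 B phi psi : (forall x, 0 <= phi x)%E ->
  (forall x, 0 <= psi x)%E -> forall x, (0 <= gate B phi psi x)%E.
Proof. by move=> f0 g0 x; rewrite /gate; case: ifP. Qed.

Lemma integral_gate_fin B phi psi : measurable B ->
  dominates phi -> dominates psi ->
  (\int[leb]_(x in `[0%R, L]) gate B phi psi x < +oo)%E.
Proof.
move=> mB [mphi phi0 phioo _] [mpsi psi0 psioo _].
apply: (@le_lt_trans _ _ (\int[leb]_(x in `[0%R, L]) (phi x + psi x))%E).
  apply: le_lower_integral => x _; first exact: gate_ge0.
  by rewrite /gate; case: ifP => _; rewrite ?leeDl ?leeDr.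
rewrite ge0_integralD//; try exact: measurable_funTS.
by rewrite lte_add_pinfty.
Qed.

Lemma switching_ray a : switching `]a, +oo[%classic.
Proof.
split => // phi psi Hphi Hpsi; have [mphi phi0 phioo Dphi] := Hphi.
have [mpsi psi0 psioo Dpsi] := Hpsi.
split; [exact: measurable_gate|exact: gate_ge0|exact: integral_gate_fin|].
have mg := measurable_gate (measurable_itv `]a, +oo[) mphi mpsi.
move=> s t s0 st tL.
(* The ray is open at [a], so for [s' = a] the gate takes the value of [psi] at the left end point;
   that null point is dropped from both integrals. *)
have Hr s' t' : a <= s' -> (\int[leb]_(x in `[s', t']) phi x =
    \int[leb]_(x in `[s', t']) gate `]a, +oo[ phi psi x)%E.
  move=> as'; rewrite -integral_itv_obnd_cbnd; last exact: measurable_funTS.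
  rewrite -[RHS]integral_itv_obnd_cbnd; last exact: measurable_funTS.
  apply: eq_integral => x; rewrite inE/= in_itv/= => /andP[sx _].
  by rewrite /gate mem_set//= in_itv/= andbT (le_lt_trans as').
have Hl s' t' : t' <= a -> (\int[leb]_(x in `[s', t']) psi x =
    \int[leb]_(x in `[s', t']) gate `]a, +oo[ phi psi x)%E.
  move=> t'a; apply: eq_integral => x; rewrite inE/= in_itv/= => /andP[_ xt].
  by rewrite /gate memNset//= in_itv/= andbT; apply/negP; rewrite -leNgt (le_trans xt).
have [as'|sa] := leP a s; first by rewrite -Hr//; exact: Dphi.
have [ta|at'] := leP t a; first by rewrite -Hl//; exact: Dpsi.
rewrite (@integral_itv_cat _ a)//; [|exact: ltW|exact: ltW|exact: gate_ge0].
rewrite -Hl// -Hr//.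
apply: (@le_trans _ _ (`|h a - h s|%:E + `|h t - h a|%:E)%E).
  rewrite -EFinD lee_fin (_ : h t - h s = (h a - h s) + (h t - h a)) ?ler_normD//.
  by ring.
apply: leeD; first by apply: Dpsi; rewrite ?(ltW sa)// (le_trans (ltW at')).
by apply: Dphi => //; [rewrite (le_trans s0)// ltW|exact: ltW].
Qed.

Lemma switchingC B : switching B -> switching (~` B).
Proof.
move=> [mB HB]; split; first exact: measurableC.
move=> phi psi Hphi Hpsi.
rewrite (_ : gate _ _ _ = gate B psi phi); first exact: HB.
by apply/funext => x; rewrite /gate in_setC; case: (x \in B).
Qed.

Lemma switchingU B1 B2 : switching B1 -> switching B2 -> switching (B1 `|` B2).
Proof.
move=> [mB1 HB1] [mB2 HB2]; split; first exact: measurableU.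
move=> phi psi Hphi Hpsi.
rewrite (_ : gate _ _ _ = gate B1 phi (gate B2 phi psi)).
  by apply: HB1 => //; exact: HB2.
by apply/funext => x; rewrite /gate in_setU; case: (x \in B1).
Qed.

(** Dominated convergence on each subinterval, [psi] being the integrable majorant. *)
Lemma dominates_lim (phi_ : (R -> \bar R)^nat) (phi psi : R -> \bar R) :
  (forall n, dominates (phi_ n)) -> measurable_fun setT psi ->
  (forall x, 0 <= psi x)%E -> (\int[leb]_(x in `[0%R, L]) psi x < +oo)%E ->
  (forall n x, phi_ n x <= psi x)%E ->
  (forall x, phi_ n x @[n --> \oo] --> phi x) -> dominates phi.
Proof.
move=> D mpsi psi0 psioo phipsi cv.
have phi_0 n x : (0 <= phi_ n x)%E by case: (D n).
have mphi_ n : measurable_fun setT (phi_ n) by case: (D n).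
have mphi : measurable_fun setT phi by apply: (emeasurable_fun_cvg phi_).
have phi0 x : (0 <= phi x)%E.
  by rewrite -(cvg_lim _ (cv x))//; apply: lime_ge; [apply/cvg_ex; exists (phi x)|exact: nearW].
have phile x : (phi x <= psi x)%E.
  by rewrite -(cvg_lim _ (cv x))//; apply: lime_le; [apply/cvg_ex; exists (phi x)|exact: nearW].
split => //.
  by apply: le_lt_trans psioo; apply: le_lower_integral.
move=> s t s0 st tL.
have sub : `[s, t]%classic `<=` `[0, L]%classic.
  by apply: subset_itv; rewrite bnd_simp.
have ipsi : leb.-integrable `[s, t]%classic psi.
  apply/integrableP; split; first exact: measurable_funTS.
  apply: le_lt_trans psioo; under eq_integral do rewrite gee0_abs//.
  by apply: ge0_subset_integral => //; exact: measurable_funTS.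
have [_ _ cvi] := @dominated_convergence _ _ _ leb `[s, t]%classic
  (measurable_itv _) phi_ phi psi (fun n => measurable_funTS (mphi_ n))
  (measurable_funTS mphi) (aeW leb (fun x => fun _ => cv x)) ipsi
  (aeW leb (fun x n _ => eq_ind_r (fun z => z <= psi x)%E (phipsi n x) (gee0_abs (phi_0 n x)))).
have le n : (`|h t - h s|%:E <= \int[leb]_(x in `[s, t]) phi_ n x)%E.
  by case: (D n) => _ _ _; apply.
by rewrite -(cvg_lim _ cvi)//; apply: lime_ge; [apply/cvg_ex; eexists; exact: cvi|exact: nearW].
Qed.

Lemma switching_bigcup (B : (set R)^nat) : (forall n, switching (B n)) ->
  switching (\bigcup_n B n).
Proof.
move=> HB; split; first by apply: bigcupT_measurable => n; case: (HB n).
move=> phi psi Hphi Hpsi.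
have [mphi phi0 phioo _] := Hphi; have [mpsi psi0 psioo _] := Hpsi.
pose U n := \big[setU/set0]_(i < n) B i.
have HU n : switching (U n).
  rewrite /U; elim: n => [|n ih]; last by rewrite big_ord_recr; exact: switchingU.
  rewrite big_ord0; split=> // f g _; rewrite (_ : gate _ _ _ = g)//.
  by apply/funext => x; rewrite /gate in_set0.
apply: (@dominates_lim (fun n => gate (U n) phi psi) _ (fun x => phi x + psi x)%E).
- by move=> n; apply: (HU n).2.
- exact: emeasurable_funD.
- by move=> x; rewrite adde_ge0.
- by rewrite ge0_integralD//; try exact: measurable_funTS; rewrite lte_add_pinfty.
- by move=> n x; rewrite /gate; case: ifP => _; rewrite ?leeDl ?leeDr.
- move=> x; rewrite /gate; have [|xU] := boolP (x \in \bigcup_n B n).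
    rewrite inE => -[k _ Bkx]; apply: cvg_near_cst; near=> n.
    rewrite mem_set// /U -bigcup_mkord; exists k => //=.
    by near: n; exists k.+1.
  apply: cvg_near_cst; near=> n; rewrite memNset// /U -bigcup_mkord => -[k _ Bkx].
  by move: xU; rewrite notin_setE; apply; exists k.
Unshelve. all: by end_near. Qed.

Lemma measurable_switching (B : set R) : measurable B -> switching B.
Proof.
move=> mB; have : (RGenOInfty.G (R:=R)).-sigma.-measurable B.
  by rewrite -RGenOInfty.measurableE.
apply: smallest_sub; last first.
  by move=> _ [a ->]; exact: switching_ray.
split; last exact: switching_bigcup.
- have -> : set0 = ~` (`]0, +oo[%classic `|` ~` `]0, +oo[%classic) :> set R.
    by rewrite setUv setCT.
  exact/switchingC/switchingU/switchingC/switching_ray/switching_ray.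
- by move=> A HA; rewrite setTD; exact: switchingC.
Qed.

(** The minimum is the gate on the measurable set where [phi] is at most [psi]; this is the purpose
    of showing that every measurable set is switching. *)
Lemma dominates_min phi psi : dominates phi -> dominates psi ->
  dominates (fun x => Order.min (phi x) (psi x)).
Proof.
move=> Hphi Hpsi; have [mphi _ _ _] := Hphi; have [mpsi _ _ _] := Hpsi.
have mB : measurable [set x | phi x <= psi x]%E.
  by rewrite -[X in measurable X]setTI; exact: emeasurable_fun_le.
have := (measurable_switching mB).2 _ _ Hphi Hpsi.
rewrite (_ : gate _ _ _ = (fun x => Order.min (phi x) (psi x)))//.
apply/funext => x; rewrite /gate; case: ifPn => [/set_mem /= xy|].
  by rewrite min_l.
by rewrite notin_setE/= => /negP; rewrite -ltNge => /ltW yx; rewrite min_r.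
Qed.

(** The running minima decrease to the infimum, with [phi_ 0] as common majorant. *)
Lemma dominates_inf (phi_ : (R -> \bar R)^nat) : (forall n, dominates (phi_ n)) ->
  dominates (fun x => ereal_inf (range (phi_ ^~ x))).
Proof.
move=> D; pose m := fix m n := if n is k.+1 then
  (fun x => Order.min (m k x) (phi_ n x)) else phi_ 0%N.
have Dm n : dominates (m n) by elim: n => //= n ih; exact: dominates_min.
have [m0 p0 i0 _] := D 0%N.
have md x : {homo m^~ x : n k / (n <= k)%N >-> (k <= n)%E}.
  move=> n k /subnK <-; elim: (k - n)%N => //= i ih.
  by rewrite ge_min ih.
have mle n x : (m n x <= phi_ n x)%E by case: n => //= n; rewrite ge_min lexx orbT.
apply: (@dominates_lim m _ (phi_ 0%N)) => //.
  by move=> n x; exact: (md x 0%N n).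
move=> x; have := @ereal_nonincreasing_cvgn _ (m^~ x) (md x).
rewrite (_ : ereal_inf (range (m^~ x)) = ereal_inf (range (phi_^~ x)))//.
apply/eqP; rewrite eq_le; apply/andP; split; apply/le_ereal_inf_tmp => _ [n _ <-].
  by apply: le_trans (mle n x); apply: ereal_inf_lbound; exists n.
elim: n => [|n ih]; first by apply: ereal_inf_lbound; exists 0%N.
by rewrite /= le_min ih/=; apply: ereal_inf_lbound; exists n.+1.
Qed.

End dominated_oscillation.

(** * Weak upper gradients *)

Section ereal_prelim.
Context {R : realType}.
Implicit Types (x y : \bar R) (r : R).
Local Open Scope ereal_scope.

Lemma lee_poweR x y r : (0 <= r)%R -> 0 <= x -> x <= y -> x `^ r <= y `^ r.
Proof.
move=> r0 x0 xy; apply: gt0_ler_poweR => //; rewrite in_itv/= ?x0 leey//.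
by rewrite (le_trans x0).
Qed.

Lemma poweRK x r : r != 0%R -> 0 <= x -> (x `^ r) `^ r^-1 = x.
Proof. by move=> r0 x0; rewrite -poweRrM mulfV// poweRe1. Qed.

Lemma poweRVK x r : r != 0%R -> 0 <= x -> (x `^ r^-1) `^ r = x.
Proof. by move=> r0 x0; rewrite -poweRrM mulVf// poweRe1. Qed.

Lemma poweRD_le x y r : (0 <= r)%R -> 0 <= x -> 0 <= y ->
  (x + y) `^ r <= (2 `^ r)%:E * (x `^ r + y `^ r).
Proof.
move=> r0; wlog xy : x y / x <= y.
  move=> H x0 y0; have [xy|/ltW yx] := leP x y; first exact: H.
  by rewrite addeC [X in _ * X]addeC; exact: H.
move=> x0 y0; apply: (@le_trans _ _ ((2%:E * y) `^ r)).
  by apply: lee_poweR; rewrite ?adde_ge0//= mule_natl mule2n leeD2r.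
rewrite poweRM// poweR_EFin; apply: lee_wpmul2l; first by rewrite lee_fin powR_ge0.
by rewrite leeDr// poweR_ge0.
Qed.

Lemma nneseries_ge_term (u : nat -> \bar R) k : (forall n, 0 <= u n) ->
  u k <= \sum_(n <oo) u n.
Proof.
move=> u0; apply: le_trans (@nneseries_lim_ge R u xpredT 0%N k.+1 (fun n _ _ => u0 n)).
by rewrite big_nat_recr//= leeDr// sume_ge0.
Qed.

Lemma nneseries_half : \sum_(n <oo) ((2 ^+ n.+1)^-1 : R)%:E = 1.
Proof.
have := @cvg_geometric_eseries_half R 1%R 0%N.
rewrite expr0 divr1 => /cvg_lim <-//; congr (limn _); apply/funext => n.
apply: eq_bigr => k _; congr EFin.
by rewrite addn1 natrX div1r.
Qed.

End ereal_prelim.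

Section line_integrals.
Context {R : realType} {d : measure_display} {Z : metricMeasurableType d R}.
Local Notation leb := (@lebesgue_measure R).
Implicit Types (c : curve Z) (g : Z -> \bar R).

Lemma measurable_comp_lipschitz (gam : R -> Z) g :
  (forall s t, mdist (gam s) (gam t) <= `|s - t|) -> borel_fun g ->
  measurable_fun setT (g \o gam).
Proof.
move=> lip bg; apply: measurable_comp_borel bg => U oU.
apply: open_measurable; move: U oU; apply/continuousP => t.
apply/cvg_ballP => e e0; apply/nbhs_ballP; exists e => // s.
move=> ts; rewrite ballEmdist/=; exact: le_lt_trans (lip _ _) ts.
Qed.

Lemma line_integral_lipschitz c (gam : R -> Z) g :
  (forall s, 0 <= s <= fine (curve_length c) -> arclength_param c s = gam s) ->
  line_integral c g = (\int[leb]_(s in `[0%R, fine (curve_length c)]) g (gam s))%E.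
Proof.
move=> gamE; apply: eq_integral => s; rewrite inE/= in_itv/= => sL.
by rewrite gamE.
Qed.

Lemma line_integral_sub c (gam : R -> Z) s t g : rectifiable c ->
  (forall s t, mdist (gam s) (gam t) <= `|s - t|) ->
  (forall s, 0 <= s <= fine (curve_length c) -> arclength_param c s = gam s) ->
  0 <= s -> s < t -> t <= fine (curve_length c) ->
  exists c', [/\ rectifiable c', c' (cbeg c') = gam s, c' (cend c') = gam t &
    forall g, borel_fun g -> (forall x, 0 <= g x)%E ->
      line_integral c' g = (\int[leb]_(x in `[s, t]) g (gam x))%E].
Proof.
move=> rc lip gamE s0 st tL.
have [c' [rc' Lc' b' e' gam']] := ex_subcurve rc s0 st tL.
have sL : 0 <= s <= fine (curve_length c) by rewrite s0 (le_trans (ltW st)).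
have tL' : 0 <= t <= fine (curve_length c) by rewrite (le_trans s0 (ltW st)).
exists c'; split => //; [by rewrite b' gamE|by rewrite e' gamE|].
move=> g' bg' g'0; rewrite (@line_integral_lipschitz c' (fun x => gam (s + x))).
  have mgg := measurable_comp_lipschitz lip bg'.
  rewrite Lc'; exact: (@integral_shift _ s t (g' \o gam) mgg (fun x => g'0 (gam x))).
move=> x; rewrite Lc' => /andP[x0 xts]; rewrite gam' ?x0// gamE//.
by rewrite addr_ge0//= (le_trans _ tL)// -lerBrDl.
Qed.

Lemma le_line_integral c g g' : (forall x, 0 <= g x)%E ->
  (forall x, g x <= g' x)%E -> (line_integral c g <= line_integral c g')%E.
Proof. by move=> g0 gg'; apply: le_lower_integral. Qed.

Lemma line_integralZ c g (k : R) : rectifiable c -> (0 <= k) ->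
  borel_fun g -> (forall x, 0 <= g x)%E ->
  line_integral c (fun x => k%:E * g x)%E = (k%:E * line_integral c g)%E.
Proof.
move=> rc k0 bg g0; have [gam [lip gamE _ _]] := ex_arclength_lipschitz rc.
rewrite !(line_integral_lipschitz _ gamE) ge0_integralZl_EFin//.
by apply: measurable_funTS; exact: measurable_comp_lipschitz bg.
Qed.

End line_integrals.

Section modulus.
Context {R : realType} {d : measure_display} {Z : metricMeasurableType d R}.
Variables (mu : {measure set Z -> \bar R}) (p : R).
Hypothesis p1 : 1 <= p.
Hypothesis mu_open : forall U : set Z, open U -> measurable U.
Local Open Scope ereal_scope.

Let p0 : (0 < p)%R. Proof. exact: lt_le_trans p1. Qed.
Let p_neq0 : p != 0%R. Proof. by rewrite gt_eqF. Qed.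

Lemma borel_measurable (g : Z -> \bar R) : borel_fun g -> measurable_fun setT g.
Proof. by move=> bg; apply: (measurable_comp_borel (h := idfun)). Qed.

Lemma measurable_powp (g : Z -> \bar R) : borel_fun g ->
  measurable_fun setT (fun x => g x `^ p).
Proof.
move=> bg; apply: (measurableT_comp (measurable_poweR p)); exact: borel_measurable.
Qed.

Lemma LnormE (g : Z -> \bar R) : (forall x, 0 <= g x) ->
  'N[mu]_p%:E[g] = (\int[mu]_x (g x `^ p)) `^ p^-1.
Proof.
move=> g0; rewrite unlock; congr (_ `^ _); apply: eq_integral => x _.
by rewrite gee0_abs.
Qed.

Lemma Lnorm_lty (g : Z -> \bar R) : (forall x, 0 <= g x) ->
  'N[mu]_p%:E[g] < +oo <-> \int[mu]_x (g x `^ p) < +oo.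
Proof.
move=> g0; rewrite LnormE//; split; last exact: poweR_lty.
by apply: lty_poweRy; rewrite invr_eq0.
Qed.

Lemma le_Lnorm (g g' : Z -> \bar R) : (forall x, 0 <= g x) ->
  (forall x, g x <= g' x) -> 'N[mu]_p%:E[g] <= 'N[mu]_p%:E[g'].
Proof.
move=> g0 gg'; have g'0 x : 0 <= g' x by exact: le_trans (gg' x).
rewrite !LnormE//; apply: lee_poweR; first by rewrite invr_ge0 ltW.
  by apply: integral_ge0 => x _; exact: poweR_ge0.
apply: le_lower_integral => x _; first exact: poweR_ge0.
by apply: lee_poweR => //; exact: ltW.
Qed.

(** The [f n] stand for p-th powers, so that the energy of the combination is exactly the sum of
    their integrals. *)
Definition lp_sum (f : nat -> Z -> \bar R) x := (\sum_(n <oo) f n x) `^ p^-1.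

Lemma lp_sum_borel (f : nat -> Z -> \bar R) : (forall n, borel_fun (f n)) ->
  (forall n x, 0 <= f n x) -> borel_fun (lp_sum f).
Proof.
move=> bf f0; apply/borel_funP.
apply: (measurableT_comp (measurable_poweR p^-1)).
apply: (@ge0_emeasurable_sum _ (g_sigma_algebraType (@open Z)) R setT f xpredT) => //.
by move=> k _; have /borel_funP := bf k.
Qed.

Lemma lp_sum_energy (f : nat -> Z -> \bar R) : (forall n, borel_fun (f n)) ->
  (forall n x, 0 <= f n x) ->
  \int[mu]_x (lp_sum f x `^ p) = \sum_(n <oo) \int[mu]_x f n x.
Proof.
move=> bf f0; rewrite -integral_nneseries//; last by move=> n; exact: borel_measurable.
apply: eq_integral => x _; rewrite /lp_sum poweRVK// nneseries_ge0//.
Qed.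

Lemma borel_funZ_powp (g : Z -> \bar R) (k : R) : borel_fun g ->
  borel_fun (fun x => k%:E * g x `^ p).
Proof.
move=> /borel_funP bg; apply/borel_funP; apply: emeasurable_funM => //.
exact: (measurableT_comp (measurable_poweR p) bg).
Qed.

(** Countable unions of exceptional families: a curve along which the majorant [r] has finite
    integral has finite integral of every [r_ n], hence avoids all the families they detect. *)
Lemma ex_lp_majorant (r_ : nat -> Z -> \bar R) :
  (forall n, borel_fun (r_ n)) -> (forall n x, 0 <= r_ n x) ->
  (forall n, 'N[mu]_p%:E[r_ n] < +oo) ->
  exists r, [/\ forall x, 0 <= r x, borel_fun r, 'N[mu]_p%:E[r] < +oo &
    forall n, exists2 k : R, (0 <= k)%R & forall x, r_ n x <= k%:E * r x].
Proof.
move=> br r0 rfin.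
pose I n := fine (\int[mu]_x (r_ n x `^ p)).
have I0 n : (0 <= I n)%R by apply: fine_ge0; apply: integral_ge0 => x _; exact: poweR_ge0.
have IE n : \int[mu]_x (r_ n x `^ p) = (I n)%:E.
  rewrite fineK// ge0_fin_numE; last by apply: integral_ge0 => x _; exact: poweR_ge0.
  exact/Lnorm_lty.
(* These weights bound the n-th energy by $2^{-(n+1)}$, so the total energy is at most 1; [1 + I n]
   avoids a division by zero. *)
pose w n := ((2 ^+ n.+1)^-1 / (1 + I n))%R.
have w0 n : (0 < w n)%R.
  by rewrite divr_gt0 ?invr_gt0 ?exprn_gt0// ltr_pwDl.
pose f n x := (w n)%:E * r_ n x `^ p.
have f0 n x : 0 <= f n x by rewrite mule_ge0 ?poweR_ge0// lee_fin ltW.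
have bf n : borel_fun (f n) by apply: borel_funZ_powp.
have r_ge0 x : 0 <= lp_sum f x by exact: poweR_ge0.
exists (lp_sum f); split => //; first exact: lp_sum_borel.
  apply/Lnorm_lty => //; rewrite lp_sum_energy//.
  apply: (@le_lt_trans _ _ 1); last by rewrite ltey.
  rewrite -(@nneseries_half R); apply: lee_nneseries => n _.
    by move=> _; apply: integral_ge0.
  rewrite ge0_integralZl_EFin//; last 3 first.
  - by move=> x _; exact: poweR_ge0.
  - exact: measurable_powp.
  - by rewrite ltW.
  rewrite IE -EFinM lee_fin /w -mulrA ler_piMr ?invr_ge0 ?exprn_ge0//.
  by rewrite mulrC ler_pdivrMr ?mul1r ?lerDr// ltr_pwDl.
move=> n; exists ((w n)^-1 `^ p^-1)%R; first exact: powR_ge0.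
move=> x; have pV0 : (0 <= p^-1)%R by rewrite invr_ge0 ltW.
have := lee_poweR pV0 (f0 n x) (nneseries_ge_term n (f0 ^~ x)).
rewrite -/(lp_sum f x) [in leLHS]/f poweRM ?poweR_ge0 ?lee_fin ?(ltW (w0 n))// poweRK//.
move=> H; apply: le_trans (lee_wpmul2l _ H); last by rewrite lee_fin powR_ge0.
rewrite muleA poweR_EFin -EFinM -powRM ?invr_ge0 ?(ltW (w0 n))//.
by rewrite mulVf ?gt_eqF// powR1 mul1e.
Qed.

Lemma upper_gradient_wug (u g : Z -> \bar R) :
  upper_gradient u g -> weak_upper_gradient mu p u g.
Proof.
move=> [g0 bg ug]; split => //; exists (cst 0); split.
- by [].
- by apply/borel_funP.
- apply/Lnorm_lty => //; rewrite integral0_eq// => x _; exact: poweR0r.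
- by move=> c [rc] []; exact: ug.
Qed.

(** Adding [k * r], with [r] of infinite integral along every exceptional curve, makes the
    inequality trivial on those curves; a small [k] keeps the energy under control. *)
Lemma weak_upper_gradient_approx (u g : Z -> \bar R) (e : R) : (0 < e)%R ->
  weak_upper_gradient mu p u g -> 'N[mu]_p%:E[g] < +oo ->
  exists g', upper_gradient u g' /\
    \int[mu]_x (g' x `^ p) <= (2 `^ p)%:E * (\int[mu]_x (g x `^ p)) + e%:E.
Proof.
move=> e0 [g0 bg [r [r0 br rfin rG]]] gfin.
pose I := fine (\int[mu]_x (r x `^ p)).
have I0 : (0 <= I)%R by apply: fine_ge0; apply: integral_ge0 => x _; exact: poweR_ge0.
have IE : \int[mu]_x (r x `^ p) = I%:E.
  rewrite fineK// ge0_fin_numE; last by apply: integral_ge0 => x _; exact: poweR_ge0.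
  exact/Lnorm_lty.
(* Then $2^p k^p I = e\,I/(1+I)\le e$, the factor $2^p$ being that of [poweRD_le]. *)
pose k := ((e / (2 `^ p * (1 + I))) `^ p^-1)%R.
have den0 : (0 < 2 `^ p * (1 + I))%R by rewrite mulr_gt0 ?powR_gt0// ltr_pwDl.
have k0 : (0 < k)%R by rewrite powR_gt0// divr_gt0.
have kr0 x : 0 <= k%:E * r x by rewrite mule_ge0// lee_fin ltW.
have kp : (k `^ p = e / (2 `^ p * (1 + I)))%R.
  by rewrite -powRrM mulVf// powRr1// divr_ge0// ltW.
have bkr : borel_fun (fun x => k%:E * r x).
  by apply/borel_funP; apply: emeasurable_funM => //; exact/borel_funP.
exists (fun x => g x + k%:E * r x); split.
  split.
  - by move=> x; rewrite adde_ge0.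
  - by apply/borel_funP; apply: emeasurable_funD; [exact/borel_funP|exact/borel_funP].
  - move=> c rc; have [gi|gi] := pselect (gradient_ineq u g c).
      by apply: le_trans gi _; apply: le_line_integral => // x; rewrite leeDl.
    rewrite /gradient_ineq (_ : line_integral _ _ = +oo) ?leey//.
    apply/eqP; rewrite -leye_eq.
    apply: (@le_trans _ _ (line_integral c (fun x => k%:E * r x))).
      rewrite line_integralZ//; last exact: ltW.
      by rewrite rG// gt0_muley// lte_fin.
    by apply: le_line_integral => // x; rewrite leeDr.
apply: (@le_trans _ _ (\int[mu]_x ((2 `^ p)%:E * (g x `^ p + (k%:E * r x) `^ p)))).
  apply: le_lower_integral => x _; first exact: poweR_ge0.
  by apply: poweRD_le => //; exact: ltW.
have mg := measurable_powp bg.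
have mkr := measurable_powp bkr.
rewrite ge0_integralZl_EFin//;
  try first [by move=> x _; rewrite adde_ge0// poweR_ge0|
    exact: emeasurable_funD|exact: powR_ge0].
rewrite ge0_integralD//; try by move=> x _; exact: poweR_ge0.
rewrite ge0_muleDr; [|by apply: integral_ge0 => x _; exact: poweR_ge0..].
rewrite leeD2l//.
under eq_integral do rewrite poweRM ?lee_fin ?(ltW k0)// poweR_EFin kp.
rewrite ge0_integralZl_EFin//;
  try first [by move=> x _; exact: poweR_ge0|exact: measurable_powp|
    by rewrite divr_ge0// ltW].
rewrite IE -!EFinM lee_fin mulrA.
have -> : (2 `^ p * (e / (2 `^ p * (1 + I))) = e / (1 + I))%R.
  have h1 : (2 `^ p != 0)%R by rewrite gt_eqF// powR_gt0.
  have h2 : (1 + I != 0)%R by rewrite gt_eqF// ltr_pwDl.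
  by field; rewrite h1 h2.
by rewrite -mulrA ler_piMr ?(ltW e0)// mulrC ler_pdivrMr ?mul1r ?lerDr// ltr_pwDl.
Qed.

(* Weak upper gradients of a finite function are stable under countable infima
   of finite energy, so a minimizing sequence produces a minimizer. *)
Lemma ex_minimal_wug (v : Z -> R) :
  (exists g, weak_upper_gradient mu p (EFin \o v) g /\ 'N[mu]_p%:E[g] < +oo) ->
  exists g, is_minimal_wug mu p (EFin \o v) g.
Proof.
move=> [g1 [wg1 fg1]]; set u := EFin \o v.
pose S := [set N | exists g, weak_upper_gradient mu p u g /\ 'N[mu]_p%:E[g] = N].
have S0 N : S N -> 0 <= N by move=> [g [_ <-]]; exact: Lnorm_ge0.
have iS0 : 0 <= ereal_inf S by apply: le_ereal_inf_tmp => N /S0.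
have iSfin : ereal_inf S \is a fin_num.
  rewrite ge0_fin_numE//; apply: le_lt_trans fg1.
  by apply: ereal_inf_lbound; exists g1.
have /choice[g_ g_P] (n : nat) : exists g, weak_upper_gradient mu p u g /\
    'N[mu]_p%:E[g] < ereal_inf S + (n.+1%:R^-1)%:E.
  have n0 : (0 < n.+1%:R^-1 :> R)%R by [].
  have [N [g [wg <-]] gn] := lb_ereal_inf_adherent n0 iSfin.
  by exists g.
have g_0 n x : 0 <= g_ n x by have [[]] := g_P n.
have bg_ n : borel_fun (g_ n) by have [[]] := g_P n.
have fg_ n : 'N[mu]_p%:E[g_ n] < +oo.
  have [_ /lt_trans] := g_P n; apply.
  by rewrite -ge0_fin_numE ?fin_numD ?iSfin// adde_ge0.
have /choice[r_ r_P] (n : nat) : exists r,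
  [/\ forall x, 0 <= r x, borel_fun r, 'N[mu]_p%:E[r] < +oo &
        forall c, rectifiable c /\ ~ gradient_ineq u (g_ n) c -> line_integral c r = +oo].
  by have [[_ _ [r H]] _] := g_P n; exists r.
(* Interleaving both sequences gives one majorant: a curve on which it has finite integral is
   non-exceptional for every [g_ n] and has finite integral of every [g_ n]. *)
pose q_ n := if odd n then r_ n./2 else g_ n./2.
have [r [r0 br fr rq]] : exists r, [/\ forall x, 0 <= r x, borel_fun r,
   'N[mu]_p%:E[r] < +oo &
    forall n, exists2 k : R, (0 <= k)%R & forall x, q_ n x <= k%:E * r x].
  by apply: ex_lp_majorant => n; rewrite /q_; case: ifP => _ //; have [] := r_P n./2.
pose g x := ereal_inf (range (g_ ^~ x)).
have g0 x : 0 <= g x by apply: le_ereal_inf_tmp => _ [n _ <-].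
have gle n x : g x <= g_ n x by apply: ereal_inf_lbound; exists n.
have bg : borel_fun g.
  apply/borel_funP; have := @measurable_fun_einfs _ (g_sigma_algebraType (@open Z)) R setT g_
    (fun n => (borel_funP (g_ n)).1 (bg_ n)) 0%N.
  congr measurable_fun; apply/funext => x; rewrite /einfs /g; congr ereal_inf.
  by apply/seteqP; split => [_ [n _ <-]|_ [n _ <-]]; exists n.
have gmin : 'N[mu]_p%:E[g] <= ereal_inf S.
  apply/lee_addgt0Pr => e e0.
  have [n ne] : exists n, (n.+1%:R^-1 < e)%R.
    exists (Num.trunc e^-1); rewrite invf_plt ?posrE//.
    by have := Num.Theory.truncnS_gt e^-1.
  apply: le_trans (le_Lnorm g0 (gle n)) _; have [_ /ltW/le_trans] := g_P n; apply.
  by rewrite leeD2l// lee_fin ltW.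
exists g; split; [|by apply: le_lt_trans gmin _; rewrite -ge0_fin_numE|]; last first.
  by move=> h wh; apply: le_trans gmin _; apply: ereal_inf_lbound; exists h.
split => //; exists r; split => // c [rc ngc].
apply/eqP; rewrite -leye_eq leNgt; apply/negP => fcr; apply: ngc.
have [gam [lip gamE gam0 gamL]] := ex_arclength_lipschitz rc.
set L := fine (curve_length c) in gamE gamL.
have L0 : (0 <= L)%R by apply: fine_ge0; move: rc => /andP[/ltW].
have qfin n : line_integral c (q_ n) < +oo.
  have [k k0 qk] := rq n; apply: (@le_lt_trans _ _ (k%:E * line_integral c r)).
    rewrite -line_integralZ//; apply: le_line_integral => //.
    by move=> x; rewrite /q_; case: ifP => _ //; have [] := r_P n./2.
  by rewrite lte_mul_pinfty// ?lee_fin// ge0_fin_numE ?lte_fin.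
have gfin n : line_integral c (g_ n) < +oo.
  by have := qfin n.*2; rewrite /q_ odd_double doubleK.
have rfin n : line_integral c (r_ n) < +oo.
  by have := qfin n.*2.+1; rewrite /q_ /= odd_double/= uphalf_double.
have dom n : dominates (v \o gam) L (g_ n \o gam).
  split => //.
  - exact: measurable_comp_lipschitz.
  - by move=> x; exact: g_0.
  - by have := gfin n; rewrite (line_integral_lipschitz _ gamE).
  - move=> s t s0; rewrite le_eqVlt => /predU1P[<-|st] tL.
      by rewrite subrr normr0 integral_ge0// => x _; exact: g_0.
    have [c' [rc' cb ce cI]] := line_integral_sub (g_ n) rc lip gamE s0 st tL.
    (* The inequality must hold on subcurves too: an exceptional subcurve would give [r_ n] an
       infinite integral along the whole of [c]. *)
    have [gi|ngi] := pselect (gradient_ineq u (g_ n) c').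
      by move: gi; rewrite /gradient_ineq cb ce cI.
    have [rn0 brn _ rn] := r_P n.
    have := rn c' (conj rc' ngi); rewrite cI// => Ioo.
    have := rfin n; rewrite (line_integral_lipschitz _ gamE) -/L ltNge => /negP[].
    rewrite leye_eq -leye_eq -Ioo; apply: ge0_subset_integral => //.
    + by apply: measurable_funTS; exact: measurable_comp_lipschitz brn.
    + by apply: subset_itv; rewrite bnd_simp.
have [_ _ _ /(_ 0%R L (lexx _) L0 (lexx _))] := dominates_inf dom.
rewrite /gradient_ineq (line_integral_lipschitz _ gamE) -/L/=.
by rewrite gam0 gamL.
Qed.

End modulus.

(** * Powers, averages and dyadic scales *)

Section powers.
Context {R : realType}.
Variable p : R.
Hypothesis p1 : 1 <= p.
Let p0 : 0 < p. Proof. exact: lt_le_trans p1. Qed.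
Implicit Types (a b t e q : R).

Lemma le_powR a b r : 0 <= r -> 0 <= a -> a <= b -> a `^ r <= b `^ r.
Proof.
by move=> r0 a0 ab; apply: ge0_ler_powR => //; rewrite nnegrE// (le_trans a0).
Qed.

(** Either $t\le e$, or $t=t^{1-p}t^p\le e^{1-p}t^p$; this is uniform in $p\ge1$. *)
Lemma young_powR t e : 0 <= t -> 0 < e -> t <= e + e `^ (1 - p) * t `^ p.
Proof.
move=> t0 e0; have [te|et] := leP t e.
  by apply: le_trans te _; rewrite lerDl mulr_ge0// powR_ge0.
apply: (@le_trans _ _ (e `^ (1 - p) * t `^ p)); last by rewrite lerDr ltW.
have t'0 : 0 < t by exact: lt_trans et.
have -> : 1 - p = - (p - 1) by rewrite opprB.
rewrite powRN mulrC ler_pdivlMr ?powR_gt0//.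
rewrite -[leRHS](@mulr_powRB1 _ t p)//; apply: ler_wpM2l => //.
by apply: le_powR; rewrite ?subr_ge0// ltW.
Qed.

(** The factor of $b^p$ can be made as close to 1 as desired at the expense of that of $a^p$, which
    is what an iteration over many summands requires. *)
Lemma powRD_split a b h : 0 <= a -> 0 <= b -> 0 < h ->
  (a + b) `^ p <= (1 + h^-1) `^ p * a `^ p + (1 + h) `^ p * b `^ p.
Proof.
move=> a0 b0 h0; have h10 : 0 <= 1 + h by lra.
have h20 : 0 <= 1 + h^-1 by rewrite addr_ge0// invr_ge0 ltW.
have [ab|ba] := leP a (h * b).
  rewrite -[leLHS]add0r; apply: lerD; first by rewrite mulr_ge0// powR_ge0.
  rewrite -powRM//; apply: le_powR; [exact: ltW|exact: addr_ge0|].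
  by rewrite mulrDl mul1r addrC lerD2l.
rewrite -[leLHS]addr0; apply: lerD; last by rewrite mulr_ge0// powR_ge0.
rewrite -powRM//; apply: le_powR; [exact: ltW|exact: addr_ge0|].
by rewrite mulrDl mul1r lerD2l mulrC ler_pdivlMr// mulrC ltW.
Qed.

Lemma powRD_le a b : 0 <= a -> 0 <= b ->
  (a + b) `^ p <= 2 `^ p * (a `^ p + b `^ p).
Proof.
move=> a0 b0; have := powRD_split a0 b0 ltr01.
by rewrite invr1 -mulrDr.
Qed.

(** The discrete Hardy inequality. With [h] such that $(1+h)^p=q$, peeling off the first term
    multiplies the remaining ones by [q] each time, while the constant $(1+1/h)^p$ in front of the
    peeled terms does not accumulate. *)
Lemma powR_sum_le q : 1 < q -> exists2 K, 0 < K & forall n (b : nat -> R),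
  (forall m, 0 <= b m) ->
  (\sum_(m < n) b m) `^ p <= K * \sum_(m < n) q ^+ m * b m `^ p.
Proof.
move=> q1; pose h := q `^ p^-1 - 1.
have q0 : 0 < q by exact: lt_trans q1.
have h0 : 0 < h.
  have : 1 `^ p^-1 < q `^ p^-1.
    by apply: gt0_ltr_powR; rewrite ?nnegrE ?invr_gt0 ?(ltW q0).
  by rewrite powR1 subr_gt0.
have hq : (1 + h) `^ p = q.
  by rewrite /h addrC subrK -powRrM mulVf ?gt_eqF// powRr1// ltW.
have K0 : 0 < (1 + h^-1) `^ p by rewrite powR_gt0// addr_gt0// invr_gt0.
exists ((1 + h^-1) `^ p) => // n; elim: n => [|n ih] b b0.
  by rewrite !big_ord0 mulr0 powR0// gt_eqF.
rewrite !big_ord_recl/= expr0 mul1r.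
apply: le_trans (powRD_split (b0 _) _ h0) _; first exact: sumr_ge0.
rewrite hq mulrDr lerD2l; apply: le_trans (ler_wpM2l (ltW q0) (ih (b \o S) _)) _.
  by move=> m; exact: b0.
rewrite mulrCA ler_pM2l// mulr_sumr; apply: ler_sum => m _.
by rewrite mulrA -exprS.
Qed.

End powers.

Section averages.
Context {d : measure_display} {T : measurableType d} {R : realType}.
Variables (mu : {measure set T -> \bar R}) (p : R).
Hypothesis p1 : 1 <= p.
Let p0 : 0 < p. Proof. exact: lt_le_trans p1. Qed.
Local Open Scope ereal_scope.

Lemma averageE (Y : metricMeasurableType d R) (m : {measure set Y -> \bar R})
    (B : set Y) (v : R) (f : Y -> \bar R) : (0 < v)%R -> m B = v%:E ->
  average m B f = (v^-1)%:E * \int[m]_(x in B) f x.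
Proof. by move=> v0 mB; rewrite /average mB inver gt_eqF. Qed.

(** Integrate [young_powR] for [f]: the mean is at most $e+e^{1-p}I$, where $I$ is the mean of
    $f^p$. At $e=I^{1/p}$ both terms equal $I^{1/p}$, whence the factor $2^p$. *)
Lemma jensen_powR (B : set T) (v : R) (f : T -> \bar R) :
  measurable B -> (0 < v)%R -> mu B = v%:E -> measurable_fun B f ->
  (forall x, 0 <= f x) ->
  ((v^-1)%:E * \int[mu]_(x in B) f x) `^ p <=
  (2 `^ p)%:E * ((v^-1)%:E * \int[mu]_(x in B) (f x `^ p)).
Proof.
move=> mB v0 muB mf f0.
have fp0 x : 0 <= f x `^ p by exact: poweR_ge0.
have mfp : measurable_fun B (fun x => f x `^ p).
  exact: (measurableT_comp (measurable_poweR p)).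
set I := (v^-1)%:E * \int[mu]_(x in B) (f x `^ p).
have I0 : 0 <= I by rewrite mule_ge0 ?integral_ge0// lee_fin invr_ge0 ltW.
have [->|Ioo] := eqVneq I +oo.
  by rewrite gt0_muley ?leey// lte_fin powR_gt0.
have /fineK IE : I \is a fin_num by rewrite ge0_fin_numE// ltey.
have a0 : (0 <= fine I)%R by exact: fine_ge0.
have H (e : R) : (0 < e)%R ->
    (v^-1)%:E * \int[mu]_(x in B) f x <= (e + e `^ (1 - p) * fine I)%:E.
  move=> e0; have c0 : (0 <= e `^ (1 - p))%R by exact: powR_ge0.
  apply: (@le_trans _ _ ((v^-1)%:E * \int[mu]_(x in B)
      (e%:E + (e `^ (1 - p))%:E * f x `^ p))).
    apply: lee_wpmul2l; first by rewrite lee_fin invr_ge0 ltW.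
    apply: le_lower_integral => // x _; case: (f x) (f0 x) => [r| |//].
      by rewrite lee_fin poweR_EFin -EFinM -EFinD lee_fin => r0; exact: young_powR.
    by rewrite poweRyr ?gt_eqF// gt0_muley ?lte_fin ?powR_gt0// addey.
  rewrite ge0_integralD//; last 3 first.
  - by move=> x _; rewrite lee_fin ltW.
  - by move=> x _; rewrite mule_ge0// lee_fin.
  - by apply: emeasurable_funM.
  rewrite integral_cst// ge0_integralZl_EFin// muB ge0_muleDr; last 2 first.
  - by rewrite -EFinM lee_fin mulr_ge0// ltW.
  - by rewrite mule_ge0 ?integral_ge0// lee_fin.
  rewrite [X in _ + X]muleCA -/I -!EFinM -[X in _ + _ * X]IE -!EFinM -EFinD lee_fin mulrCA mulVf ?mulr1//.
  by rewrite gt_eqF.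
have J0 : 0 <= (v^-1)%:E * \int[mu]_(x in B) f x.
  by rewrite mule_ge0 ?integral_ge0// lee_fin invr_ge0 ltW.
(* For $I=0$ the choice $e=I^{1/p}$ is not allowed; instead $e$ tends to 0. *)
have [aE|a1] := eqVneq (fine I) 0%R.
  have -> : (v^-1)%:E * \int[mu]_(x in B) f x = 0.
    apply/eqP; rewrite eq_le J0 andbT; apply/lee_addgt0Pr => e e0.
    by rewrite add0e; apply: le_trans (H e e0) _; rewrite aE mulr0 addr0.
  by rewrite poweR0r ?gt_eqF// mule_ge0// lee_fin powR_ge0.
have {}a0 : (0 < fine I)%R by rewrite lt_neqAle eq_sym a1.
have e0 : (0 < fine I `^ p^-1)%R by rewrite powR_gt0.
have := H _ e0; rewrite -[X in (_ + _ * X)%R](@powRr1 _ (fine I)) ?(ltW a0)//.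
rewrite -[X in (_ + _ * _ `^ X)%R](@mulVf _ p) ?gt_eqF// powRrM -powRD; last first.
  by apply/implyP => _; rewrite gt_eqF.
rewrite subrK powRr1 ?(ltW e0)// => {}H.
apply: le_trans (lee_poweR (ltW p0) J0 H) _.
rewrite poweR_EFin -[X in _ <= _ * X]IE -EFinM lee_fin.
have -> : (fine I `^ p^-1 + fine I `^ p^-1 = 2 * fine I `^ p^-1)%R by ring.
by rewrite powRM// ?(ltW e0)// -powRrM mulVf ?gt_eqF// powRr1// ltW.
Qed.

Lemma integrable_cst_fin (B : set T) (v c : R) : measurable B -> mu B = v%:E ->
  mu.-integrable B (cst c%:E).
Proof.
move=> mB muB; apply/integrableP; split; first exact: measurable_cst.
by rewrite /= integral_cst// muB -EFinM ltey.
Qed.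

Lemma mean_dist (B : set T) (v c : R) (u : T -> \bar R) :
  measurable B -> (0 < v)%R -> mu B = v%:E -> mu.-integrable B u ->
  (`|v^-1 * fine (\int[mu]_(x in B) u x) - c|)%:E <=
  (v^-1)%:E * \int[mu]_(x in B) `|u x - c%:E|.
Proof.
move=> mB v0 muB iu; have ic := integrable_cst_fin c mB muB.
have Ifin := integrable_fin_num mB iu.
have mu_ := measurable_int mu iu.
apply: (@le_trans _ _ ((v^-1)%:E * `|\int[mu]_(x in B) (u x - c%:E)|)).
  have -> : \int[mu]_(x in B) (u x - c%:E) = \int[mu]_(x in B) u x - \int[mu]_(x in B) (cst c%:E) x.
    exact: integralB.
  have -> : \int[mu]_(x in B) u x - \int[mu]_(x in B) (cst c%:E) x =
      (fine (\int[mu]_(x in B) u x) - c * v)%:E.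
    by rewrite integral_cst// muB EFinB EFinM fineK.
  rewrite abse_EFin -EFinM lee_fin.
  set I := fine _; have -> : (v^-1 * I - c = v^-1 * (I - c * v))%R.
    by field; rewrite gt_eqF.
  by rewrite normrM gtr0_norm ?invr_gt0.
apply: lee_wpmul2l; first by rewrite lee_fin invr_ge0 ltW.
apply: le_abse_integral => //; apply: emeasurable_funB => //; exact: measurable_cst.
Qed.

Lemma overlap_sum (D : set T) (B : nat -> set T) (N : R) (h : T -> \bar R) :
  measurable D -> (forall l, measurable (B l)) -> (forall l, B l `<=` D) ->
  measurable_fun D h -> (forall x, 0 <= h x) ->
  (forall x n, D x -> (\sum_(l < n) (x \in B l)%:R <= N)%R) ->
  \sum_(l <oo) \int[mu]_(x in B l) h x <= N%:E * \int[mu]_(x in D) h x.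
Proof.
move=> mD mB BD mh h0 ov.
have mBh l : measurable_fun D (fun x => (\1_(B l) x)%:E * h x).
  apply: emeasurable_funM => //; apply/measurable_EFinP.
  exact: measurable_indic.
have -> : \sum_(l <oo) \int[mu]_(x in B l) h x =
    \sum_(l <oo) \int[mu]_(x in D) ((\1_(B l) x)%:E * h x).
  apply: eq_eseriesr => l _; rewrite -[in LHS](setIidr (BD l)) integral_mkcondr.
  apply: eq_integral => x _; rewrite patchE indicE.
  by case: (x \in B l); rewrite ?mul1e ?mul0e.
rewrite -integral_nneseries//; last first.
  by move=> l x _; rewrite mule_ge0// lee_fin.
(* The overlap hypothesis, taken with no terms, gives [N] its sign as soon as [D] has a point. *)
have N0 : (0 <= N)%R \/ D = set0.
  have [->|/set0P[x Dx]] := eqVneq D set0; [by right|left].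
  by have := ov x 0%N Dx; rewrite big_ord0.
case: N0 => [N0|->]; last by rewrite !integral_set0 mule0.
rewrite -ge0_integralZl_EFin//; apply: le_lower_integral => x Dx.
  by apply: nneseries_ge0 => l _ _; rewrite mule_ge0// lee_fin.
apply: lime_le; first by apply: is_cvg_nneseries => l _ _; rewrite mule_ge0// lee_fin.
apply: nearW => n; rewrite big_mkord.
under eq_bigr do rewrite indicE.
rewrite -ge0_sume_distrl; last by move=> l _; rewrite lee_fin.
by apply: lee_wpmul2r => //; rewrite sumEFin lee_fin; exact: ov.
Qed.

(** Borel-Cantelli in integral form: the sum of the series is integrable, hence almost everywhere
    finite. *)
Lemma ae_summable (h : nat -> T -> \bar R) : (forall n, measurable_fun setT (h n)) ->
  (forall n x, 0 <= h n x) -> \sum_(n <oo) \int[mu]_x h n x < +oo ->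
  {ae mu, forall x, \sum_(n <oo) h n x < +oo}.
Proof.
move=> mh h0 fin.
have s0 x : 0 <= \sum_(n <oo) h n x by exact: nneseries_ge0.
have : mu.-integrable setT (fun x => \sum_(n <oo) h n x).
  apply/integrableP; split.
    exact: (@ge0_emeasurable_sum _ _ R setT h xpredT).
  under eq_integral do rewrite gee0_abs//.
  by rewrite integral_nneseries.
move=> /(integrable_ae measurableT); apply: filterS => x /(_ Logic.I).
by rewrite ge0_fin_numE.
Qed.

Lemma nneseries_cvg0 (u : nat -> \bar R) : (forall n, 0 <= u n) ->
  \sum_(n <oo) u n < +oo -> u n @[n --> \oo] --> 0.
Proof.
move=> u0 /nneseries_tail_cvg => /(_ (fun n _ => u0 n)) tl.
apply: (@squeeze_cvge _ _ _ _ (cst 0) _ (fun N => \sum_(N <= k <oo) u k)) => //; last exact: cvg_cst.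
apply: nearW => n; rewrite u0/= (@nneseries_split _ _ n 1)//.
by rewrite addn1 big_nat1 leeDl// nneseries_ge0.
Qed.

End averages.

Section dyadic.
Context {R : realType}.

(** The enumeration 0, -1, 1, -2, ... turns sums over all scales into series indexed by [nat]. *)
Definition int_enum (n : nat) : int := if odd n then Negz n./2 else Posz n./2.

Lemma int_enum_inj : injective int_enum.
Proof.
move=> m n; rewrite /int_enum; have := odd_double_half m; have := odd_double_half n.
by case: (odd m); case: (odd n) => //= hn hm [e]; rewrite -hm -hn e.
Qed.

Lemma int_enum_surj k : exists n, int_enum n = k.
Proof.
case: k => n; first by exists n.*2; rewrite /int_enum odd_double doubleK.
by exists n.*2.+1; rewrite /int_enum /= odd_double/= uphalf_double.
Qed.

Definition sc (k : int) : R := 2 ^ k.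

Lemma sc_gt0 k : 0 < sc k. Proof. by rewrite exprz_gt0. Qed.

Lemma scD k l : sc (k + l) = sc k * sc l.
Proof. by rewrite /sc expfzDr. Qed.

Lemma scS k : sc (k + 1) = 2 * sc k.
Proof. by rewrite scD mulrC /sc expr1z. Qed.

Lemma scB1 k : sc k = 2 * sc (k - 1).
Proof. by rewrite -scS subrK. Qed.

Lemma sc_le k l : k <= l -> sc k <= sc l.
Proof. by move=> kl; apply: ler_weXz2l => //; rewrite ler1n. Qed.

Lemma sc_nat (n : nat) : sc n = 2 ^+ n. Proof. by []. Qed.

Lemma sc_powR k r : sc k `^ r = (2 `^ r) ^ k.
Proof.
rewrite /sc -powR_intmul// -powRrM mulrC powRrM powR_intmul// powR_ge0.
Qed.

Lemma sc_lt_inj k l : sc k < sc (l + 1) -> k <= l.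
Proof. move=> kl; rewrite leNgt; apply/negP => lk.
have : sc (l + 1) <= sc k by apply: sc_le; lia.
by rewrite leNgt kl. Qed.

Lemma ex_scale r : 0 < r -> exists k, sc k <= r < sc (k + 1).
Proof.
move=> r0.
have up x : 0 < x -> exists n : nat, x < sc n.
  move=> x0; exists (Num.trunc x).+1; apply: lt_le_trans (truncnS_gt x) _.
  by rewrite sc_nat -natrX ler_nat ltnW// ltn_expl.
have [n rn] := up _ r0.
have r'0 : 0 < r^-1 by rewrite invr_gt0.
have [m rm] := up _ r'0.
have lo : sc (- m%:Z) < r.
  have -> : sc (- m%:Z) = (sc m)^-1 by rewrite /sc invr_expz.
  by rewrite invf_plt ?posrE ?sc_gt0.
have H : exists N : nat, r < sc (- m%:Z + N%:Z).
  exists (m + n)%N; apply: lt_le_trans rn _; apply: sc_le.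
  by rewrite PoszD addrA addNr add0r.
have [N rN minN] := ex_minnP H.
case: N rN minN => [|N] rN minN.
  by move: rN; rewrite addr0 => /lt_trans/(_ lo); rewrite ltxx.
exists (- m%:Z + N%:Z); rewrite leNgt; apply/andP; split.
  by apply/negP => /minN; rewrite ltnn.
by rewrite -addrA -[X in _ + (_ + X)]/(1%:Z) -PoszD addn1.
Qed.

Lemma ex_scale_oc r : 0 < r -> exists k, sc (k - 1) < r <= sc k.
Proof.
move=> r0; have [k /andP[]] := ex_scale r0; rewrite le_eqVlt => /predU1P[kr _|kr rk].
  by exists k; rewrite -kr lexx andbT [ltRHS]scB1 mulr_natl mulr2n ltrDl sc_gt0.
by exists (k + 1); rewrite addrK kr ltW.
Qed.

Lemma scale_count (a b : R) : 0 < a -> 0 < b -> exists N : R,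
  forall (t : R) (m : int) (n : nat),
  \sum_(l < n) ((a * sc (int_enum l + m) < t) && (t < b * sc (int_enum l + m)))%R%:R <= N.
Proof.
move=> a0 b0; have [c bc] : exists c : nat, b / a <= 2 ^+ c.
  exists (Num.trunc (b / a)).+1; apply: le_trans (ltW (truncnS_gt _)) _.
  by rewrite -natrX ler_nat ltnW// ltn_expl.
exists (2 * c)%:R => t m n.
pose P k := (a * sc (k + m) < t) && (t < b * sc (k + m)).
have near k l : P k -> P l -> k < l + c%:Z.
  move=> /andP[k1 _] /andP[_ l2]; rewrite ltNge; apply/negP => lk.
  have : a * sc (k + m) < b * sc (l + m) by exact: lt_trans l2.
  apply/negP; rewrite -leNgt.
  apply: (@le_trans _ _ (a * (2 ^+ c * sc (l + m)))); last first.
    rewrite ler_pM2l// -sc_nat -scD; apply: sc_le; lia.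
  by rewrite mulrA ler_pM2r ?sc_gt0// mulrC -ler_pdivrMr.
rewrite -natr_sum ler_nat.
pose s := [seq int_enum l | l <- iota 0 n & P (int_enum l)].
have us : uniq s by rewrite map_inj_uniq ?filter_uniq ?iota_uniq//; exact: int_enum_inj.
have sP k : k \in s -> P k by move=> /mapP[l]; rewrite mem_filter => /andP[? _] ->.
have -> : (\sum_(l < n) (P (int_enum l) : nat) = size s)%N.
  rewrite size_map size_filter -sum1_count.
  have -> : iota 0 n = index_iota 0 n by rewrite /index_iota subn0.
  by rewrite [RHS]big_mkcond big_mkord; apply: eq_bigr => l _; case: (P _).
case E : s us sP => [//|k0 s'] us sP; rewrite -E in us sP *.
have k0s : P k0 by apply: sP; rewrite E mem_head.
rewrite -(size_iota 0 (2 * c)) -(size_map (fun k : int => absz (k - k0 + c%:Z)%R)).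
apply: uniq_leq_size.
  rewrite map_inj_in_uniq// => k l /sP Pk /sP Pl.
  have := near _ _ k0s Pk; have := near _ _ k0s Pl; lia.
move=> _ /mapP[k /sP Pk ->]; rewrite mem_iota/=.
have := near _ _ k0s Pk; have := near _ _ Pk k0s; lia.
Qed.

Local Notation leb := (@lebesgue_measure R).
Local Open Scope ereal_scope.

Definition zsum (f : int -> \bar R) := \sum_(n <oo) f (int_enum n).

Let J k : set R := `]sc (k - 1), sc k]%classic.

Let J_sub k : J k `<=` `]0%R, +oo[%classic.
Proof.
move=> r; rewrite /J /= !in_itv/= andbT => /andP[+ _].
by apply: lt_trans; exact: sc_gt0.
Qed.

Let J_measure k : leb (J k) = (sc (k - 1))%:E.
Proof.
rewrite /J lebesgue_measure_itv/= lte_fin [X in (_ < X)%R]scB1.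
rewrite mulr_natl mulr2n ltrDl sc_gt0 -EFinB; congr EFin.
by rewrite (scB1 k) mulr_natl mulr2n addrK.
Qed.

Let J_uniq k l r : J k r -> J l r -> k = l.
Proof.
rewrite /J /= !in_itv/= => /andP[k1 k2] /andP[l1 l2].
apply/eqP; rewrite eq_le; apply/andP; split; apply: sc_lt_inj.
- by rewrite (scB1 k) scS ltr_pM2l//; exact: lt_le_trans k1 l2.
- by rewrite (scB1 l) scS ltr_pM2l//; exact: lt_le_trans l1 k2.
Qed.

Let integral_step (b : int -> \bar R) : (forall k, 0 <= b k) ->
  \int[leb]_(r in `]0%R, +oo[) (\sum_(n <oo) ((\1_(J (int_enum n)) r)%:E * b (int_enum n)))
  = zsum (fun k => (sc (k - 1))%:E * b k).
Proof.
move=> b0; rewrite integral_nneseries//; last 2 first.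
- move=> n; apply: emeasurable_funM => //; apply/measurable_EFinP.
  by apply: measurable_indic; exact: measurable_itv.
- by move=> n r _; rewrite mule_ge0// lee_fin.
apply: eq_eseriesr => n _; rewrite ge0_integralZr//; last first.
  apply/measurable_EFinP.
  by apply: measurable_indic; exact: measurable_itv.
congr (_ * _); rewrite integral_indic//; last exact: measurable_itv.
by rewrite -[RHS]J_measure; congr (leb _); exact/setIidl/J_sub.
Qed.

Lemma zsum_ge0 (f : int -> \bar R) : (forall k, 0 <= f k) -> 0 <= zsum f.
Proof. by move=> f0; apply: nneseries_ge0. Qed.

Lemma le_zsum (f g : int -> \bar R) : (forall k, 0 <= f k) ->
  (forall k, f k <= g k) -> zsum f <= zsum g.
Proof. by move=> f0 fg; apply: lee_nneseries. Qed.

Lemma zsumZl (c : R) (f : int -> \bar R) : (forall k, 0 <= f k) ->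
  zsum (fun k => c%:E * f k) = c%:E * zsum f.
Proof. by move=> f0; rewrite /zsum nneseriesZl. Qed.

Lemma zsum_ge_term (f : int -> \bar R) k : (forall k, 0 <= f k) -> f k <= zsum f.
Proof.
move=> f0; have [n <-] := int_enum_surj k.
by apply: (nneseries_ge_term n) => m.
Qed.

Lemma zsum_shift (f : int -> \bar R) (m : int) : (forall k, 0 <= f k) ->
  zsum (fun k => f (k + m)%R) = zsum f.
Proof.
have bij : set_bij [set: nat] [set: int] int_enum.
  by split => // [k l _ _|k _]; [exact: int_enum_inj|
    have [n <-] := int_enum_surj k; exists n].
have E (g : int -> \bar R) : (forall k, 0 <= g k) ->
    zsum g = \esum_(k in [set: int]) g k.
  by move=> g0; rewrite /zsum nneseries_esumT// (reindex_esum _ _ _ _ bij).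
move=> f0; rewrite !E//.
rewrite [RHS](reindex_esum [set: int] [set: int] (fun k => k + m)%R)//.
split => // [k l _ _|k _]; first exact: addIr.
by exists (k - m)%R => //; rewrite subrK.
Qed.

(** On $]2^{k-1},2^k]$, of length $2^{k-1}$, one has $1/r\le 2^{1-k}$, so this interval contributes
    at most [b k]. The comparison with a step function is made inside the lower integral, from the
    pointwise bound alone. *)
Lemma dyadic_upper (H : R -> \bar R) (b : int -> \bar R) :
  (forall r, 0 <= H r) -> (forall k, 0 <= b k) ->
  (forall k r, (sc (k - 1) < r <= sc k)%R -> H r <= b k) ->
  \int[leb]_(r in `]0%R, +oo[) (H r * (r^-1)%:E) <= zsum b.
Proof.
move=> H0 b0 Hb.
have c0 k : (0 < (sc (k - 1))^-1)%R by rewrite invr_gt0 sc_gt0.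
pose c k := ((sc (k - 1))^-1)%:E * b k.
have cc0 k : 0 <= c k by rewrite mule_ge0// lee_fin ltW.
rewrite (_ : zsum b = zsum (fun k => (sc (k - 1))%:E * c k)); last first.
  rewrite /zsum; apply: eq_eseriesr => n _.
  by rewrite /c muleA -EFinM mulfV ?mul1e// gt_eqF// sc_gt0.
rewrite -integral_step//; apply: le_lower_integral => r.
  by rewrite /= in_itv/= andbT => r0; rewrite mule_ge0// lee_fin invr_ge0 ltW.
rewrite /= in_itv/= andbT => r0.
have [k kr] := ex_scale_oc r0; have [n nk] := int_enum_surj k.
apply: le_trans (nneseries_ge_term n _); last first.
  by move=> m; rewrite mule_ge0// lee_fin.
rewrite nk indicE mem_set ?mul1e; last by rewrite /J /= in_itv.
rewrite /c muleC; apply: lee_pmul => //; last exact: Hb.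
  by rewrite lee_fin invr_ge0 ltW.
by rewrite lee_fin lef_pV2 ?posrE// ?sc_gt0// ltW//; case/andP: kr.
Qed.

(** Here $1/r\ge 2^{-k}$ on an interval of length $2^{k-1}$, which leaves half of [b k]; hence the
    factor 2. *)
Lemma dyadic_lower (H : R -> \bar R) (b : int -> \bar R) :
  (forall r, 0 <= H r) -> (forall k, 0 <= b k) ->
  (forall k r, (sc (k - 1) < r <= sc k)%R -> b k <= H r) ->
  zsum b <= 2%:E * \int[leb]_(r in `]0%R, +oo[) (H r * (r^-1)%:E).
Proof.
move=> H0 b0 Hb.
have c0 k : (0 < (sc k)^-1)%R by rewrite invr_gt0 sc_gt0.
pose c k := ((sc k)^-1)%:E * b k.
have cc0 k : 0 <= c k by rewrite mule_ge0// lee_fin ltW.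
have -> : zsum b = 2%:E * zsum (fun k => (sc (k - 1))%:E * c k).
  rewrite /zsum -nneseriesZl; last by move=> n _; rewrite mule_ge0// lee_fin ltW// sc_gt0.
  apply: eq_eseriesr => n _; rewrite /c !muleA -!EFinM -scB1.
  by rewrite mulfV ?mul1e// gt_eqF// sc_gt0.
apply: lee_wpmul2l => //; rewrite -integral_step//; apply: le_lower_integral => r.
  by move=> _; apply: nneseries_ge0 => n _ _; rewrite mule_ge0// lee_fin.
rewrite /= in_itv/= andbT => r0.
have [k kr] := ex_scale_oc r0; have [n nk] := int_enum_surj k.
have Jkr : J k r by rewrite /J /= in_itv.
rewrite (@nneseriesD1 _ _ n); [|by move=> m _; rewrite mule_ge0// lee_fin|by []].
rewrite eseries0 ?adde0; last first.
  move=> m _ /= mn; rewrite indicE memNset ?mul0e// => Jm.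
  move: mn; rewrite -(inj_eq int_enum_inj) nk => /eqP; apply.
  exact: J_uniq Jm Jkr.
rewrite nk indicE mem_set// mul1e /c muleC; apply: lee_pmul => //.
- by rewrite lee_fin ltW.
- exact: Hb.
- by rewrite lee_fin lef_pV2 ?posrE// ?sc_gt0//; case/andP: kr.
Qed.

End dyadic.

(** * Subdivision of curves, Lipschitz functions and limits *)

Section metric_prelim.
Context {R : realType}.

Lemma open_mball (Z : metricType R) (x : Z) (r : R) : open (ball x r).
Proof.
rewrite openE => y; rewrite ballEmdist /= => xy.
apply/nbhs_ballP; exists (r - mdist x y); first by rewrite /= subr_gt0.
move=> z; rewrite !ballEmdist/= ltrBrDl.
exact/le_lt_trans/metric_triangle.
Qed.

Lemma isometric_continuous (Y Z : metricType R) (f : Y -> Z) :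
  isometric f -> continuous f.
Proof.
move=> isof x; apply/cvg_ballP => e e0; apply/nbhs_ballP; exists e => // y.
by rewrite !ballEmdist/= isof.
Qed.

Lemma curve_ivt (Z : metricType R) (c : curve Z) a v :
  a \in `[cbeg c, cend c] -> 0 <= v <= mdist (c a) (c (cend c)) ->
  exists2 t, a <= t <= cend c & mdist (c a) (c t) = v.
Proof.
move=> ac v0; have /andP[ca ac'] : cbeg c <= a <= cend c by rewrite in_itv/= in ac.
have cont : {within `[a, cend c], continuous (fun t => mdist (c a) (c t))}.
  apply/subspace_continuousP => t; rewrite /= in_itv/= => /andP[at' tc].
  apply/cvgrPdist_lt => e e0.
  have tcc : t \in `[cbeg c, cend c] by rewrite in_itv/= (le_trans ca).
  have [d d0 H] := curve_cont tcc e0.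
  rewrite near_withinE; apply/nbhs_ballP; exists d => //= t'.
  rewrite /ball/= distrC => tt' ; rewrite in_itv/= => /andP[at'' t'c].
  have := H t'; rewrite in_itv/= t'c (le_trans ca at'') => /(_ isT tt').
  have := metric_triangle (c a) (c t) (c t').
  have := metric_triangle (c a) (c t') (c t).
  rewrite /from_subspace (metric_sym (c t') (c t)) ltr_norml => H1 H2 H3.
  apply/andP; split; lra.
have := @IVT _ _ _ _ v ac' cont; rewrite /= mdistxx.
case/andP: v0 => v0 v1.
rewrite min_l ?mdist_ge0// max_r ?mdist_ge0// v0 v1 => /(_ isT)[t].
by rewrite in_itv/= => tc <-; exists t.
Qed.

(* Greedy subdivision: each new point is at distance exactly [rho] from the last. *)
Lemma curve_chain (Z : metricType R) (c : curve Z) (Phi : Z -> R) (rho B : R) (n : nat) :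
  0 < rho -> (curve_length c <= (n%:R * rho)%:E)%E ->
  (forall s t, s \in `[cbeg c, cend c] -> t \in `[cbeg c, cend c] ->
    mdist (c s) (c t) <= rho -> `|Phi (c s) - Phi (c t)| <= B) ->
  `|Phi (c (cbeg c)) - Phi (c (cend c))| <= n.+1%:R * B.
Proof.
move=> rho0 Lc H.
have ec : cend c \in `[cbeg c, cend c] by rewrite in_itv/= lexx cbeg_le_cend.
have bc : cbeg c \in `[cbeg c, cend c] by rewrite in_itv/= lexx cbeg_le_cend.
have B0 : 0 <= B by apply: (le_trans (normr_ge0 _) (H _ _ bc bc _)); rewrite mdistxx ltW.
rewrite /curve_length in Lc; move: bc Lc; move: {1 3 4}(cbeg c) => a.
elim: n a => [|n ih] a ac Lc.
  rewrite mul1r; apply: H => //; rewrite -lee_fin.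
  have /andP[ca ac'] : cbeg c <= a <= cend c by rewrite in_itv/= in ac.
  apply: le_trans (mdist_le_path_length c ac') _; apply: le_trans Lc _.
  by rewrite mul0r lee_fin ltW.
have /andP[ca ac'] : cbeg c <= a <= cend c by rewrite in_itv/= in ac.
have [dle|dgt] := leP (mdist (c a) (c (cend c))) rho.
  by apply: le_trans (H _ _ ac ec dle) _; rewrite ler_peMl// ler1n.
have [|t /andP[at' tc] td] := @curve_ivt _ c a rho ac; first by rewrite !ltW.
have tcc : t \in `[cbeg c, cend c] by rewrite in_itv/= (le_trans ca).
have Lt : (path_length c t (cend c) <= (n%:R * rho)%:E)%E.
  have := path_length_superadd c at' tc; move=> /le_trans/(_ Lc).
  rewrite -natr1 mulrDl mul1r EFinD addeC => LL.
  have : (rho%:E + path_length c t (cend c) <= rho%:E + (n%:R * rho)%:E)%E.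
    apply: le_trans LL; rewrite leeD2r//.
    by rewrite -[in leLHS]td mdist_le_path_length.
  by rewrite leeD2lE.
have := ih t tcc Lt; have := H a t ac tcc; rewrite td => /(_ (lexx _)) => H1 H2.
rewrite -[n.+2]add1n natrD mulrDl mul1r; apply: le_trans (lerD H1 H2).
have -> : Phi (c a) - Phi (c (cend c)) =
  (Phi (c a) - Phi (c t)) + (Phi (c t) - Phi (c (cend c))) by ring.
exact: ler_normD.
Qed.

Lemma lipschitz_continuous (Z : metricType R) (h : Z -> R) (L : R) : 0 < L ->
  (forall x y, `|h x - h y| <= L * mdist x y) -> continuous h.
Proof.
move=> L0 H x; apply/cvg_ballP => e e0; apply/nbhs_ballP; exists (e / L); first exact: divr_gt0.
move=> z; rewrite ballEmdist/= => xz; rewrite /ball/=.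
by apply: le_lt_trans (H x z) _; rewrite mulrC -ltr_pdivlMr.
Qed.

Lemma continuous_borel d (Z : metricMeasurableType d R) (h : Z -> R) :
  continuous h -> borel_fun (EFin \o h).
Proof.
move=> ch U oU; apply: sub_sigma_algebra; apply: (open_comp (D := EFin @^-1` U)) => //.
rewrite openE => x Ux; have : nbhs x%:E U by exact: open_nbhs_nbhs.
by rewrite /nbhs /= /ereal_nbhs /=.
Qed.

Lemma integrable_bounded_mul d (T : measurableType d) (m : {measure set T -> \bar R})
    (B : set T) (h f : T -> R) (M : R) : measurable B -> measurable_fun B h ->
  (forall x, B x -> `|h x| <= M) -> m.-integrable B (EFin \o f) ->
  m.-integrable B (EFin \o (fun x => h x * f x)).
Proof.
move=> mB mh hM fi; have := @integrableMr _ _ _ m B mB h (EFin \o f) mh _ fi.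
apply; exists M; split; first exact: num_real.
by move=> N MN x Bx; apply: le_trans (hM x Bx) (ltW MN).
Qed.

(** The gradient inequality is local: pieces of length [e] are peeled off from the end and their
    bounds added. *)
Lemma small_step_bound (h : R -> R) (phi : R -> \bar R) (L e : R) : 0 < e -> 0 <= L ->
  measurable_fun setT phi -> (forall x, 0 <= phi x)%E ->
  (forall s t, 0 <= s -> s <= t -> t <= L -> t - s <= e ->
    (`|h t - h s|%:E <= \int[lebesgue_measure]_(x in `[s, t]) phi x)%E) ->
  (`|h L - h 0|%:E <= \int[lebesgue_measure]_(x in `[0%R, L]) phi x)%E.
Proof.
move=> e0 L0 mphi phi0 H.
have [N LN] : exists N : nat, L <= N%:R * e.
  exists (Num.trunc (L / e)).+1; rewrite -ler_pdivrMr//; apply: ltW; exact: truncnS_gt.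
elim: N L L0 LN H => [|N ih] L L0 LN H.
  apply: H => //; rewrite subr0; apply: le_trans LN _; by rewrite mul0r ltW.
have [Le|eL] := leP L e; first by apply: H => //; rewrite subr0.
have Le0 : 0 <= L - e by lra.
have Le1 : L - e <= L by lra.
rewrite (integral_itv_cat Le0 Le1)//.
have -> : h L - h 0 = (h (L - e) - h 0) + (h L - h (L - e)) by ring.
apply: (@le_trans _ _ (`|h (L - e) - h 0|%:E + `|h L - h (L - e)|%:E)%E).
  by rewrite -EFinD lee_fin ler_normD.
apply: leeD; last by apply: H => //; lra.
apply: ih => //; first by move: LN; rewrite -natr1 mulrDl mul1r; lra.
by move=> s t s0 st tL; apply: H => //; lra.
Qed.

Lemma geometric_steps_cvg (a : nat -> R) (M rho : R) : 0 <= rho < 1 ->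
  (forall m, `|a m.+1 - a m| <= M * rho ^+ m) -> cvgn a.
Proof.
move=> /andP[rho0 rho1] H.
have cs : cvgn (series (telescope a)).
  apply: normed_cvg; apply: (@series_le_cvg _ _ (geometric M rho)).
  - by move=> n; exact: normr_ge0.
  - by move=> n; apply: le_trans (normr_ge0 _) (H n).
  - exact: H.
  - by apply: is_cvg_geometric_series; rewrite ger0_norm.
rewrite (_ : a = (fun n => a 0 + series (telescope a) n)).
  by apply: is_cvgD => //; exact: is_cvg_cst.
by apply/funext => n; exact: eq_sum_telescope.
Qed.

Lemma cvg_int_shift (s : int -> R) (k : int) (c : R) :
  (s (k - n%:Z) @[n --> \oo] --> c) -> (s (- n%:Z) @[n --> \oo] --> c).
Proof.
move=> /cvgrPdist_lt H; apply/cvgrPdist_lt => e e0.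
have [N _ HN] := H e e0; exists (N + `|k|)%N => // n /= Nn.
have -> : - n%:Z = k - (absz (n%:Z + k))%:Z by lia.
by apply: HN => /=; lia.
Qed.

Lemma nneseries_geometric_le (x : R) : 0 <= x < 1 ->
  (\sum_(m <oo) (x ^+ m)%:E <= ((1 - x)^-1)%:E)%E.
Proof.
move=> /andP[x0 x1]; have x10 : 0 < 1 - x by rewrite subr_gt0.
apply: lime_le; first by apply: is_cvg_nneseries => m _ _; rewrite lee_fin exprn_ge0.
apply: nearW => n; rewrite sumEFin lee_fin -[leRHS]mul1r ler_pdivlMr//.
rewrite (_ : _ * _ = 1 - x ^+ n) ?gerBl ?exprn_ge0//.
elim: n => [|n ih]; first by rewrite big_geq// mul0r expr0 subrr.
by rewrite big_nat_recr//= mulrDl ih exprS; ring.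
Qed.

Lemma cvge_at_right0 (f : R -> \bar R) : (forall r, (0 <= f r)%E) ->
  (forall e, 0 < e -> exists2 d, 0 < d & forall r, 0 < r -> r < d -> (f r <= e%:E)%E) ->
  f r @[r --> 0^'+] --> 0%E.
Proof.
move=> f0 H; have near_le e : 0 < e -> \forall r \near 0^'+, (f r <= e%:E)%E.
  move=> e0; have [d d0 Hd] := H e e0.
  by near=> r; apply: Hd; near: r; [exact: nbhs_right_gt|exact: nbhs_right_lt].
apply/fine_cvgP; split.
  have := near_le 1 ltr01; apply: filterS => r fr.
  by rewrite ge0_fin_numE// (le_lt_trans fr)// ltry.
apply/cvgrPdist_le => e e0; have := near_le e e0; apply: filterS => r fr.
rewrite sub0r normrN ger0_norm ?fine_ge0// -lee_fin fineK//.
by rewrite ge0_fin_numE// (le_lt_trans fr)// ltry.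
Unshelve. all: by end_near. Qed.

End metric_prelim.

(** * Nets, corkscrews and chains *)

Section geometry.
Context {R : realType} {d1 d2 : measure_display}.
Context {Omega : metricMeasurableType d1 R} {X : metricType R} {bd : metricMeasurableType d2 R}.
Variables (i : Omega -> X) (j : bd -> X).
Variables (mu : {measure set Omega -> \bar R}) (nu : {measure set bd -> \bar R}).
Variables (theta Cm Cc A : R).
Hypothesis iso_i : isometric i.
Hypothesis iso_j : isometric j.
Hypothesis dense_i : dense (range i).
Hypothesis range_j : range j = bdry i.
Hypothesis mu_open : forall U : set Omega, open U -> measurable U.
Hypothesis nu_open : forall U : set bd, open U -> measurable U.
Hypothesis mu_ball : positive_finite_balls mu.
Hypothesis Cm1 : 1 <= Cm.
Hypothesis mu_doubling : forall (z : Omega) (r : R), 0 < r ->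
  (mu (ball z (2 * r)) <= Cm%:E * mu (ball z r))%E.
Hypothesis theta0 : 0 < theta.
Hypothesis Cc1 : 1 <= Cc.
Hypothesis codim : forall (zeta : bd) (r : R), 0 < r ->
  ((Cc^-1)%:E * nu (j @^-1` ball (j zeta) r)
         <= mu (i @^-1` ball (j zeta) r) * ((r `^ theta)^-1)%:E
         <= Cc%:E * nu (j @^-1` ball (j zeta) r))%E.

Lemma preimage_i_ball z r : i @^-1` ball (i z) r = ball z r.
Proof. by apply/seteqP; split => w /=; rewrite !ballEmdist/= iso_i. Qed.

Lemma preimage_j_ball z r : j @^-1` ball (j z) r = ball z r.
Proof. by apply/seteqP; split => w /=; rewrite !ballEmdist/= iso_j. Qed.

Lemma measurable_i_ball x r : measurable (i @^-1` ball x r).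
Proof.
apply: mu_open; apply: open_comp; last exact: open_mball.
by move=> ? _; exact: isometric_continuous.
Qed.

Lemma measurable_j_ball x r : measurable (j @^-1` ball x r).
Proof.
apply: nu_open; apply: open_comp; last exact: open_mball.
by move=> ? _; exact: isometric_continuous.
Qed.

Lemma dense_iP (x : X) (e : R) : 0 < e -> exists z, mdist x (i z) < e.
Proof.
move=> e0; have [|_ [] /[swap] -[z _ <-]] := dense_i _ (@open_mball _ _ x e).
  by exists x; exact: ballxx.
by rewrite ballEmdist/= => ?; exists z.
Qed.

Definition mM (x : X) (r : R) := fine (mu (i @^-1` ball x r)).
Definition nN (x : X) (r : R) := fine (nu (j @^-1` ball x r)).

Lemma subset_mball (Z : metricType R) (x x' : Z) r r' :
  mdist x' x + r <= r' -> ball x r `<=` ball x' r'.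
Proof.
move=> H y; rewrite !ballEmdist/= => xy; apply: le_lt_trans (metric_triangle _ x _) _.
by apply: lt_le_trans H; rewrite ltrD2l.
Qed.

(** The centre lies in the completion, possibly on the boundary. By density it is within $r/2$ of a
    point of the domain, whose balls of radius $r/2$ and $2r$ bracket the given one. *)
Lemma mME x r : 0 < r -> mu (i @^-1` ball x r) = (mM x r)%:E /\ 0 < mM x r.
Proof.
move=> r0; have r20 : 0 < r / 2 by rewrite divr_gt0.
have [z xz] := dense_iP x r20.
have m1 := measurable_i_ball x r.
have lo : (0 < mu (i @^-1` ball x r))%E.
  apply: (@lt_le_trans _ _ (mu (ball z (r / 2)))); first by case/andP: (mu_ball z r20).
  apply: le_measure; rewrite ?inE//; first by rewrite -preimage_i_ball; exact: measurable_i_ball.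
  by rewrite -preimage_i_ball; apply: preimage_subset; apply: subset_mball; lra.
have hi : (mu (i @^-1` ball x r) < +oo)%E.
  have r20' : 0 < 2 * r by rewrite mulr_gt0.
  apply: (@le_lt_trans _ _ (mu (ball z (2 * r)))); last by case/andP: (mu_ball z r20').
  apply: le_measure; rewrite ?inE//; first by rewrite -preimage_i_ball; exact: measurable_i_ball.
  rewrite -preimage_i_ball; apply: preimage_subset; apply: subset_mball.
  by rewrite metric_sym; lra.
have E : mu (i @^-1` ball x r) = (mM x r)%:E by rewrite fineK// ge0_fin_numE// ltW.
by split => //; rewrite -lte_fin -E.
Qed.

Lemma nNE z r : 0 < r -> nu (j @^-1` ball (j z) r) = (nN (j z) r)%:E /\ 0 < nN (j z) r.
Proof.
move=> r0; have [ME M0] := mME (j z) r0.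
have /andP[] := codim z r0; rewrite ME -EFinM => c1 c2.
have Cc0 : 0 < Cc by exact: lt_le_trans Cc1.
have hi : (nu (j @^-1` ball (j z) r) < +oo)%E.
  rewrite ltey; apply/negP => /eqP H.
  by move: c1; rewrite H gt0_muley ?lte_fin ?invr_gt0// leye_eq.
have E : nu (j @^-1` ball (j z) r) = (nN (j z) r)%:E by rewrite fineK// ge0_fin_numE.
split => //; move: c2; rewrite E -EFinM lee_fin => c2.
have : 0 < Cc * nN (j z) r.
  by apply: lt_le_trans c2; rewrite mulr_gt0// invr_gt0 powR_gt0.
by rewrite pmulr_rgt0.
Qed.

Lemma codimE z r : 0 < r -> nN (j z) r <= Cc * r `^ (- theta) * mM (j z) r /\
  mM (j z) r <= Cc * r `^ theta * nN (j z) r.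
Proof.
move=> r0; have [ME M0] := mME (j z) r0; have [NE N0] := nNE z r0.
have /andP[] := codim z r0; rewrite ME NE -!EFinM !lee_fin => c1 c2.
have Cc0 : 0 < Cc by exact: lt_le_trans Cc1.
have t0 : 0 < r `^ theta by rewrite powR_gt0.
split.
  by rewrite powRN -mulrA -ler_pdivrMl// [X in _ <= X]mulrC.
by move: c2; rewrite ler_pdivrMr// mulrAC.
Qed.

Lemma ex_pow2 (L : R) : exists n : nat, L <= 2 ^+ n.
Proof.
exists (Num.trunc L).+1.
have := truncnS_gt L; move=> /ltW/le_trans; apply.
by rewrite -natrX ler_nat ltnW// ltn_expl.
Qed.

Lemma mM_doubling (L : R) : exists2 C : R, 0 < C & forall x x' r r',
  0 < r -> 0 < r' -> mdist x x' + r <= L * r' -> mM x r <= C * mM x' r'.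
Proof.
(* With [z] within $r'/2$ of [x'], the ball about [x] lies in the ball about [z] of radius
   $r'/2+Lr'=(2L+1)\,r'/2$, reached from radius $r'/2$ by [n] doublings. *)
have [n nL] := ex_pow2 (2 * L + 1).
have Cm0 : 0 < Cm by exact: lt_le_trans Cm1.
exists (Cm ^+ n) => [|x x' r r' r0 r'0 H]; first by rewrite exprn_gt0.
have r20 : 0 < r' / 2 by rewrite divr_gt0.
have [z xz] := dense_iP x' r20.
have iter m : (mu (ball z (2 ^+ m * (r' / 2))) <= (Cm ^+ m)%:E * mu (ball z (r' / 2)))%E.
  elim: m => [|m ih]; first by rewrite !expr0 mul1r mul1e.
  rewrite exprS -mulrA; apply: le_trans (mu_doubling _ _) _; first by rewrite mulr_gt0// exprn_gt0.
  by rewrite exprS EFinM -muleA; apply: lee_wpmul2l => //; rewrite lee_fin ltW.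
have [E1 _] := mME x r0; have [E2 _] := mME x' r'0.
rewrite -lee_fin EFinM -E1 -E2.
apply: (@le_trans _ _ (mu (ball z (2 ^+ n * (r' / 2))))).
  apply: le_measure; rewrite ?inE//; first exact: measurable_i_ball.
    by rewrite -preimage_i_ball; exact: measurable_i_ball.
  rewrite -preimage_i_ball; apply: preimage_subset; apply: subset_mball.
  have := metric_triangle (i z) x' x.
  rewrite (metric_sym (i z) x') (metric_sym x' x).
  have := ler_wpM2r (ltW r20) nL; lra.
apply: le_trans (iter n) _; apply: lee_wpmul2l; first by rewrite lee_fin exprn_ge0// ltW.
apply: le_measure; rewrite ?inE//; last 2 first.
- exact: measurable_i_ball.
- by rewrite -preimage_i_ball; apply: preimage_subset; apply: subset_mball; lra.
by rewrite -preimage_i_ball; exact: measurable_i_ball.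
Qed.

Lemma le_nN z z' r r' : 0 < r -> mdist (j z') (j z) + r <= r' -> nN (j z) r <= nN (j z') r'.
Proof.
move=> r0 H; have r'0 : 0 < r' by have := mdist_ge0 (j z') (j z); lra.
have [E1 _] := nNE z r0; have [E2 _] := nNE z' r'0.
rewrite -lee_fin -E1 -E2; apply: le_measure; rewrite ?inE; try exact: measurable_j_ball.
by apply: preimage_subset; exact: subset_mball.
Qed.

(** The boundary measure inherits doubling from [mu] through the codimension condition, at the price
    of a power of [L]. *)
Lemma nN_doubling (L : R) : 0 < L -> exists2 C : R, 0 < C & forall z z' r r',
  0 < r -> 0 < r' -> mdist (j z) (j z') + r <= L * r' -> nN (j z) r <= C * nN (j z') r'.
Proof.
move=> L0; have [C C0 HC] := mM_doubling L.
have Cc0 : 0 < Cc by exact: lt_le_trans Cc1.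
exists (Cc * L `^ (- theta) * C * Cc); first by rewrite !mulr_gt0// powR_gt0.
move=> z z' r r' r0 r'0 H.
have Lr0 : 0 < L * r' by rewrite mulr_gt0.
apply: (@le_trans _ _ (nN (j z') (L * r'))); first by apply: le_nN; rewrite // metric_sym.
have [c1 _] := codimE z' Lr0; apply: le_trans c1 _.
have [_ c2] := codimE z' r'0.
have H2 := HC (j z') (j z') _ _ Lr0 r'0; rewrite mdistxx add0r lexx in H2.
apply: (@le_trans _ _ (Cc * (L * r') `^ (- theta) * (C * (Cc * r' `^ theta * nN (j z') r')))).
  apply: ler_wpM2l; first by rewrite mulr_ge0 ?powR_ge0// ltW.
  by apply: le_trans (H2 isT) _; rewrite ler_pM2l.
rewrite powRM ?(ltW L0) ?(ltW r'0)// (powRN r').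
have t0 : r' `^ theta != 0 by rewrite gt_eqF// powR_gt0.
rewrite le_eqVlt; apply/orP; left; apply/eqP; field.
by rewrite t0.
Qed.

(* The balls of radius [r / 2] are disjoint and, by doubling, of measure
   comparable to that of a common larger ball. *)
Lemma separated_count (L : R) : 0 < L -> exists N : R, forall (r : R) (x : X) (s : seq bd),
  0 < r -> uniq s -> (forall b b', b \in s -> b' \in s -> b != b' -> r <= mdist b b') ->
  (forall b, b \in s -> mdist x (j b) < L * r) -> (size s)%:R <= N.
Proof.
(* Two points of the family are less than $2Lr$ apart, and the common ball has radius $(2L+1)r$; the
   sum $(4L+1)r$ is $8L+2$ times the small radius $r/2$. *)
move=> L0; have L10 : 0 < 8 * L + 2 by lra.
have [C C0 HC] := nN_doubling L10.
exists C => r x s r0 us seps ins.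
case: s us seps ins => [|b0 s] us seps ins; first exact: ltW.
set S := b0 :: s in us seps ins *; have b0S : b0 \in S by rewrite mem_head.
have r20 : 0 < r / 2 by rewrite divr_gt0.
pose rr := (2 * L + 1) * r; have rr0 : 0 < rr by rewrite mulr_gt0//; lra.
have [E0 N0] := nNE b0 rr0.
have dS b : b \in S -> mdist (j b0) (j b) < 2 * L * r.
  move=> bS; have := ins _ bS; have := ins _ b0S.
  have := metric_triangle (j b0) x (j b); rewrite (metric_sym (j b0) x); lra.
have H1 b : b \in S -> nN (j b0) rr <= C * nN (j b) (r / 2).
  move=> bS; apply: HC => //; have := dS _ bS; rewrite /rr; lra.
have sumle : \sum_(b <- S) nN (j b) (r / 2) <= nN (j b0) rr.
  rewrite -lee_fin -E0.
  have -> : (\sum_(b <- S) nN (j b) (r / 2))%:E =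
      nu (\big[setU/set0]_(b <- S) (j @^-1` ball (j b) (r / 2))).
    move: us seps {dS H1 ins b0S}; move: S => S.
    elim: S => [|b S ih] /=; first by rewrite !big_nil measure0.
    move=> /andP[bS uS] sep; rewrite !big_cons measureU; last 3 first.
    - exact: measurable_j_ball.
    - by rewrite big_seq; apply: bigsetU_measurable => b' _; exact: measurable_j_ball.
    - rewrite -subset0 => w []; rewrite -bigcup_seq /= ballEmdist/= => w1 [b' b'S].
      rewrite /= ballEmdist/= => w2.
      have : r <= mdist b b'.
        apply: sep; rewrite ?mem_head// ?inE ?b'S ?orbT//.
        by apply: contraNneq bS => ->.
      rewrite -(iso_j b b'); have := metric_triangle (j b) (j w) (j b').
      rewrite (metric_sym (j w) (j b')); lra.
    rewrite EFinD; congr (_ + _)%E; first by have [] := nNE b r20.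
    apply: ih => //.
    by move=> b1 b2 h1 h2; apply: sep; rewrite inE ?h1 ?h2 orbT.
  apply: le_measure; rewrite ?inE; [|exact: measurable_j_ball|].
    by apply: bigsetU_measurable => b' _; exact: measurable_j_ball.
  rewrite -bigcup_seq => w [b bS]; rewrite /= !ballEmdist/= => w1.
  have := dS _ bS; have := metric_triangle (j b0) (j b) (j w).
  by rewrite /rr; lra.
have : (size S)%:R * nN (j b0) rr <= C * nN (j b0) rr.
  apply: le_trans (ler_wpM2l (ltW C0) sumle).
  rewrite mulr_sumr; apply: (@le_trans _ _ (\sum_(b <- S) nN (j b0) rr)).
    by rewrite big_const_seq count_predT iter_addr_0 mulr_natl.
  by rewrite !big_seq; apply: ler_sum => b bS; exact: H1.
by rewrite ler_pM2r.
Qed.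

Definition separated (r : R) (S : set bd) :=
  forall b b', S b -> S b' -> b != b' -> r <= mdist b b'.

Hypothesis unbounded_bd : unbounded_space bd.

(** A maximal separated set covers. Its bounded parts are finite by [separated_count], so it is
    countable, and it is infinite because the boundary is unbounded; a bijection with [nat] then
    keeps distinct indices separated. *)
Lemma ex_net (r : R) : 0 < r -> exists y : nat -> bd,
  (forall l m, l != m -> r <= mdist (y l) (y m)) /\
  (forall b, exists l, mdist (y l) b < r).
Proof.
move=> r0.
have [S [sepS maxS]] : exists S, separated r S /\ forall B, S `<` B -> ~ separated r B.
  apply: Zorn_bigcup => F FP tF b b' [S1 FS1 S1b] [S2 FS2 S2b'].
  by have [S12|S21] := tF _ _ FS1 FS2; [apply: (FP _ FS2)|apply: (FP _ FS1)] => //;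
    [exact: S12|exact: S21].
have covS b : exists2 b', S b' & mdist b' b < r.
  apply: contrapT => H.
  have Hb b' : S b' -> r <= mdist b' b.
    by move=> Sb'; rewrite leNgt; apply/negP => lt; apply: H; exists b'.
  apply: (maxS (b |` S)).
    split; first by move=> ? ?; right.
    move=> /(_ b (or_introl erefl)) Sb; have := Hb _ Sb.
    by rewrite mdistxx leNgt r0.
  move=> b1 b2 [->|S1] [->|S2]; rewrite ?eqxx// => b12; last exact: sepS.
    by rewrite metric_sym; exact: Hb.
  exact: Hb.
have finS n : finite_set (S `&` ball point n%:R).
  apply: contrapT => infS.
  have L0 : 0 < (n%:R + 1) / r by rewrite divr_gt0// ltr_wpDl.
  have [N HN] := separated_count L0.
  have [m mN] : exists m : nat, N < m%:R.
    by exists (Num.trunc N).+1; exact: truncnS_gt.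
  have [B BS Bm] := infinite_set_fset m infS.
  have : (size (finmap.enum_fset B))%:R <= N.
    apply: (HN r (j point) _ r0 (finmap.fset_uniq B)).
      by move=> b b' bB b'B; apply: sepS; [case: (BS _ bB)|case: (BS _ b'B)].
    move=> b /BS[_]; rewrite ballEmdist/= iso_j mulfVK ?gt_eqF// => lt.
    by rewrite (lt_trans lt)// ltrDl.
  by rewrite leNgt (lt_le_trans mN)// ler_nat.
have cS : countable S.
  have -> : S = \bigcup_n (S `&` ball point n%:R).
    rewrite -setI_bigcupr; apply/seteqP; split => [b Sb|b []//]; split => //.
    exists (Num.trunc (mdist point b)).+1 => //.
    by rewrite ballEmdist/=; exact: truncnS_gt.
  by apply: bigcup_countable => // n _; exact: finite_set_countable.
have infS : ~ finite_set S.
  move=> /finite_seqP[s Ss].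
  pose M := \sum_(b <- s) mdist point b + r.
  have HM (b : bd) : mdist point b < M.
    have [b' Sb' bb'] := covS b.
    apply: le_lt_trans (metric_triangle _ b' _) _; rewrite ler_ltD//.
    have b's : b' \in s by rewrite Ss in Sb'.
    rewrite (big_rem b')//= lerDl sumr_ge0// => ? _; exact: mdist_ge0.
  have [x [y]] := unbounded_bd (2 * M); apply/negP; rewrite -leNgt.
  have := metric_triangle x point y; rewrite (metric_sym x point).
  have := HM x; have := HM y; lra.
have /card_esym/card_set_bijP[y [/= y1 y2 y3]] := eq_card_nat cS infS.
exists y; split => [l m lm|b].
  apply: sepS; [exact: y1|exact: y1|].
  by apply: contra lm => /eqP ylm; apply/eqP; apply: y2 => //; rewrite inE.
by have [b' /y3[l _ <-] lt] := covS b; exists l.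
Qed.

Lemma net_overlap (L : R) : 0 < L -> exists N : R,
  forall (r : R) (y : nat -> bd) (x : X) (n : nat), 0 < r ->
  (forall l m, l != m -> r <= mdist (y l) (y m)) ->
  \sum_(l < n) (mdist x (j (y l)) < L * r)%R%:R <= N.
Proof.
move=> L0; have [N HN] := separated_count L0; exists N => r y x n r0 sep.
have yinj : injective y.
  move=> l m ylm; apply/eqP; apply: contraT => /sep.
  by rewrite ylm mdistxx leNgt r0.
rewrite -natr_sum; apply: le_trans (HN r x [seq y l | l <- iota 0 n & mdist x (j (y l)) < L * r] r0 _ _ _).
- rewrite size_map size_filter -sum1_count ler_nat.
  have -> : iota 0 n = index_iota 0 n by rewrite /index_iota subn0.
  by rewrite [X in (_ <= X)%N]big_mkcond big_mkord; apply: leq_sum => l _; case: ifP.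
- by rewrite map_inj_uniq// filter_uniq// iota_uniq.
- move=> b b' /mapP[l _ ->] /mapP[m _ ->] lm; apply: sep.
  by apply: contra lm => /eqP ->.
- by move=> b /mapP[l]; rewrite mem_filter => /andP[? _] ->.
Qed.

Definition delta (y : Omega) : R := fine (dist_bdry i y).

Lemma dist_bdryE y : dist_bdry i y = (delta y)%:E.
Proof.
have jp : bdry i (j point) by rewrite -range_j; exists point.
rewrite fineK// ge0_fin_numE; last first.
  by apply: le_ereal_inf_tmp => _ [z _ <-]; rewrite lee_fin mdist_ge0.
apply: (@le_lt_trans _ _ (mdist (i y) (j point))%:E); last by rewrite ltey.
by apply: ereal_inf_lbound; exists (j point).
Qed.

Lemma delta_le y b : delta y <= mdist (i y) (j b).
Proof.
rewrite -lee_fin -dist_bdryE; apply: ereal_inf_lbound; exists (j b) => //.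
by rewrite -range_j; exists b.
Qed.

Lemma delta_lt y e : 0 < e -> exists b, mdist (i y) (j b) < delta y + e.
Proof.
move=> e0; have := dist_bdryE y; rewrite /dist_bdry => E.
have F : ereal_inf [set (mdist (i y) z)%:E | z in bdry i] \is a fin_num by rewrite E.
have [_ [z zb <-]] := lb_ereal_inf_adherent e0 F.
rewrite E -EFinD lte_fin; move: zb; rewrite -range_j => -[b _ <-] lt.
by exists b.
Qed.

Lemma delta_lip y z : delta y <= delta z + mdist y z.
Proof.
apply/ler_addgt0Pr => e e0; have [b lt] := delta_lt z e0.
apply: le_trans (delta_le y b) _; apply: le_trans (metric_triangle _ (i z) _) _.
by rewrite iso_i; lra.
Qed.

Hypothesis lc : locally_compact [set: Omega].

(** Local compactness makes the domain open in its completion: a boundary point too close to [y]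
    would be a limit of points of a compact neighbourhood of [y], whose image is closed. *)
Lemma delta_gt0 y : 0 < delta y.
Proof.
have [K Ky [cK _]] := lc (Logic.I : [set: Omega] y); move: Ky.
move=> /nbhs_ballP[r /= r0 rK].
have ciK : closed (i @` K).
  apply: compact_closed; first exact: metric_hausdorff.
  apply: continuous_compact => //; apply: continuous_subspaceT.
  exact: isometric_continuous.
suff: r <= delta y by exact: lt_le_trans.
rewrite leNgt; apply/negP => dr; have e0 : 0 < r - delta y by rewrite subr_gt0.
have [b] := delta_lt y e0; rewrite addrC subrK => yb.
have : (i @` K) (j b).
  rewrite (closure_id (i @` K)).1// => B /nbhs_ballP[e /= e'0 eB].
  have me0 : 0 < Num.min e (r - mdist (i y) (j b)) by rewrite lt_min e'0 subr_gt0.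
  have [z zb] := dense_iP (j b) me0; move: zb; rewrite lt_min => /andP[ze zr].
  exists (i z); split; last by apply: eB; rewrite ballEmdist.
  exists z => //; apply: (rK _ _ Logic.I); rewrite ballEmdist/= -iso_i.
  by apply: le_lt_trans (metric_triangle _ (j b) _) _; lra.
move=> [z _ zb]; have : bdry i (j b) by rewrite -range_j; exists b.
by rewrite -zb; apply; exists z.
Qed.

Hypothesis A1 : 1 <= A.
Hypothesis unifA : forall x y : Omega, exists c : curve Omega,
      [/\ joins c x y,
          (curve_length c <= (A * mdist x y)%:E)%E &
          forall t, t \in `[cbeg c, cend c] ->
            (Order.min (path_length c (cbeg c) t) (path_length c t (cend c))
             <= A%:E * dist_bdry i (c t))%E].
Hypothesis unbounded_Om : unbounded_space Omega.

(** Join a point [x] within $r/2$ of [b] to a point [y] farther than $2r$ from [x]. The point of the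
    uniform curve at distance $r$ from [x] is also at distance at least $r$ from [y], so both
    subarcs have length at least $r$ and uniformity gives depth $r/A$. *)
Lemma ex_corkscrew b r : 0 < r -> exists z : Omega,
  mdist (i z) (j b) < 3 / 2 * r /\ r / A <= delta z.
Proof.
move=> r0; have r20 : 0 < r / 2 by rewrite divr_gt0.
have A0 : 0 < A by exact: lt_le_trans A1.
have [x xb] := dense_iP (j b) r20.
have [y xy] : exists y, 2 * r < mdist x y.
  have [y1 [y2 lt]] := unbounded_Om (4 * r).
  have [h|h] := ltP (2 * r) (mdist x y1); first by exists y1.
  exists y2; have := metric_triangle y1 x y2; rewrite (metric_sym y1 x); lra.
have [c [[cx cy] Lc cd]] := unifA x y.
have bc : cbeg c \in `[cbeg c, cend c] by rewrite in_itv/= lexx cbeg_le_cend.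
have [|t /andP[bt te] dt] := @curve_ivt _ _ c (cbeg c) r bc.
  by rewrite cx cy; apply/andP; split; lra.
have tc : t \in `[cbeg c, cend c] by rewrite in_itv/= bt.
exists (c t); split.
  apply: le_lt_trans (metric_triangle _ (i x) _) _.
  rewrite (metric_sym (i (c t)) (i x)) (metric_sym (i x) (j b)) iso_i.
  by move: dt; rewrite cx; lra.
rewrite ler_pdivrMr// mulrC -lee_fin EFinM -dist_bdryE; apply: le_trans (cd _ tc).
rewrite le_min; apply/andP; split.
  by apply: le_trans (mdist_le_path_length _ bt); rewrite dt.
apply: le_trans (mdist_le_path_length _ te); rewrite lee_fin.
have := metric_triangle x (c t) y; rewrite -cx -cy dt; move: xy; rewrite -cx -cy; lra.
Qed.

(* Near its ends the uniform curve is close to [x] or [y], in between the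
   uniformity condition applies: this is where [eta / (2 * A)] comes from. *)
Lemma uniform_chain (x y : Omega) (eta rho B : R) (n : nat) (Phi : Omega -> R) :
  0 < rho -> A * mdist x y <= n%:R * rho -> eta <= delta x -> eta <= delta y ->
  (forall s t, eta / (2 * A) <= delta s -> mdist x s <= A * mdist x y ->
     mdist s t <= rho -> `|Phi s - Phi t| <= B) ->
  `|Phi x - Phi y| <= n.+1%:R * B.
Proof.
move=> rho0 dn ex ey H; have A0 : 0 < A by exact: lt_le_trans A1.
have [c [[cx cy] Lc cd]] := unifA x y.
have fLc : (curve_length c < +oo)%E by apply: le_lt_trans Lc _; rewrite ltey.
have := @curve_chain _ _ c Phi rho B n rho0; rewrite cx cy; apply.
  by apply: le_trans Lc _; rewrite lee_fin.
move=> s t sc tc; apply: H; last first.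
  have /andP[bs se] : cbeg c <= s <= cend c by rewrite in_itv/= in sc.
  rewrite -lee_fin -cx; apply: le_trans (mdist_le_path_length c bs) _.
  rewrite cx; apply: le_trans Lc.
  by rewrite /curve_length (path_lengthD c bs se) leeDl// path_length_ge0.
have /andP[bs se] : cbeg c <= s <= cend c by rewrite in_itv/= in sc.
have [e0|e0] := leP eta 0.
  apply: le_trans (ltW (delta_gt0 _)).
  by rewrite pmulr_lle0// invr_gt0 mulr_gt0.
have l1 := path_length_fin fLc (lexx _) bs se.
have l2 := path_length_fin fLc bs se (lexx _).
have d1' := mdist_le_path_length c bs; have d2' := mdist_le_path_length c se.
have := cd _ sc; move: d1' d2'.
rewrite dist_bdryE -(fineK l1) -(fineK l2) -EFin_min -EFinM !lee_fin cx cy => h1 h2.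
have eA : eta / (2 * A) <= eta / 2.
  by rewrite invfM mulrA ler_piMr ?invf_le1// divr_ge0// ltW.
have [lx|lx] := leP (fine (path_length c (cbeg c) s)) (eta / 2).
  move=> _; have := delta_lip x (c s); lra.
have [ly|ly] := leP (fine (path_length c s (cend c))) (eta / 2).
  move=> _; have := delta_lip y (c s); rewrite (metric_sym y (c s)); lra.
rewrite ge_min => H1; rewrite invfM mulrA ler_pdivrMr// [X in _ <= X]mulrC.
by case/orP: H1 => H1; apply: le_trans H1; exact: ltW.
Qed.

Definition V (b : bd) (r : R) := nN (j b) r.

Lemma VE b r : 0 < r -> nu (ball b r) = (V b r)%:E.
Proof. by move=> r0; rewrite -preimage_j_ball; case: (nNE b r0). Qed.

Lemma V_gt0 b r : 0 < r -> 0 < V b r.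
Proof. by move=> r0; case: (nNE b r0). Qed.

Lemma measurable_mball (b : bd) r : measurable (ball b r).
Proof. by rewrite -preimage_j_ball; exact: measurable_j_ball. Qed.

Lemma V_doubling (L : R) : 0 < L -> exists2 C : R, 0 < C & forall b b' r r',
  0 < r -> 0 < r' -> mdist b b' + r <= L * r' -> V b r <= C * V b' r'.
Proof.
move=> L0; have [C C0 H] := nN_doubling L0; exists C => // b b' r r' r0 r'0 h.
by apply: H; rewrite ?iso_j.
Qed.

Variable p : R.
Hypothesis p1 : 1 <= p.
Hypothesis thetap : theta < p.

Let p0 : 0 < p. Proof. exact: lt_le_trans p1. Qed.

Definition al : R := 1 - theta / p.

Lemma alp : al * p = p - theta.
Proof. by rewrite /al mulrBl mul1r mulfVK// gt_eqF. Qed.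

Lemma alp_gt0 : 0 < al * p. Proof. by rewrite alp subr_gt0. Qed.

Variable y : int -> nat -> bd.
Hypothesis y_sep : forall k l m, l != m -> sc k <= mdist (y k l) (y k m).
Hypothesis y_cov : forall k b, exists l, mdist (y k l) b < sc k.

Ltac side := try first
  [ exact: measurable_mball
  | exact: measurable_i_ball
  | exact: powR_ge0
  | by move=> *; rewrite lee_fin ?powR_ge0
  | by move=> *; exact: poweR_ge0
  | by rewrite invr_ge0 ltW
  | by move=> *; rewrite ?mule_ge0 ?adde_ge0// ?lee_fin ?powR_ge0 ].

(** * Oscillations of Besov functions *)

Section besov_functions.
Variable f : bd -> R.
Hypothesis mf : measurable_fun setT f.
Local Open Scope ereal_scope.

Definition osc_int (r : R) (b : bd) : \bar R :=
  average nu (ball b r) (fun x => (`|f b - f x| `^ p / r `^ (al * p))%:E).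

Definition osc_fun (r : R) : \bar R := \int[nu]_b osc_int r b.

Definition besov_energy : \bar R :=
  \int[lebesgue_measure]_(r in `]0%R, +oo[) (osc_fun r * (r^-1)%:E).

Lemma osc_int_ge0 r b : 0 <= osc_int r b.
Proof.
rewrite /osc_int /average mule_ge0 ?inve_ge0//; apply: integral_ge0 => x _.
by rewrite lee_fin divr_ge0// powR_ge0.
Qed.

Lemma osc_fun_ge0 r : 0 <= osc_fun r.
Proof. by apply: integral_ge0 => b _; exact: osc_int_ge0. Qed.

Lemma besov_energy_ge0 : 0 <= besov_energy.
Proof.
apply: integral_ge0 => r /=; rewrite in_itv/= andbT => r0.
by rewrite mule_ge0 ?osc_fun_ge0// lee_fin invr_ge0 ltW.
Qed.

Lemma besov_normE : besov_norm nu p al f = besov_energy `^ p^-1.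
Proof. by []. Qed.

Lemma besov_energyE : besov_energy = besov_norm nu p al f `^ p.
Proof. by rewrite besov_normE poweRVK ?gt_eqF// besov_energy_ge0. Qed.

Lemma measurable_diff_pow (D : set bd) c : measurable_fun D (fun x => (`|f x - c| `^ p)%:E).
Proof.
apply/measurable_EFinP; apply: measurable_funTS.
apply: (measurableT_comp (measurable_powR p)).
by apply: (measurableT_comp (@normr_measurable R setT)); apply: measurable_funB.
Qed.

Lemma osc_intE r b : (0 < r)%R ->
  \int[nu]_(x in ball b r) (`|f x - f b| `^ p)%:E =
  (V b r * r `^ (al * p))%:E * osc_int r b.
Proof.
move=> r0; have V0 := V_gt0 b r0.
have rp : (0 < r `^ (al * p))%R by rewrite powR_gt0.
rewrite /osc_int (averageE _ V0 (VE b r0)).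
under [in RHS]eq_integral do rewrite mulrC EFinM distrC.
rewrite ge0_integralZl_EFin//; side; try exact: measurable_diff_pow.
rewrite !muleA -!EFinM.
have -> : (V b r * r `^ (al * p) * (V b r)^-1 * (r `^ (al * p))^-1 = 1)%R.
  by field; rewrite !gt_eqF.
by rewrite mul1e.
Qed.

Hypothesis fin_energy : besov_energy < +oo.

(** Were $|f|^p$ not integrable on the ball, then for every $t>2r$ the oscillation at radius $t$
    would be infinite at each point of the ball, and so would the energy. This gives traces their
    local integrability. *)
Lemma besov_Lp_ball b r : (0 < r)%R ->
  \int[nu]_(x in ball b r) (`|f x| `^ p)%:E < +oo.
Proof.
move=> r0; rewrite ltey; apply/eqP => I.
have r20 : (0 < 2 * r)%R by rewrite mulr_gt0.
have [k kr] : exists k : int, (2 * r <= sc (k - 1))%R.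
  have [k /andP[_ kr]] := ex_scale r20.
  by exists (k + 1 + 1)%R; rewrite addrK ltW.
have Hoo t : (2 * r < t)%R -> osc_fun t = +oo.
  move=> rt; have t0 : (0 < t)%R by exact: lt_trans rt.
  have bb x : ball b r x -> osc_int t x = +oo.
    move=> bx; apply/eqP; rewrite -leye_eq leNgt; apply/negP => xoo.
    have : \int[nu]_(x' in ball x t) (`|f x' - f x| `^ p)%:E < +oo.
      rewrite osc_intE// lte_mul_pinfty ?lee_fin ?mulr_ge0 ?powR_ge0 ?(ltW (V_gt0 _ _))//.
    move=> Ix; have : \int[nu]_(x' in ball b r) (`|f x'| `^ p)%:E < +oo; last by rewrite I.
    apply: (@le_lt_trans _ _ (\int[nu]_(x' in ball b r)
       ((2 `^ p)%:E * ((`|f x' - f x| `^ p)%:E + (`|f x| `^ p)%:E)))).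
      apply: le_lower_integral => x' _; first by rewrite lee_fin powR_ge0.
      rewrite -EFinD -EFinM lee_fin; apply: le_trans (powRD_le p1 _ _) => //.
      apply: le_powR => //; first exact: ltW.
      by rewrite -[X in (`|X| <= _)%R](subrK (f x)) ler_normD.
    rewrite ge0_integralZl_EFin//; side;
      try by apply: emeasurable_funD => //; exact: measurable_diff_pow.
    rewrite lte_mul_pinfty ?lee_fin ?powR_ge0// ge0_integralD//; side;
      try exact: measurable_diff_pow.
    rewrite integral_cst; last exact: measurable_mball.
    rewrite lte_add_pinfty//; last by rewrite [in X in _ * X](VE b r0) -EFinM ltey.
    apply: le_lt_trans Ix; apply: ge0_subset_integral.
    - exact: measurable_mball.
    - exact: measurable_mball.
    - exact: measurable_diff_pow.
    - by move=> x' _; rewrite lee_fin powR_ge0.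
    - apply: subset_mball; move: bx; rewrite ballEmdist/= metric_sym => bx.
      by rewrite (le_trans _ (ltW rt))// mulr_natl mulr2n lerD2r ltW.
  apply/eqP; rewrite -leye_eq.
  apply: (@le_trans _ _ (\int[nu]_(x in ball b r) (cst +oo) x)).
    rewrite integral_cst; last exact: measurable_mball.
    by rewrite [in X in _ * X](VE b r0) gt0_mulye// lte_fin V_gt0.
  rewrite integral_mkcond; apply: le_lower_integral => x _.
    by rewrite patchE; case: ifP => //= _; exact: leey.
  by rewrite patchE; case: ifPn => [/set_mem /bb ->//|_]; exact: osc_int_ge0.
(* One infinite weight, at a scale where [osc_fun] is [+oo] throughout, suffices to contradict
   [fin_energy] via [dyadic_lower]. *)
pose w l : \bar R := if l == k then +oo else 0.
have w0 l : 0 <= w l by rewrite /w; case: ifP.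
have wH l t : (sc (l - 1) < t <= sc l)%R -> w l <= osc_fun t.
  rewrite /w; case: eqP => [->|_ _]; last exact: osc_fun_ge0.
  by move=> /andP[kt _]; rewrite Hoo// (le_lt_trans kr).
have := dyadic_lower osc_fun_ge0 w0 wH; rewrite -/besov_energy.
have [n nk] := int_enum_surj k.
move=> /(le_trans (nneseries_ge_term n (fun m => w0 (int_enum m)))).
rewrite nk /w eqxx leye_eq => /eqP E; move: fin_energy.
move=> fe; have : 2%:E * besov_energy < +oo by apply: lte_mul_pinfty.
by rewrite E.
Qed.

Lemma besov_integrable_ball b r : (0 < r)%R -> nu.-integrable (ball b r) (EFin \o f).
Proof.
move=> r0; apply/integrableP; split; first exact/measurable_EFinP/measurable_funTS.
apply: (@le_lt_trans _ _ (\int[nu]_(x in ball b r) (1 + (`|f x| `^ p)%:E))).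
  apply: le_lower_integral => x _; rewrite //= -EFinD lee_fin.
  by apply: le_trans (young_powR p1 (normr_ge0 _) ltr01) _; rewrite powR1 mul1r.
have mp : measurable_fun (ball b r) (fun x => (`|f x| `^ p)%:E).
  by have := @measurable_diff_pow (ball b r) 0; under eq_fun do rewrite subr0.
rewrite ge0_integralD//; side.
rewrite lte_add_pinfty//; last exact: besov_Lp_ball.
by rewrite integral_cst; side; rewrite mul1e (VE b r0) ltey.
Qed.

End besov_functions.

Local Open Scope ereal_scope.

Definition besov_adm (f : bd -> R) :=
  measurable_fun setT f /\ besov_energy f < +oo.

Lemma measurable_absdiff (f : bd -> R) (D : set bd) c : measurable_fun setT f ->
  measurable_fun D (fun x => `|f x - c|%:E).
Proof.
move=> mf; apply/measurable_EFinP; apply: measurable_funTS.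
by apply: (measurableT_comp (@normr_measurable R setT)); apply: measurable_funB.
Qed.

Lemma besov_Lp (f : bd -> R) b r : besov_adm f -> (0 < r)%R ->
  nu.-integrable (ball b r) (EFin \o f).
Proof. by move=> [mf fe] r0; exact: besov_integrable_ball. Qed.

(** The factor 16 exceeds $6+27/4$: the ball contains the support of the kernel of every point
    [anchored] to [y k l]. *)
Definition nball k l := ball (y k l) (16 * sc k)%R.

Lemma sc16 k : (0 < 16 * sc k :> R)%R. Proof. by rewrite mulr_gt0// sc_gt0. Qed.

Definition cmean (f : bd -> R) k l : R :=
  ((V (y k l) (16 * sc k))^-1 * fine (\int[nu]_(x in nball k l) (f x)%:E))%R.

Definition net_osc (f : bd -> R) k l : \bar R :=
  \int[nu]_(x in nball k l) (`|f x - cmean f k l| `^ p)%:E.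

Definition scale_osc (f : bd -> R) k : \bar R := \sum_(l <oo) net_osc f k l.

Lemma net_osc_ge0 f k l : 0 <= net_osc f k l.
Proof. by apply: integral_ge0 => x _; rewrite lee_fin powR_ge0. Qed.

Lemma scale_osc_ge0 f k : 0 <= scale_osc f k.
Proof. by apply: nneseries_ge0 => l _ _; exact: net_osc_ge0. Qed.

Lemma cmean_dist_pow (f : bd -> R) k l c : besov_adm f ->
  (`|cmean f k l - c| `^ p)%:E <=
  (2 `^ p)%:E * (((V (y k l) (16 * sc k))^-1)%:E *
    \int[nu]_(x in nball k l) (`|f x - c| `^ p)%:E).
Proof.
move=> Hf; have s0 := sc16 k; have V0 := V_gt0 (y k l) s0.
have mB : measurable (nball k l) by exact: measurable_mball.
have fi : nu.-integrable (nball k l) (EFin \o f) by exact: besov_Lp.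
have nuB : nu (nball k l) = (V (y k l) (16 * sc k))%:E by exact: VE.
have := mean_dist c mB V0 nuB fi; rewrite -/(cmean f k l) => H.
rewrite -poweR_EFin; apply: le_trans (lee_poweR (ltW p0) _ H) _; first by rewrite lee_fin.
have := jensen_powR p1 mB V0 nuB (measurable_absdiff (D := nball k l) c Hf.1).
by move=> /(_ (fun x => _)) -> // x; rewrite lee_fin.
Qed.

(** For [b] in [nball k l], a radius above [32 * sc k] is large enough for [ball b r] to contain the
    whole net ball, so the deviation from the mean is bounded by the oscillation around [b]; the
    upper limit [64 * sc k] keeps the measures comparable. *)
Lemma net_dev : exists2 C : R, (0 < C)%R & forall (f : bd -> R), besov_adm f ->
  forall k l r b, (sc (k + 5) < r <= sc (k + 6))%R -> nball k l b ->
  (`|f b - cmean f k l| `^ p)%:E <= (C * r `^ (al * p))%:E * osc_int f r b.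
Proof.
have L0 : (0 < 5 :> R)%R by [].
have [C C0 HC] := V_doubling L0.
exists (2 `^ p * C)%R; first by rewrite mulr_gt0// powR_gt0.
move=> f Hf k l r b /andP[rk1 rk2] bB.
have s0 := sc16 k; have V0 := V_gt0 (y k l) s0.
have e5 : (sc (k + 5) = 32 * sc k :> R)%R.
  by rewrite scD mulrC; congr (_ * _)%R; rewrite sc_nat; ring.
have e6 : (sc (k + 6) = 64 * sc k :> R)%R.
  by rewrite scD mulrC; congr (_ * _)%R; rewrite sc_nat; ring.
have r0 : (0 < r)%R by apply: lt_trans rk1; exact: sc_gt0.
move: (bB); rewrite /nball ballEmdist/= => by'.
rewrite distrC; apply: le_trans (cmean_dist_pow k l (f b) Hf) _.
apply: (@le_trans _ _ ((2 `^ p)%:E * (((V (y k l) (16 * sc k))^-1)%:E *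
    \int[nu]_(x in ball b r) (`|f x - f b| `^ p)%:E))).
  apply: lee_wpmul2l; first by rewrite lee_fin powR_ge0.
  apply: lee_wpmul2l; first by rewrite lee_fin invr_ge0 ltW.
  apply: ge0_subset_integral; side; first exact: measurable_diff_pow Hf.1 _ _.
  by apply: subset_mball; rewrite metric_sym; move: rk1; rewrite e5; lra.
rewrite (osc_intE Hf.1)//; move: (osc_int f r b) (osc_int_ge0 f r b) => O O0.
rewrite !muleA -!EFinM; apply: lee_wpmul2r => //.
rewrite lee_fin mulrA ler_wpM2r ?powR_ge0// -mulrA ler_wpM2l ?powR_ge0//.
rewrite ler_pdivrMl// mulrC; apply: HC => //.
by move: rk2; rewrite e6 metric_sym => rk2; lra.
Qed.

Lemma scale_osc_le : exists2 C : R, (0 < C)%R & forall (f : bd -> R), besov_adm f ->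
  forall k r, (sc (k + 5) < r <= sc (k + 6))%R ->
  scale_osc f k <= (C * r `^ (al * p))%:E * osc_fun f r.
Proof.
have [C C0 HC] := net_dev.
have L0 : (0 < 16 :> R)%R by [].
have [N HN] := net_overlap L0.
exists (C * (Num.max N 1))%R; first by rewrite mulr_gt0// lt_max ltr01 orbT.
move=> f Hf k r Hr; set N' := Num.max N 1%R.
have N'0 : (0 < N')%R by rewrite lt_max ltr01 orbT.
have r0 : (0 < r)%R by case/andP: Hr => H _; apply: lt_trans H; exact: sc_gt0.
have rp0 : (0 < r `^ (al * p))%R by rewrite powR_gt0.
pose G b := \sum_(l <oo) ((\1_(nball k l) b)%:E * (`|f b - cmean f k l| `^ p)%:E).
have mterm l : measurable_fun setT (fun b => (\1_(nball k l) b)%:E * (`|f b - cmean f k l| `^ p)%:E).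
  apply: emeasurable_funM; last exact: measurable_diff_pow Hf.1 _ _.
  by apply/measurable_EFinP; apply: measurable_indic; exact: measurable_mball.
have term0 l b : 0 <= (\1_(nball k l) b)%:E * (`|f b - cmean f k l| `^ p)%:E.
  by rewrite mule_ge0// lee_fin ?powR_ge0.
have G0 b : 0 <= G b by exact: nneseries_ge0.
have mG : measurable_fun setT G.
  exact: (@ge0_emeasurable_sum _ _ R setT _ xpredT).
have -> : scale_osc f k = \int[nu]_b G b.
  rewrite integral_nneseries//; apply: eq_eseriesr => l _.
  rewrite /net_osc -[X in integral _ X _]setTI integral_mkcondr.
  by apply: eq_integral => x _; rewrite patchE indicE; case: (x \in _); rewrite ?mul1e ?mul0e.
have c0 : (0 < C * N' * r `^ (al * p))%R by rewrite !mulr_gt0.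
(* The constant is taken out of the integral of the measurable [G]; the integral of [osc_int] on the
   other side is then reached by monotonicity. *)
have -> : \int[nu]_b G b = (C * N' * r `^ (al * p))%:E *
    \int[nu]_b (((C * N' * r `^ (al * p))^-1)%:E * G b).
  rewrite ge0_integralZl_EFin// ?muleA; last by rewrite invr_ge0 ltW.
  by rewrite -EFinM mulfV ?mul1e// gt_eqF.
apply: lee_wpmul2l; first by rewrite lee_fin ltW.
apply: le_lower_integral => b _; first by rewrite mule_ge0// lee_fin invr_ge0 ltW.
rewrite lee_pdivrMl//.
apply: lime_le; first by apply: is_cvg_nneseries.
apply: nearW => n; rewrite big_mkord.
apply: (@le_trans _ _ (\sum_(l < n) ((\1_(nball k l) b)%:E *
    ((C * r `^ (al * p))%:E * osc_int f r b)))).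
  apply: lee_sum => l _; rewrite indicE.
  case: (boolP (b \in _)) => [/set_mem bB|_]; last by rewrite !mul0e.
  by rewrite !mul1e; exact: HC.
rewrite -ge0_sume_distrl; last by move=> l _; rewrite lee_fin.
rewrite sumEFin muleA; apply: lee_wpmul2r; first exact: osc_int_ge0.
rewrite -EFinM lee_fin (mulrC C N') -mulrA ler_wpM2r ?mulr_ge0 ?(ltW C0) ?(ltW rp0)//.
rewrite le_max; apply/orP; left.
apply: le_trans (HN (sc k) (y k) (j b) n (sc_gt0 k) (y_sep k)).
apply: ler_sum => l _; rewrite indicE /nball ler_nat.
case: (boolP (b \in _)) => // /set_mem; rewrite ballEmdist/= iso_j metric_sym => ->.
by [].
Qed.

(** Scale [k] is compared with the radii in $]2^{k+5},2^{k+6}]$; the shift by 6 costs the factor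
    $64^{\alpha p}$ and is undone by translation invariance of the sum over scales. *)
Lemma scale_osc_energy : exists2 C : R, (0 < C)%R & forall f, besov_adm f ->
  zsum (fun k => (sc k `^ (- (al * p)))%:E * scale_osc f k) <= C%:E * besov_energy f.
Proof.
have [C C0 HC] := scale_osc_le.
have D0 : (0 < C * 64 `^ (al * p))%R by rewrite mulr_gt0// powR_gt0.
exists (C * 64 `^ (al * p) * 2)%R; first by rewrite mulr_gt0.
move=> f Hf.
pose w k := ((C * sc (k + 6) `^ (al * p))^-1)%:E * scale_osc f k.
have w0 k : 0 <= w k.
  by rewrite mule_ge0 ?scale_osc_ge0// lee_fin invr_ge0 mulr_ge0 ?powR_ge0// ltW.
have -> : zsum (fun k => (sc k `^ (- (al * p)))%:E * scale_osc f k) =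
    (C * 64 `^ (al * p))%:E * zsum w.
  rewrite -zsumZl//; congr zsum; apply/funext => k; rewrite /w muleA -EFinM.
  congr (_%:E * _); rewrite powRN.
  have -> : (sc (k + 6) = 64 * sc k :> R)%R.
    by rewrite scD mulrC; congr (_ * _)%R; rewrite sc_nat; ring.
  have h1 : (sc k `^ (al * p) != 0 :> R)%R by rewrite gt_eqF// powR_gt0// sc_gt0.
  have h2 : (64 `^ (al * p) != 0 :> R)%R by rewrite gt_eqF// powR_gt0.
  rewrite powRM ?(ltW (sc_gt0 _))//; field.
  by rewrite h1 h2 gt_eqF.
rewrite (_ : (C * 64 `^ (al * p) * 2)%:E * besov_energy f =
  (C * 64 `^ (al * p))%:E * (2%:E * besov_energy f)); last by rewrite muleA -EFinM.
apply: lee_wpmul2l; first by rewrite lee_fin ltW.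
rewrite -(zsum_shift (-6) w0).
have wk0 k : 0 <= w (k - 6)%R by exact: w0.
apply: (@dyadic_lower R (osc_fun f) (fun k => w (k - 6)%R) (osc_fun_ge0 f) wk0).
move=> k r kr; rewrite /w subrK.
have kr0 : (0 < r)%R by case/andP: kr => H _; apply: lt_trans H; exact: sc_gt0.
have Hk : scale_osc f (k - 6) <= (C * sc k `^ (al * p))%:E * osc_fun f r.
  apply: le_trans (HC f Hf (k - 6)%R r _) _.
    by move: kr; rewrite subrK -addrA.
  apply: lee_wpmul2r; first exact: osc_fun_ge0.
  rewrite lee_fin ler_pM2l//; case/andP: kr => _ kr.
  by apply: le_powR; rewrite ?(ltW alp_gt0) ?(ltW kr0).
have c0 : (0 < C * sc k `^ (al * p))%R by rewrite mulr_gt0// powR_gt0// sc_gt0.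
have := lee_wpmul2l (_ : 0 <= ((C * sc k `^ (al * p))^-1)%:E) Hk.
rewrite lee_fin invr_ge0 ltW// => /(_ isT) {}Hk; apply: le_trans Hk _.
by rewrite muleA -EFinM mulVf ?mul1e// gt_eqF.
Qed.

Local Close Scope ereal_scope.

(** * The extension operator *)

(** The factor 3 leaves room for a boundary ball of radius [delta x / 2] on which the kernel is at
    least [delta x]. *)
Definition kern (x : Omega) (b : bd) : R := Num.max 0 (3 * delta x - mdist (i x) (j b)).

Definition kernW x := \int[nu]_b kern x b.

Definition ext (f : bd -> R) x := (\int[nu]_b (kern x b * f b)) / kernW x.

Lemma kern_ge0 x b : 0 <= kern x b. Proof. by rewrite le_max lexx. Qed.

Lemma kern_le x b : kern x b <= 3 * delta x.
Proof.
by rewrite ge_max mulr_ge0 ?(ltW (delta_gt0 _))//= gerBl mdist_ge0.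
Qed.

Lemma kern_out x b : 3 * delta x <= mdist (i x) (j b) -> kern x b = 0.
Proof. by move=> H; rewrite /kern max_l// subr_le0. Qed.

Lemma max0_lip (a a' : R) : `|Num.max 0 a - Num.max 0 a'| <= `|a - a'|.
Proof.
wlog aa : a a' / a <= a'.
  by move=> H; have [/H//|/ltW /H] := leP a a'; rewrite distrC [X in _ <= X]distrC.
rewrite [leRHS]distrC (ger0_norm (_ : 0 <= a' - a)) ?subr_ge0//.
by case: (leP 0 a) => ha; case: (leP 0 a') => hb; rewrite ler_norml; apply/andP; split; lra.
Qed.

Lemma kern_lip x x' b : `|kern x b - kern x' b| <= 4 * mdist x x'.
Proof.
apply: le_trans (max0_lip _ _) _; rewrite ler_norml.
have := delta_lip x x'; have := delta_lip x' x; rewrite (metric_sym x' x).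
have := metric_triangle (i x) (i x') (j b); have := metric_triangle (i x') (i x) (j b).
by rewrite !iso_i (metric_sym x' x) => h1 h2 h3 h4; apply/andP; split; lra.
Qed.

Lemma measurable_kern x (D : set bd) : measurable_fun D (kern x).
Proof.
apply: measurable_funTS; apply/measurable_EFinP.
apply: (borel_measurable (Z := bd)) => //; apply: continuous_borel.
apply: (@lipschitz_continuous _ _ _ 1) => // b b'; rewrite mul1r.
apply: le_trans (max0_lip _ _) _; rewrite ler_norml -iso_j.
have := metric_triangle (i x) (j b) (j b'); have := metric_triangle (i x) (j b') (j b).
by rewrite (metric_sym (j b') (j b)) => h1 h2; apply/andP; split; lra.
Qed.

(** The bounds are slightly larger than the [2 * sc k] and [5 * sc k] provided by [ex_anchored], so
    that points within [sc k / 8] stay anchored to the same net point. *)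
Definition anchored (k : int) (l : nat) (x : Omega) :=
  delta x <= 9 / 4 * sc k /\ mdist (i x) (j (y k l)) <= 6 * sc k.

Lemma anchored_out k l x b : anchored k l x -> ~ nball k l b -> kern x b = 0.
Proof.
move=> [h1 h2] nb; apply: kern_out; rewrite leNgt; apply/negP => lt; apply: nb.
rewrite /nball ballEmdist/= -iso_j.
have := metric_triangle (j (y k l)) (i x) (j b); rewrite (metric_sym (j _) (i x)).
have := sc_gt0 (R := R) k; lra.
Qed.

Lemma Rintegral_anchored k l x (h : bd -> R) : anchored k l x ->
  \int[nu]_b (kern x b * h b) = \int[nu]_(b in nball k l) (kern x b * h b).
Proof.
move=> an; rewrite [RHS]Rintegral_mkcond; apply: eq_Rintegral => b _.
rewrite patchE; case: ifPn => // /negP nb.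
by rewrite (anchored_out an) ?mul0r// => /mem_set.
Qed.

Lemma ex_anchored x : exists k l, [/\ sc k <= delta x, delta x < sc (k + 1) &
  mdist (i x) (j (y k l)) < 5 * sc k].
Proof.
have d0 := delta_gt0 x; have [k /andP[kd dk]] := ex_scale d0.
have [b xb] := delta_lt x d0; have [l lb] := y_cov k b.
exists k, l; split => //; have := metric_triangle (i x) (j b) (j (y k l)).
move: dk; rewrite scS (metric_sym (j b)) iso_j; lra.
Qed.

Lemma kernW_lower (tau : R) : 0 < tau -> exists2 c0 : R, 0 < c0 &
  forall k l x, tau * sc k <= delta x -> anchored k l x ->
  c0 * (sc k * V (y k l) (16 * sc k)) <= kernW x.
Proof.
(* The distance from [y k l] to [b0] plus [16 * sc k] is below [26 * sc k], which is at most
   $52/\tau$ times the radius [delta x / 2]. *)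
move=> tau0; have L0 : 0 < 52 / tau by rewrite divr_gt0.
have [C C0 HC] := V_doubling L0.
exists (tau / C); first by rewrite divr_gt0.
move=> k l x tx an; have d0 := delta_gt0 x; have s0 : 0 < sc k :> R := sc_gt0 k.
have d20 : 0 < delta x / 2 by rewrite divr_gt0.
have [b0 xb0] := delta_lt x d20.
have VV : V (y k l) (16 * sc k) <= C * V b0 (delta x / 2).
  apply: HC => //; first exact: sc16.
  case: an => a1 a2; rewrite -iso_j.
  have := metric_triangle (j (y k l)) (i x) (j b0); rewrite (metric_sym (j _) (i x)).
  have e : 26 * sc k <= 52 / tau * (delta x / 2).
    rewrite (_ : 52 / tau * _ = 26 * (delta x / tau)); last by field; rewrite gt_eqF.
    by rewrite ler_pM2l// ler_pdivlMr// mulrC.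
  lra.
have -> : kernW x = \int[nu]_(b in nball k l) (kern x b * 1).
  by rewrite -(Rintegral_anchored _ an); apply: eq_Rintegral => b _; rewrite mulr1.
have sub : ball b0 (delta x / 2) `<=` nball k l.
  move=> b; rewrite ballEmdist/= => bb; apply: contrapT => /(anchored_out an) K0.
  have : 0 < kern x b; last by rewrite K0 ltxx.
  rewrite lt_max; apply/orP; right; rewrite -iso_j in bb.
  have := metric_triangle (i x) (j b0) (j b); lra.
have m1 := measurable_mball b0 (delta x / 2).
have i1 : nu.-integrable (nball k l) (EFin \o (fun b => kern x b * 1)).
  apply: (@integrable_bounded_mul _ _ _ _ _ _ _ (3 * delta x)); first exact: measurable_mball.
  - exact: measurable_kern.
  - by move=> b _; rewrite ger0_norm ?kern_ge0// kern_le.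
  - apply: integrable_cst_fin (VE (y k l) (sc16 k)); exact: measurable_mball.
apply: (@le_trans _ _ (\int[nu]_(b in ball b0 (delta x / 2)) delta x)).
  rewrite Rintegral_cst// (VE b0 d20) /=.
  apply: (@le_trans _ _ (tau * sc k * V b0 (delta x / 2))).
    rewrite (_ : tau / C * _ = tau * sc k * (V (y k l) (16 * sc k) / C)); last by field; rewrite gt_eqF.
    apply: ler_wpM2l; first by rewrite mulr_ge0// ltW.
    by rewrite ler_pdivrMr// (mulrC _ C).
  by rewrite ler_wpM2r// ltW// V_gt0.
apply: (@le_trans _ _ (\int[nu]_(b in ball b0 (delta x / 2)) (kern x b * 1))).
  apply: le_Rintegral => //.
  - exact: integrable_cst_fin (VE b0 d20).
  - by apply: integrableS i1 => //; exact: measurable_mball.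
  move=> b; rewrite ballEmdist/= mulr1 le_max => bb; apply/orP; right; rewrite -iso_j in bb.
  have := metric_triangle (i x) (j b0) (j b); lra.
rewrite /Rintegral fine_le//.
- by apply: integrable_fin_num => //; apply: integrableS i1 => //; exact: measurable_mball.
- by apply: integrable_fin_num => //; exact: measurable_mball.
apply: ge0_subset_integral => //; first exact: measurable_mball.
  by case/integrableP: i1.
by move=> b _; rewrite lee_fin mulr1 kern_ge0.
Qed.

Definition dev (f : bd -> R) (c : R) k l : R :=
  (\int[nu]_(b in nball k l) `|f b - c|) / V (y k l) (16 * sc k).

Lemma nball_integrable_sub (f : bd -> R) c k l : besov_adm f ->
  nu.-integrable (nball k l) (EFin \o (fun b => f b - c)).
Proof.
move=> Hf; have s0 := sc16 k; have mB := measurable_mball (y k l) (16 * sc k).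
have i1 : nu.-integrable (nball k l) (EFin \o f) by exact: besov_Lp.
have i2 := integrable_cst_fin c mB (VE (y k l) s0).
by have := integrableB mB i1 i2; apply: eq_integrable.
Qed.

Lemma kern_integrable k l x (h : bd -> R) : nu.-integrable (nball k l) (EFin \o h) ->
  nu.-integrable (nball k l) (EFin \o (fun b => kern x b * h b)).
Proof.
move=> ih; apply: (@integrable_bounded_mul _ _ _ _ _ _ _ (3 * delta x)) => //.
- exact: measurable_mball.
- exact: measurable_kern.
- by move=> b _; rewrite ger0_norm ?kern_ge0// kern_le.
Qed.

Lemma one_integrable k l : nu.-integrable (nball k l) (EFin \o (fun=> 1 : R)).
Proof. by apply: integrable_cst_fin (VE (y k l) (sc16 k)); exact: measurable_mball. Qed.

Lemma kernWE k l x : anchored k l x ->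
  kernW x = \int[nu]_(b in nball k l) (kern x b * 1).
Proof.
move=> an; rewrite -(Rintegral_anchored _ an); apply: eq_Rintegral => b _.
by rewrite mulr1.
Qed.

(** The extension reproduces constants, so only the deviation of [f] from [c] on the net ball
    matters, for any [c]. *)
Lemma ext_sub (f : bd -> R) c k l x : besov_adm f -> anchored k l x -> 0 < kernW x ->
  (ext f x - c) * kernW x = \int[nu]_(b in nball k l) (kern x b * (f b - c)).
Proof.
move=> Hf an W0; rewrite mulrBl /ext mulfVK ?gt_eqF// (Rintegral_anchored _ an).
have mB := measurable_mball (y k l) (16 * sc k); have i1 := one_integrable k l.
rewrite [in LHS](kernWE an) -RintegralZl//; last exact: kern_integrable.
have i2 : nu.-integrable (nball k l) (EFin \o f) by apply: besov_Lp => //; exact: sc16.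
rewrite -RintegralB//; last 2 first.
- exact: kern_integrable.
- have := integrableZl mB c (kern_integrable x i1).
  by apply: eq_integrable => // b _; rewrite /= EFinM.
by apply: eq_Rintegral => b _; ring.
Qed.

Lemma norm_Rintegral_mul (f g : bd -> R) M c k l : besov_adm f ->
  measurable_fun (nball k l) g ->
  (forall b, nball k l b -> `|g b| <= M) ->
  `|\int[nu]_(b in nball k l) (g b * (f b - c))| <=
  M * (dev f c k l * V (y k l) (16 * sc k)).
Proof.
move=> Hf mg gM; have s0 := sc16 k; have mB := measurable_mball (y k l) (16 * sc k).
have i1 := nball_integrable_sub c k l Hf.
have i2 : nu.-integrable (nball k l) (EFin \o (fun b => g b * (f b - c))).
  exact: (@integrable_bounded_mul _ _ _ _ _ _ _ M).
rewrite /dev mulfVK ?gt_eqF ?V_gt0//.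
apply: le_trans (le_normr_Rintegral mB i2) _.
have i3 : nu.-integrable (nball k l) (EFin \o (fun b => `|f b - c|)).
  exact: (integrable_norm i1).
rewrite -RintegralZl//; apply: le_Rintegral => //.
- exact: (integrable_norm i2).
- by have := integrableZl mB M i3; apply: eq_integrable.
by move=> b Bb; rewrite normrM ler_wpM2r// gM.
Qed.

Lemma dev_ge0 f c k l : 0 <= dev f c k l.
Proof.
by rewrite divr_ge0 ?(ltW (V_gt0 _ (sc16 k)))//; apply: Rintegral_ge0.
Qed.

Lemma ext_dist (tau : R) : 0 < tau -> exists2 C : R, 0 < C & forall f c k l x,
  besov_adm f -> tau * sc k <= delta x -> anchored k l x ->
  `|ext f x - c| <= C * dev f c k l.
Proof.
move=> tau0; have [c0 c00 HW] := kernW_lower tau0.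
(* The kernel is at most [3 * delta x], hence at most [27 / 4 * sc k] at anchored points. *)
exists (27 / 4 / c0); first by rewrite divr_gt0.
move=> f c k l x Hf tx an; have s0 : 0 < sc k :> R := sc_gt0 k.
have V0 := V_gt0 (y k l) (sc16 k).
have W := HW _ _ _ tx an.
have cW0 : 0 < c0 * (sc k * V (y k l) (16 * sc k)) by rewrite !mulr_gt0.
have W0 : 0 < kernW x by exact: lt_le_trans W.
have := ext_sub c Hf an W0.
have /= H := @norm_Rintegral_mul f (kern x) (27 / 4 * sc k) c k l Hf (@measurable_kern _ _).
move=> E; rewrite -E in H.
have {}H : `|(ext f x - c) * kernW x| <= 27 / 4 * sc k * (dev f c k l * V (y k l) (16 * sc k)).
  apply: H => b _; rewrite ger0_norm ?kern_ge0//; apply: le_trans (kern_le _ _) _.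
  by case: an => h _; lra.
rewrite -(ler_pM2r cW0); apply: le_trans (_ : `|(ext f x - c) * kernW x| <= _).
  by rewrite normrM (gtr0_norm W0) ler_wpM2l.
apply: le_trans H _; rewrite le_eqVlt; apply/orP; left; apply/eqP; field.
by rewrite gt_eqF.
Qed.

(** The quotient is differentiated by hand: the difference times [kernW x] is the change of the
    centred numerator plus [ext f x' - c] times the change of [kernW]. Both are Lipschitz because
    the kernel is, and the normalization is bounded below by [kernW_lower]. *)
Lemma ext_lip : exists2 C : R, 0 < C & forall f c k l x x',
  besov_adm f -> sc k / 2 <= delta x -> sc k / 2 <= delta x' ->
  anchored k l x -> anchored k l x' ->
  `|ext f x - ext f x'| <= C * dev f c k l / sc k * mdist x x'.
Proof.
have tau0 : 0 < 2^-1 :> R by rewrite invr_gt0.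
have [c0 c00 HW] := kernW_lower tau0; have [C1 C10 HD] := ext_dist tau0.
exists (4 / c0 * (1 + C1)); first by rewrite mulr_gt0 ?divr_gt0// addr_gt0.
move=> f c k l x x' Hf; rewrite !(mulrC (sc k)) => tx tx' an an'.
have s0 : 0 < sc k :> R := sc_gt0 k; have V0 := V_gt0 (y k l) (sc16 k).
set v := V (y k l) (16 * sc k) in V0 *.
have cW0 : 0 < c0 * (sc k * v) by rewrite !mulr_gt0.
have W := HW _ _ _ tx an; have W' := HW _ _ _ tx' an'.
have W0 : 0 < kernW x by exact: lt_le_trans W.
have W'0 : 0 < kernW x' by exact: lt_le_trans W'.
have mB := measurable_mball (y k l) (16 * sc k).
have D' := HD f c k l x' Hf tx' an'.
have i1 := nball_integrable_sub c k l Hf.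
have kl b : `|kern x b - kern x' b| <= 4 * mdist x x' by exact: kern_lip.
have mk : measurable_fun (nball k l) (fun b => kern x b - kern x' b).
  by apply: measurable_funB; exact: measurable_kern.
have P1 : `|(ext f x - c) * kernW x - (ext f x' - c) * kernW x'| <=
    4 * mdist x x' * (dev f c k l * v).
  rewrite (ext_sub c Hf an W0) (ext_sub c Hf an' W'0) -RintegralB//; try exact: kern_integrable.
  under eq_Rintegral do rewrite -mulrBl.
  by apply: norm_Rintegral_mul.
have P2 : `|kernW x - kernW x'| <= 4 * mdist x x' * v.
  rewrite (kernWE an) (kernWE an') -RintegralB//; try exact: kern_integrable (one_integrable _ _).
  under eq_Rintegral do rewrite !mulr1.
  have i2 : nu.-integrable (nball k l) (EFin \o (fun b => (kern x b - kern x' b) * 1)).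
    apply: (@integrable_bounded_mul _ _ _ _ _ _ _ (4 * mdist x x')) => //.
    exact: one_integrable.
  have {}i2 : nu.-integrable (nball k l) (EFin \o (fun b => kern x b - kern x' b)).
    by apply: eq_integrable i2 => // b _; rewrite /= mulr1.
  apply: le_trans (le_normr_Rintegral mB i2) _.
  have -> : 4 * mdist x x' * v = \int[nu]_(b in nball k l) (4 * mdist x x').
    by rewrite Rintegral_cst// (VE (y k l) (sc16 k)).
  apply: le_Rintegral => //; first exact: (integrable_norm i2).
  by apply: integrable_cst_fin (VE (y k l) (sc16 k)).
have E : (ext f x - ext f x') * kernW x =
   ((ext f x - c) * kernW x - (ext f x' - c) * kernW x') +
   (ext f x' - c) * (kernW x' - kernW x) by ring.
have {}E : `|ext f x - ext f x'| * kernW x <= 4 * (1 + C1) * mdist x x' * (dev f c k l * v).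
  rewrite -[X in _ * X](gtr0_norm W0) -normrM E; apply: le_trans (ler_normD _ _) _.
  rewrite (_ : 4 * (1 + C1) * _ * _ = 4 * mdist x x' * (dev f c k l * v) +
    C1 * dev f c k l * (4 * mdist x x' * v)); last by ring.
  by apply: lerD => //; rewrite normrM ler_pM// distrC.
rewrite -(ler_pM2r cW0); apply: (@le_trans _ _ (`|ext f x - ext f x'| * kernW x)).
  by rewrite ler_wpM2l.
apply: le_trans E _; rewrite le_eqVlt; apply/orP; left; apply/eqP; field.
by rewrite !gt_eqF.
Qed.

(** * An upper gradient of the extension *)

Section extension_gradient.
Variable f : bd -> R.
Hypothesis Hf : besov_adm f.
Variable CE : R.
Hypothesis CE0 : 0 < CE.
Hypothesis ext_lipf : forall k l x x', sc k / 2 <= delta x -> sc k / 2 <= delta x' ->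
  anchored k l x -> anchored k l x' ->
  `|ext f x - ext f x'| <= CE * dev f (cmean f k l) k l / sc k * mdist x x'.

Definition slope k l : R := CE * dev f (cmean f k l) k l / sc k.

Lemma slope_ge0 k l : 0 <= slope k l.
Proof. apply: divr_ge0; last exact: ltW (sc_gt0 k).
apply: mulr_ge0; [exact: ltW|exact: dev_ge0]. Qed.

Local Open Scope ereal_scope.

(** All slopes whose net point is close to [x] are kept, as p-th powers: the sum then dominates each
    of them and its energy is computed term by term. *)
Definition slope_sum n (x : Omega) : \bar R :=
  \sum_(l <oo) ((slope (int_enum n) l `^ p)%:E *
     (\1_(i @^-1` ball (j (y (int_enum n) l)) (6 * sc (int_enum n))%R) x)%:E).

Definition ext_grad := lp_sum p slope_sum.

Lemma slope_term_ge0 n l x : 0 <= (slope (int_enum n) l `^ p)%:E *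
     (\1_(i @^-1` ball (j (y (int_enum n) l)) (6 * sc (int_enum n))%R) x)%:E.
Proof. by rewrite mule_ge0// lee_fin// powR_ge0. Qed.

Lemma slope_term_borel n l : borel_fun (fun x => (slope (int_enum n) l `^ p)%:E *
     (\1_(i @^-1` ball (j (y (int_enum n) l)) (6 * sc (int_enum n))%R) x)%:E).
Proof.
apply/borel_funP; apply: emeasurable_funM; first exact: measurable_cst.
apply/measurable_EFinP; apply: measurable_indic; apply: sub_sigma_algebra.
by apply: open_comp; [move=> ? _; exact: isometric_continuous|exact: open_mball].
Qed.

Lemma slope_sum_ge0 n x : 0 <= slope_sum n x.
Proof. by apply: nneseries_ge0 => l _ _; exact: slope_term_ge0. Qed.

Lemma slope_sum_borel n : borel_fun (slope_sum n).
Proof.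
apply/borel_funP.
apply: (@ge0_emeasurable_sum _ (g_sigma_algebraType (@open Omega)) R setT _ xpredT).
  by move=> l x _ _; exact: slope_term_ge0.
by move=> l _; apply/borel_funP; exact: slope_term_borel.
Qed.

Lemma ext_grad_ge0 x : 0 <= ext_grad x. Proof. exact: poweR_ge0. Qed.

Lemma ext_grad_borel : borel_fun ext_grad.
Proof. by apply: lp_sum_borel; [exact: slope_sum_borel|exact: slope_sum_ge0]. Qed.

Lemma ext_grad_ge k l x : (mdist (i x) (j (y k l)) < 6 * sc k)%R ->
  (slope k l)%:E <= ext_grad x.
Proof.
move=> xy; have [n nk] := int_enum_surj k.
rewrite -[leLHS](@poweRK _ _ p) ?gt_eqF// ?lee_fin ?slope_ge0//.
apply: lee_poweR; first by rewrite invr_ge0 ltW.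
  exact: poweR_ge0.
apply: le_trans (nneseries_ge_term n (slope_sum_ge0 ^~ x)).
apply: le_trans (nneseries_ge_term l _); last by move=> m; exact: slope_term_ge0.
rewrite nk poweR_EFin indicE mem_set ?mule1//= ballEmdist/= metric_sym.
exact: xy.
Qed.

(** Along a short piece of curve all points are anchored to one net point, where [ext f] is
    Lipschitz with constant [slope k l] and [ext_grad] is at least that constant; [small_step_bound]
    does the rest. *)
Lemma ext_grad_upper : upper_gradient (EFin \o ext f) ext_grad.
Proof.
split; [exact: ext_grad_ge0|exact: ext_grad_borel|move=> c rc].
have [gam [lip gamE g0 gL]] := ex_arclength_lipschitz rc.
rewrite /gradient_ineq (line_integral_lipschitz _ gamE); set L := fine _ in gamE gL *.
have L0 : (0 <= L)%R by rewrite fine_ge0// ltW//; case/andP: rc.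
rewrite -g0 -gL.
have cd : {within `[0%R, L], continuous (fun s => delta (gam s))}.
  apply: continuous_subspaceT; apply/continuousP => U oU.
  have cU : continuous (fun s => delta (gam s)).
    move=> s; apply/cvgrPdist_lt => e e0; apply/nbhs_ballP; exists e => // t.
    rewrite /ball/= => st; apply: le_lt_trans st.
    apply: le_trans (lip s t); rewrite ler_norml.
    have := delta_lip (gam s) (gam t); have := delta_lip (gam t) (gam s).
    by rewrite (metric_sym (gam t)) => h1 h2; apply/andP; split; lra.
  by apply: (open_comp (D := U)) => // ? _; exact: cU.
have [s0 _ smin] := EVT_min L0 cd.
(* The least depth along the curve gives a uniform step: since [delta (gam s) < 2 * sc k], a
   sixteenth of it is below [sc k / 8]. *)
have e0 : (0 < delta (gam s0) / 16)%R by rewrite divr_gt0// delta_gt0.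
apply: (small_step_bound (h := fun s => ext f (gam s)) (phi := ext_grad \o gam) e0 L0).
- exact: measurable_comp_lipschitz ext_grad_borel.
- by move=> x; exact: ext_grad_ge0.
move=> s t s0' st tL tse.
have ds : (delta (gam s0) <= delta (gam s))%R by apply: smin; rewrite in_itv/= s0' (le_trans st).
have [k [l [kd dk kl]]] := ex_anchored (gam s).
have near_s r : (s <= r)%R -> (r <= t)%R -> (mdist (gam s) (gam r) <= sc k / 8)%R.
  move=> sr rt; apply: le_trans (lip s r) _; rewrite distrC ger0_norm ?subr_ge0//.
  by move: dk; rewrite scS; lra.
have anc r : (s <= r)%R -> (r <= t)%R -> (sc k / 2 <= delta (gam r))%R /\ anchored k l (gam r).
  move=> sr rt; have nr := near_s _ sr rt; have s0k := sc_gt0 (R := R) k.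
  have := delta_lip (gam s) (gam r); have := delta_lip (gam r) (gam s).
  rewrite (metric_sym (gam r)) => h1 h2; move: dk; rewrite scS => dk.
  split; first by lra.
  split; first by lra.
  have := metric_triangle (i (gam r)) (i (gam s)) (j (y k l)).
  by rewrite iso_i (metric_sym (gam r)); lra.
have [d1' a1] := anc s (lexx _) st; have [d2' a2] := anc t st (lexx _).
apply: (@le_trans _ _ (\int[lebesgue_measure]_(x in `[s, t]) (slope k l)%:E)).
  rewrite integral_cst//= lebesgue_measure_itv/= lte_fin; case: ltP => ts.
    rewrite -EFinD -EFinM lee_fin distrC; apply: le_trans (ext_lipf d1' d2' a1 a2) _.
    apply: ler_wpM2l; first exact: slope_ge0.
    by apply: le_trans (lip s t) _; rewrite distrC ger0_norm ?subr_ge0.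
  have -> : t = s by apply/eqP; rewrite eq_le ts st.
  by rewrite subrr normr0 mule0.
apply: le_lower_integral => x; first by rewrite lee_fin slope_ge0.
rewrite /= in_itv/= => /andP[sx xt]; apply: ext_grad_ge.
have := near_s _ sx xt; have s0k := sc_gt0 (R := R) k.
have := metric_triangle (i (gam x)) (i (gam s)) (j (y k l)).
by rewrite iso_i (metric_sym (gam x)); lra.
Qed.

Lemma ext_continuous : continuous (ext f).
Proof.
move=> x; have [k [l [kd dk kl]]] := ex_anchored x.
have s0k := sc_gt0 (R := R) k; have M0 := slope_ge0 k l.
apply/cvgrPdist_lt => e e0.
have r0 : (0 < Num.min (sc k / 8) (e / (slope k l + 1)))%R.
  by rewrite lt_min !divr_gt0// ltr_wpDl.
apply/nbhs_ballP; exists (Num.min (sc k / 8) (e / (slope k l + 1)))%R => // x'.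
rewrite ballEmdist/= lt_min => /andP[h1 h2].
have := delta_lip x x'; have := delta_lip x' x; rewrite (metric_sym x' x) => h3 h4.
have := metric_triangle (i x') (i x) (j (y k l)); rewrite iso_i (metric_sym x') => h5.
rewrite scS in dk.
have H : (`|ext f x - ext f x'| <= slope k l * mdist x x')%R.
  by apply: ext_lipf; rewrite /anchored; try split; lra.
apply: le_lt_trans H _; apply: (@le_lt_trans _ _ ((slope k l + 1) * mdist x x')%R).
  by rewrite ler_wpM2r ?mdist_ge0// lerDl.
by rewrite mulrC -ltr_pdivlMr// ltr_wpDl.
Qed.

End extension_gradient.

Lemma slope_pow f CE k l : besov_adm f -> (0 < CE)%R ->
  ((slope f CE k l `^ p * V (y k l) (16 * sc k))%:E <=
  ((2 * CE) `^ p * sc k `^ (- p))%:E * net_osc f k l)%E.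
Proof.
move=> Hf CE0; have s0 := sc16 k; have mB := measurable_mball (y k l) (16 * sc k).
have V0 := V_gt0 (y k l) s0; have s0k := sc_gt0 (R := R) k.
have D0 := dev_ge0 f (cmean f k l) k l.
have := jensen_powR p1 mB V0 (VE (y k l) s0)
  (measurable_absdiff (D := nball k l) (cmean f k l) Hf.1).
move=> /(_ (fun x => ltac:(by rewrite lee_fin))) H.
have {}H : ((dev f (cmean f k l) k l `^ p)%:E <=
   (2 `^ p)%:E * (((V (y k l) (16 * sc k))^-1)%:E * net_osc f k l))%E.
  rewrite -poweR_EFin; apply: le_trans H.
  rewrite /dev mulrC EFinM /Rintegral fineK//.
  by apply: integrable_fin_num => //; exact: (integrable_norm (nball_integrable_sub _ _ _ Hf)).
rewrite /slope powRM ?mulr_ge0 ?(ltW CE0) ?invr_ge0 ?(ltW s0k)//.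
rewrite powRM ?(ltW CE0)// -powR_inv1 ?(ltW s0k)// -powRrM mulN1r.
rewrite -mulrA -mulrA EFinM.
rewrite (powRM p (ler0n _ 2) (ltW CE0)).
set S := sc k `^ (- p); set v := V _ _.
have S0 : 0 <= S by rewrite powR_ge0.
rewrite (_ : 2 `^ p * CE `^ p * S = CE `^ p * (2 `^ p * S)); last by ring.
rewrite (EFinM (CE `^ p)) -muleA; apply: lee_wpmul2l; first by rewrite lee_fin powR_ge0.
rewrite mulrC EFinM.
have Sv0 : 0 <= S * v by rewrite mulr_ge0// ltW.
apply: le_trans (lee_wpmul2l _ H) _; first by rewrite lee_fin.
rewrite !muleA -!EFinM; apply: lee_wpmul2r; first exact: net_osc_ge0.
  rewrite -/v lee_fin le_eqVlt; apply/orP; left; apply/eqP; field.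
  by rewrite gt_eqF.
  exact: Rintegral_ge0.
exact: ltW.
Qed.

Local Open Scope ereal_scope.

(** Each slope lives on a ball of [mu]-measure at most a constant times $2^{k\theta}$ times the
    boundary measure, by codimension; with the factor $2^{-kp}$ from [slope_pow] this is the weight
    $2^{-k\alpha p}$ of [scale_osc_energy]. *)
Lemma ext_grad_energy CE : (0 < CE)%R -> exists2 C : R, (0 < C)%R & forall f, besov_adm f ->
  \int[mu]_x (ext_grad f CE x `^ p) <= C%:E * besov_energy f.
Proof.
move=> CE0; have [C0 C00 HC0] := scale_osc_energy.
have [C1 C10 HC1] := mM_doubling 1.
have Cc0 : (0 < Cc)%R by exact: lt_le_trans Cc1.
pose D := (C1 * Cc * 16 `^ theta * (2 * CE) `^ p)%R.
have D0 : (0 < D)%R by rewrite !mulr_gt0 ?powR_gt0 ?mulr_gt0.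
exists (D * C0)%R; first by rewrite mulr_gt0.
move=> f Hf; rewrite EFinM -muleA; apply: le_trans (lee_wpmul2l _ (HC0 f Hf)); last first.
  by rewrite lee_fin ltW.
rewrite -zsumZl; last first.
  by move=> k; rewrite mule_ge0 ?scale_osc_ge0// lee_fin powR_ge0.
rewrite lp_sum_energy//; [|exact: slope_sum_borel|exact: slope_sum_ge0].
apply: lee_nneseries => n _.
  by move=> _; apply: integral_ge0 => x _; exact: slope_sum_ge0.
set k := int_enum n; rewrite /slope_sum integral_nneseries//; last 2 first.
- by move=> l; apply: borel_measurable => //; exact: slope_term_borel.
- by move=> l x _; exact: slope_term_ge0.
rewrite -nneseriesZl; last by move=> l _; exact: net_osc_ge0.
rewrite -nneseriesZl; last first.
  by move=> l _; rewrite mule_ge0 ?net_osc_ge0// lee_fin powR_ge0.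
apply: lee_nneseries => l _.
  by move=> _; apply: integral_ge0 => x _; exact: slope_term_ge0.
have s0k := sc_gt0 (R := R) k.
have s60 : (0 < 6 * sc k :> R)%R by rewrite mulr_gt0.
have s160 : (0 < 16 * sc k :> R)%R := sc16 k.
rewrite ge0_integralZl_EFin//; last first.
- exact: powR_ge0.
- apply/measurable_EFinP; apply: measurable_indic; exact: measurable_i_ball.
rewrite integral_indic//; last exact: measurable_i_ball.
rewrite setIT (mME (j (y k l)) s60).1 -EFinM.
have := slope_pow k l Hf CE0; move=> H.
have M1 : (mM (j (y k l)) (6 * sc k) <=
    C1 * (Cc * (16 `^ theta * sc k `^ theta) * V (y k l) (16 * sc k)))%R.
  apply: le_trans (HC1 _ (j (y k l)) _ _ s60 s160 _) _; first by rewrite mdistxx; lra.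
  rewrite ler_pM2l// -powRM ?(ltW s0k)//.
  exact: (codimE (y k l) s160).2.
apply: (@le_trans _ _ ((C1 * Cc * 16 `^ theta * sc k `^ theta)%:E *
   (slope f CE k l `^ p * V (y k l) (16 * sc k))%:E)).
  rewrite -EFinM lee_fin; apply: le_trans (ler_wpM2l (powR_ge0 _ _) M1) _.
  by rewrite le_eqVlt; apply/orP; left; apply/eqP; ring.
apply: le_trans (lee_wpmul2l _ H) _.
  by rewrite lee_fin !mulr_ge0 ?powR_ge0// ltW.
rewrite !muleA -!EFinM; apply: lee_wpmul2r; first exact: net_osc_ge0.
rewrite lee_fin alp opprB powRD; last by rewrite (gt_eqF s0k) implybT.
by rewrite le_eqVlt /D; apply/orP; left; apply/eqP; ring.
Qed.

Lemma ext_dirichlet : exists2 C : R, (0 < C)%R & forall f, besov_adm f ->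
  dirichlet mu p (EFin \o ext f) /\
  (dirichlet_norm mu p (EFin \o ext f) <= C%:E * besov_norm nu p al f)%E.
Proof.
have [CE CE0 HE] := ext_lip; have [C C0 HC] := ext_grad_energy CE0.
exists (C `^ p^-1)%R; first by rewrite powR_gt0.
move=> f Hf; have pg := ltW p0.
have HEf k l x x' h1 h2 a1 a2 := HE f (cmean f k l) k l x x' Hf h1 h2 a1 a2.
have ug := ext_grad_upper CE0 HEf.
have g0 := ext_grad_ge0 f CE.
have wug := upper_gradient_wug mu p1 ug.
have E0 := besov_energy_ge0 f.
have gfin : 'N[mu]_p%:E[ext_grad f CE] < +oo.
  apply/Lnorm_lty => //; apply: le_lt_trans (HC f Hf) _.
  by rewrite lte_mul_pinfty ?lee_fin ?(ltW C0)//; case: Hf.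
have ex : exists g, weak_upper_gradient mu p (EFin \o ext f) g /\ 'N[mu]_p%:E[g] < +oo.
  by exists (ext_grad f CE).
split.
  split => //; apply: borel_measurable => //; apply: continuous_borel.
  exact: (ext_continuous CE0 HEf).
(* Existence of a minimizer ensures that [minimal_wug] is not its default value [+oo]. *)
have [h hm] := ex_minimal_wug p1 mu_open ex.
have [_ _ mn] : is_minimal_wug mu p (EFin \o ext f) (minimal_wug mu p (EFin \o ext f)).
  by apply: xgetPex; exists h.
apply: le_trans (mn _ wug) _; rewrite LnormE// besov_normE -poweR_EFin -poweRM//; last first.
  by rewrite lee_fin ltW.
apply: lee_poweR; [by rewrite invr_ge0| |exact: HC].
by apply: integral_ge0 => x _; exact: poweR_ge0.
Qed.

(** * The trace operator *)

Variables (Cp lam : R).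
Hypothesis Cp0 : (0 < Cp)%R.
Hypothesis lam1 : (1 <= lam)%R.
Hypothesis poin : forall (z : Omega) (r : R) (u g : Omega -> \bar R), (0 < r)%R ->
  dirichlet mu p u -> upper_gradient u g ->
  average mu (ball z r) (fun x => `|u x - average mu (ball z r) u|) <=
  (Cp * r)%:E * (average mu (ball z (lam * r)%R) (fun x => g x `^ p)) `^ p^-1.

Let lam0 : (0 < lam)%R. Proof. exact: lt_le_trans lam1. Qed.

Lemma ME s r : (0 < r)%R -> mu (ball s r) = (mM (i s) r)%:E.
Proof. by move=> r0; rewrite -preimage_i_ball (mME (i s) r0).1. Qed.

Lemma M_gt0 s r : (0 < r)%R -> (0 < mM s r)%R.
Proof. by move=> r0; case: (mME s r0). Qed.

Lemma measurable_Mball (s : Omega) r : measurable (ball s r).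
Proof. by rewrite -preimage_i_ball; exact: measurable_i_ball. Qed.

Definition umean (u : Omega -> \bar R) s r : R :=
  ((mM (i s) r)^-1 * fine (\int[mu]_(x in ball s r) u x))%R.

Definition admissible (u g : Omega -> \bar R) :=
  [/\ dirichlet mu p u, upper_gradient u g & \int[mu]_x (g x `^ p) < +oo].

Lemma admissible_pow_measurable u g D : admissible u g ->
  measurable_fun D (fun x => g x `^ p).
Proof. by move=> [_ [_ bg _] _]; apply: measurable_funTS; exact: measurable_powp. Qed.

(** The right-hand side is finite. An infinite average would make the integrand on the left [+oo]
    everywhere, so the average is finite and [u] is integrable on the ball. *)
Lemma poincare_ball u g s r : admissible u g -> (0 < r)%R ->
  mu.-integrable (ball s r) u /\
  ((mM (i s) r)^-1)%:E * \int[mu]_(x in ball s r) `|u x - (umean u s r)%:E| <=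
  (Cp * r)%:E * (((mM (i s) (lam * r))^-1)%:E *
     \int[mu]_(x in ball s (lam * r)) (g x `^ p)) `^ p^-1.
Proof.
move=> Hug r0; have lr0 : (0 < lam * r)%R by rewrite mulr_gt0.
have [du ug gfin] := Hug.
have M0 := M_gt0 (i s) r0; have Ml0 := M_gt0 (i s) lr0.
have mB := measurable_Mball s r.
have mgp := admissible_pow_measurable (D := setT) Hug.
have mu_ : measurable_fun (ball s r) u by apply: measurable_funTS; case: du.
have := poin s r0 du ug; rewrite (averageE (fun x => g x `^ p) Ml0 (ME s lr0)).
set P := _ * _ `^ _ => H.
have Pfin : P < +oo.
  rewrite /P lte_mul_pinfty ?lee_fin ?mulr_ge0 ?(ltW Cp0) ?(ltW r0)//.
  apply: poweR_lty; rewrite lte_mul_pinfty ?lee_fin ?invr_ge0 ?(ltW Ml0)//.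
  apply: le_lt_trans gfin; apply: ge0_subset_integral => //.
  - exact: measurable_Mball.
  - by move=> x _; exact: poweR_ge0.
have av := averageE u M0 (ME s r0).
have fin : average mu (ball s r) u \is a fin_num.
  have aux e : average mu (ball s r) u = e -> (forall x, `|u x - e| = +oo) -> False.
    move=> E uE; move: H; rewrite E (averageE _ M0 (ME s r0)).
    under eq_integral do rewrite uE.
    rewrite integral_cst// (ME s r0) gt0_mulye ?lte_fin// gt0_muley ?lte_fin ?invr_gt0//.
    by rewrite leye_eq => /eqP E2; rewrite E2 in Pfin.
  by rewrite fin_numE; apply/andP; split; apply/eqP => /aux; apply => x; case: (u x).
have avE : average mu (ball s r) u = (umean u s r)%:E.
  rewrite -(fineK fin) /umean av; congr (_%:E).
  have : \int[mu]_(x in ball s r) u x \is a fin_num.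
    move: fin; rewrite av; case: (\int[mu]_(x in ball s r) u x) => //.
      by rewrite gt0_muley// lte_fin invr_gt0.
    by rewrite gt0_muleNy// lte_fin invr_gt0.
  by move=> If; rewrite fineM.
rewrite avE (averageE _ M0 (ME s r0)) in H; split => //.
have Ifin : \int[mu]_(x in ball s r) `|u x - (umean u s r)%:E| < +oo.
  rewrite ltey; apply/eqP => E; move: H; rewrite E gt0_muley ?lte_fin ?invr_gt0//.
  by rewrite leye_eq => /eqP E2; rewrite E2 in Pfin.
have i1 : mu.-integrable (ball s r) (fun x => u x - (umean u s r)%:E).
  apply/integrableP; split => //.
  by apply: emeasurable_funB => //; exact: measurable_cst.
have i2 := integrable_cst_fin (umean u s r) mB (ME s r0).
have := integrableD mB i1 i2; apply: eq_integrable => //.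
by move=> x _; exact: subeK.
Qed.

Lemma umean_jump u g s t r r' D : admissible u g -> (0 < r)%R -> (0 < r')%R ->
  ball t r' `<=` ball s r -> (0 < D)%R -> (mM (i s) r <= D * mM (i t) r')%R ->
  (`|umean u t r' - umean u s r| `^ p)%:E <=
  ((D * Cp * r) `^ p)%:E * (((mM (i s) (lam * r))^-1)%:E *
     \int[mu]_(x in ball s (lam * r)) (g x `^ p)).
Proof.
move=> Hug r0 r'0 sub D0 MD.
have lr0 : (0 < lam * r)%R by rewrite mulr_gt0.
have [iu H] := poincare_ball s Hug r0.
have M0 := M_gt0 (i s) r0; have M'0 := M_gt0 (i t) r'0; have Ml0 := M_gt0 (i s) lr0.
have mB := measurable_Mball s r; have mB' := measurable_Mball t r'.
have iu' : mu.-integrable (ball t r') u by exact: integrableS iu.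
have := mean_dist (umean u s r) mB' M'0 (ME t r'0) iu'; rewrite -/(umean u t r') => H1.
have {}H1 : (`|umean u t r' - umean u s r|)%:E <= D%:E * ((Cp * r)%:E *
   (((mM (i s) (lam * r))^-1)%:E * \int[mu]_(x in ball s (lam * r)) (g x `^ p)) `^ p^-1).
  apply: le_trans H1 _; apply: (@le_trans _ _ (D%:E * (((mM (i s) r)^-1)%:E *
     \int[mu]_(x in ball s r) `|u x - (umean u s r)%:E|))).
    rewrite muleA -EFinM; apply: lee_pmul.
    - by rewrite lee_fin invr_ge0 ltW.
    - exact: integral_ge0.
    - by rewrite lee_fin ler_pdivlMr// ler_pdivrMl// (mulrC _ D).
    - apply: ge0_subset_integral => //.
      apply: measurableT_comp => //; apply: emeasurable_funB; last exact: measurable_cst.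
      by apply: measurable_funTS; case: Hug => -[].
  by apply: lee_wpmul2l => //; rewrite lee_fin ltW.
rewrite -poweR_EFin; apply: le_trans (lee_poweR (ltW p0) _ H1) _; first by rewrite lee_fin.
have I0 : 0 <= \int[mu]_(x in ball s (lam * r)) (g x `^ p).
  by apply: integral_ge0 => x _; exact: poweR_ge0.
have J0 : 0 <= ((mM (i s) (lam * r))^-1)%:E * \int[mu]_(x in ball s (lam * r)) (g x `^ p).
  by rewrite mule_ge0// lee_fin invr_ge0 ltW.
rewrite muleA -EFinM poweRM ?poweR_ge0//; last first.
  by rewrite lee_fin !mulr_ge0 ?(ltW D0) ?(ltW Cp0) ?(ltW r0).
by rewrite poweRVK ?gt_eqF// poweR_EFin mulrA.
Qed.

Variable z : int -> nat -> Omega.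
Hypothesis z_near : forall k l, (mdist (i (z k l)) (j (y k l)) < 3 / 2 * sc k)%R.
Hypothesis z_delta : forall k l, (sc k / A <= delta (z k l))%R.

Let A0 : (0 < A)%R. Proof. exact: lt_le_trans A1. Qed.

(* The constants are such that the dilated balls met along a chain at scale [k]
   stay in [shell k l]. *)
Definition kap : R := ((8 * A ^+ 2 * lam)^-1)%R.
Definition rad k : R := (kap * sc k)%R.
Definition tau : R := ((4 * A ^+ 2)^-1)%R.

Lemma kap_gt0 : (0 < kap)%R.
Proof. by rewrite invr_gt0 !mulr_gt0// exprn_gt0. Qed.

Lemma kap_le1 : (kap <= 1)%R.
Proof.
rewrite /kap invf_le1; last by rewrite !mulr_gt0// exprn_gt0.
have A2 : (1 <= A ^+ 2)%R by rewrite exprn_ege1.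
apply: mulr_ege1 => //; apply: mulr_ege1 => //; by rewrite ler1n.
Qed.

Lemma rad_gt0 k : (0 < rad k)%R.
Proof. by rewrite mulr_gt0 ?kap_gt0 ?sc_gt0. Qed.

Lemma tau_gt0 : (0 < tau)%R.
Proof. by rewrite invr_gt0 mulr_gt0// exprn_gt0. Qed.

Lemma tau_le : (tau <= 4^-1)%R.
Proof.
rewrite /tau lef_pV2 ?posrE ?mulr_gt0 ?exprn_gt0//.
by rewrite ler_peMr// exprn_ege1.
Qed.

Lemma lam_rad k : (lam * (2 * rad k) = tau * sc k)%R.
Proof.
by rewrite /rad /kap /tau; field; rewrite !gt_eqF.
Qed.

Definition shell k l : set Omega :=
  i @^-1` ball (j (y k l)) (12 * A * sc k)%R `&` [set x | (tau * sc k < delta x)%R].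

Lemma measurable_delta_gt c : measurable [set x | (c < delta x)%R].
Proof.
apply: mu_open; apply: (open_comp (f := delta) (D := [set r | (c < r)%R])) => [x _|]; last exact: open_gt.
apply: (@lipschitz_continuous _ _ delta 1 ltr01) => {x} x x'; rewrite mul1r ler_norml.
have := delta_lip x x'; have := delta_lip x' x; rewrite (metric_sym x' x) => h1 h2.
by apply/andP; split; lra.
Qed.

Lemma measurable_shell k l : measurable (shell k l).
Proof. by apply: measurableI; [exact: measurable_i_ball|exact: measurable_delta_gt]. Qed.

Definition shell_energy (g : Omega -> \bar R) k l := \int[mu]_(x in shell k l) (g x `^ p).

Lemma shell_energy_ge0 g k l : 0 <= shell_energy g k l.
Proof. by apply: integral_ge0 => x _; exact: poweR_ge0. Qed.

(** Up to constants, the factor $r^p/\mu(B)$ of the Poincare inequality at scale [k], rewritten with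
    the boundary measure by codimension. *)
Definition dens k l : R := (sc k `^ (al * p) / V (y k l) (sc k))%R.

Lemma dens_gt0 k l : (0 < dens k l)%R.
Proof. by rewrite divr_gt0 ?powR_gt0 ?V_gt0 ?sc_gt0. Qed.

Lemma powR_dens k : (sc k `^ p * sc k `^ (- theta) = sc k `^ (al * p) :> R)%R.
Proof.
by rewrite alp powRD//; apply/implyP => _; rewrite gt_eqF// sc_gt0.
Qed.

(** The assumed depth of [s] is [2 * tau * sc k] and the dilated Poincare ball about [s] has radius
    [tau * sc k]; so it stays inside the shell. *)
Lemma umean_near : exists2 C : R, (0 < C)%R & forall u g, admissible u g ->
  forall k l s t r', (mdist (i s) (j (y k l)) <= 11 * A * sc k)%R ->
  (sc k / (2 * A ^+ 2) <= delta s)%R ->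
  (mdist s t + r' <= 2 * rad k)%R -> (rad k <= r')%R ->
  (`|umean u t r' - umean u s (2 * rad k)| `^ p)%:E <=
  (C * dens k l)%:E * shell_energy g k l.
Proof.
(* The second factor turns the radius [tau * sc k] into [12 * A * sc k], enough to contain the ball
   of radius [sc k] about the net point. *)
have [D D0 HD] := mM_doubling 3; have [D2 D20 HD2] := mM_doubling (48 * A ^+ 3).
have k0 := kap_gt0; have t0 := tau_gt0; have t4 := tau_le.
have Cc0 : (0 < Cc)%R by exact: lt_le_trans Cc1.
exists ((D * Cp * (2 * kap)) `^ p * (D2 * Cc))%R.
  by rewrite !mulr_gt0// powR_gt0// !mulr_gt0.
move=> u g Hug k l s t r' sy ds str rr'.
have s0 := sc_gt0 (R := R) k; have r0 := rad_gt0 k.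
have r20 : (0 < 2 * rad k)%R by rewrite mulr_gt0.
have r'0 : (0 < r')%R by exact: lt_le_trans rr'.
have lr0 : (0 < lam * (2 * rad k))%R by rewrite mulr_gt0.
have ts0 : (0 < tau * sc k)%R by rewrite mulr_gt0.
have sub : ball t r' `<=` ball s (2 * rad k)%R by exact: subset_mball.
have MD : (mM (i s) (2 * rad k) <= D * mM (i t) r')%R.
  apply: HD => //; rewrite iso_i; lra.
apply: le_trans (umean_jump Hug r20 r'0 sub D0 MD) _.
have scA : (sc k <= A * sc k)%R by rewrite ler_peMl// ltW.
have Mlo : (mM (j (y k l)) (sc k) <= D2 * mM (i s) (lam * (2 * rad k)))%R.
  apply: HD2 => //; rewrite lam_rad metric_sym.
  have -> : (48 * A ^+ 3 * (tau * sc k) = 12 * (A * sc k))%R.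
    by rewrite /tau; field; rewrite gt_eqF.
  by lra.
have Mj0 : (0 < mM (j (y k l)) (sc k))%R by case: (mME (j (y k l)) s0).
have Ml0 := M_gt0 (i s) lr0.
have V0 : (0 < V (y k l) (sc k))%R := V_gt0 (y k l) s0.
have Minv : ((mM (i s) (lam * (2 * rad k)))^-1 <= D2 * Cc * sc k `^ (- theta) / V (y k l) (sc k))%R.
  have [c1 _] := codimE (y k l) s0.
  rewrite ler_pdivlMr// ler_pdivrMl// -/(V _ _); apply: le_trans c1 _.
  have cc0 : (0 <= Cc * sc k `^ (- theta))%R by rewrite mulr_ge0 ?powR_ge0// ltW.
  apply: le_trans (ler_wpM2l cc0 Mlo) _.
  by rewrite le_eqVlt; apply/orP; left; apply/eqP; ring.
have Isub : \int[mu]_(x in ball s (lam * (2 * rad k))) (g x `^ p) <= shell_energy g k l.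
  apply: ge0_subset_integral.
  - exact: measurable_Mball.
  - exact: measurable_shell.
  - exact: admissible_pow_measurable Hug.
  - by move=> x _; exact: poweR_ge0.
  move=> x; rewrite lam_rad ballEmdist/= => sx; split => /=.
    rewrite ballEmdist/= metric_sym; have := metric_triangle (i x) (i s) (j (y k l)).
    rewrite iso_i (metric_sym x s).
    have := ler_wpM2r (ltW s0) t4; lra.
  have := delta_lip s x.
  have e : (sc k / (2 * A ^+ 2) = 2 * (tau * sc k))%R.
    by rewrite /tau; field; rewrite gt_eqF.
  lra.
have pD : (0 <= (D * Cp * (2 * rad k)) `^ p)%R by exact: powR_ge0.
apply: (@le_trans _ _ (((D * Cp * (2 * rad k)) `^ p)%:E *
    ((D2 * Cc * sc k `^ (- theta) / V (y k l) (sc k))%:E * shell_energy g k l))).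
  apply: lee_wpmul2l; first by rewrite lee_fin.
  apply: lee_pmul => //; first by rewrite lee_fin invr_ge0 ltW.
  by apply: integral_ge0 => x _; exact: poweR_ge0.
rewrite muleA -EFinM; apply: lee_wpmul2r; first exact: shell_energy_ge0.
rewrite lee_fin /dens -powR_dens /rad.
rewrite (_ : D * Cp * (2 * (kap * sc k)) = (D * Cp * (2 * kap)) * sc k)%R; last by ring.
rewrite (powRM _ _ (ltW s0)); last by rewrite !mulr_ge0// ltW.
by rewrite le_eqVlt; apply/orP; left; apply/eqP; ring.
Qed.

Definition cm (u : Omega -> \bar R) k l : R := umean u (z k l) (rad k).

Lemma shell_energy_fin u g k l : admissible u g -> shell_energy g k l \is a fin_num.
Proof.
move=> Hug; rewrite ge0_fin_numE ?shell_energy_ge0//; have [_ _] := Hug; apply: le_lt_trans.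
apply: ge0_subset_integral => //; first exact: measurable_shell.
  exact: admissible_pow_measurable Hug.
by move=> x _; exact: poweR_ge0.
Qed.

Lemma jump_bound : exists2 C : R, (0 < C)%R & forall u g, admissible u g ->
  forall k l k' l', k' = k \/ k' = (k + 1)%R -> (mdist (y k l) (y k' l') <= 4 * sc k)%R ->
  (`|cm u k l - cm u k' l'| `^ p)%:E <= (C * dens k l)%:E * shell_energy g k l.
Proof.
have [C C0 HC] := umean_near.
have k0 := kap_gt0.
(* The two corkscrew points are within $3/2+4+3=17/2$ times [sc k], so a uniform curve between them
   has length at most [n * rad k], with [n] independent of the scale. *)
pose n := (Num.trunc (A * (17 / 2) / kap)).+1.
have nA : (A * (17 / 2) <= n%:R * kap)%R.
  by rewrite -ler_pdivrMr//; apply: ltW; exact: truncnS_gt.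
exists (2 `^ p * (n.+1%:R `^ p * (2 `^ p * (C + C)) + C))%R.
  by rewrite mulr_gt0 ?powR_gt0// addr_gt0// !mulr_gt0 ?powR_gt0// addr_gt0.
move=> u g Hug k l k' l' kk' yy'.
have s0 := sc_gt0 (R := R) k; have r0 := rad_gt0 k.
have A2 : (1 <= A ^+ 2)%R by rewrite exprn_ege1.
have scA : (sc k <= A * sc k)%R by rewrite ler_peMl// ltW.
have sk1 : (sc k <= sc k' :> R)%R by case: kk' => ->; rewrite ?scS; lra.
have sk2 : (sc k' <= 2 * sc k :> R)%R by case: kk' => ->; rewrite ?scS; lra.
have zn := z_near k l; have zn' := z_near k' l'.
have zd := z_delta k l.
have zd' : (sc k / A <= delta (z k' l'))%R.
  by apply: le_trans (z_delta k' l'); rewrite ler_wpM2r// invr_ge0 ltW.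
have zz' : (mdist (z k l) (z k' l') <= 17 / 2 * sc k)%R.
  rewrite -iso_i; have := metric_triangle (i (z k l)) (j (y k l)) (i (z k' l')).
  have := metric_triangle (j (y k l)) (j (y k' l')) (i (z k' l')).
  rewrite iso_j (metric_sym (j (y k' l'))); lra.
have z'y : (mdist (i (z k' l')) (j (y k l)) <= 11 * A * sc k)%R.
  have := metric_triangle (i (z k' l')) (j (y k' l')) (j (y k l)).
  rewrite iso_j (metric_sym (y k' l')); lra.
have dz' : (sc k / (2 * A ^+ 2) <= delta (z k' l'))%R.
  apply: le_trans zd'; rewrite ler_pM2l// lef_pV2 ?posrE ?mulr_gt0 ?exprn_gt0//.
  rewrite expr2; have : (A * 1 <= A * A)%R by rewrite ler_pM2l.
  have : (0 < A * A)%R by rewrite mulr_gt0.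
  by lra.
have Gf := shell_energy_fin k l Hug; set G := fine (shell_energy g k l).
have GE : shell_energy g k l = G%:E by rewrite fineK.
have G0 : (0 <= G)%R by rewrite fine_ge0// shell_energy_ge0.
have d0 := dens_gt0 k l.
set b := (dens k l * G)%R; have b0 : (0 <= b)%R by rewrite mulr_ge0// ltW.
have HC' s t r' : (mdist (i s) (j (y k l)) <= 11 * A * sc k)%R ->
  (sc k / (2 * A ^+ 2) <= delta s)%R ->
  (mdist s t + r' <= 2 * rad k)%R -> (rad k <= r')%R ->
  (`|umean u t r' - umean u s (2 * rad k)| `^ p <= C * b)%R.
  move=> h1 h2 h3 h4; have := HC u g Hug k l s t r' h1 h2 h3 h4.
  by rewrite GE -EFinM lee_fin /b mulrA.
rewrite GE -EFinM lee_fin -mulrA -/b.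
have Phi : (`|umean u (z k l) (rad k) - umean u (z k' l') (rad k)| <=
    n.+1%:R * (2 `^ p * (C + C) * b) `^ p^-1)%R.
  have := @uniform_chain (z k l) (z k' l') (sc k / A)%R (rad k)
     ((2 `^ p * (C + C) * b) `^ p^-1)%R n (fun s => umean u s (rad k)) r0.
  apply => //.
    apply: le_trans (ler_wpM2l (ltW A0) zz') _.
    by rewrite /rad !mulrA ler_pM2r// -mulrA.
  move=> s t ds zs st.
  have {}ds : (sc k / (2 * A ^+ 2) <= delta s)%R.
    by apply: le_trans ds; rewrite le_eqVlt; apply/orP; left; apply/eqP; field; rewrite gt_eqF.
  have sy : (mdist (i s) (j (y k l)) <= 11 * A * sc k)%R.
    have := metric_triangle (i s) (i (z k l)) (j (y k l)); rewrite iso_i (metric_sym s).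
    have := ler_wpM2l (ltW A0) zz'; lra.
  have H1 := HC' s s (rad k) sy ds; have H2 := HC' s t (rad k) sy ds.
  rewrite mdistxx add0r in H1.
  have {}H1 : (`|umean u s (rad k) - umean u s (2 * rad k)| `^ p <= C * b)%R by apply: H1; lra.
  have {}H2 : (`|umean u t (rad k) - umean u s (2 * rad k)| `^ p <= C * b)%R by apply: H2; lra.
  have H3 : (`|umean u s (rad k) - umean u t (rad k)| `^ p <= 2 `^ p * (C + C) * b)%R.
    rewrite -mulrA mulrDl; apply: (@le_trans _ _ (2 `^ p *
      (`|umean u s (rad k) - umean u s (2 * rad k)| `^ p +
       `|umean u t (rad k) - umean u s (2 * rad k)| `^ p))%R).
      apply: le_trans (powRD_le p1 _ _) => //; apply: le_powR => //; first exact: ltW.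
      rewrite [X in (_ <= _ + X)%R]distrC.
      set a1 := umean _ _ _; set a2 := umean _ _ _; set a3 := umean _ _ _.
      by rewrite (_ : a1 - a2 = (a1 - a3) + (a3 - a2))%R ?ler_normD//; ring.
    rewrite ler_pM2l ?powR_gt0//; exact: lerD H1 H2.
  have : ((`|umean u s (rad k) - umean u t (rad k)| `^ p) `^ p^-1 <= (2 `^ p * (C + C) * b) `^ p^-1)%R.
    by apply: le_powR; rewrite ?powR_ge0 ?invr_ge0 ?(ltW p0).
  by rewrite -powRrM mulfV ?gt_eqF// powRr1.
have Cs0 : (0 <= 2 `^ p * (C + C) * b)%R.
  by rewrite mulr_ge0// mulr_ge0 ?powR_ge0// addr_ge0 ?(ltW C0).
have {}Phi : (`|umean u (z k l) (rad k) - umean u (z k' l') (rad k)| `^ p <=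
    n.+1%:R `^ p * (2 `^ p * (C + C)) * b)%R.
  apply: le_trans (le_powR (ltW p0) _ Phi) _; first by [].
  by rewrite powRM ?powR_ge0// -powRrM mulVf ?gt_eqF// powRr1// mulrA.
(* The chain uses radius [rad k] throughout. For [k' = k + 1] the far average has radius
   [2 * rad k], which costs one more comparison at the same centre. *)
have last : (`|umean u (z k' l') (rad k) - umean u (z k' l') (rad k')| `^ p <= C * b)%R.
  case: kk' => [->|k'E].
    by rewrite subrr normr0 powR0 ?gt_eqF// mulr_ge0// ltW.
  have -> : rad k' = (2 * rad k)%R by rewrite k'E /rad scS mulrCA.
  apply: HC' => //; rewrite mdistxx; lra.
rewrite /cm -mulrA mulrDl; apply: (@le_trans _ _ (2 `^ p *
  (`|umean u (z k l) (rad k) - umean u (z k' l') (rad k)| `^ p +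
   `|umean u (z k' l') (rad k) - umean u (z k' l') (rad k')| `^ p))%R).
  apply: le_trans (powRD_le p1 _ _) => //; apply: le_powR => //; first exact: ltW.
  set a1 := umean _ _ _; set a2 := umean _ _ _; set a3 := umean _ _ _.
  by rewrite (_ : a1 - a2 = (a1 - a3) + (a3 - a2))%R ?ler_normD//; ring.
rewrite ler_pM2l ?powR_gt0//; apply: le_trans (lerD Phi last) _.
by rewrite le_eqVlt /b; apply/orP; left; apply/eqP; ring.
Qed.

(** Overlap is bounded twice: at one scale because the net is separated, across scales because
    membership in a shell pins [delta x] between two fixed multiples of [sc k]. *)
Lemma shell_energy_sum : exists2 C : R, (0 < C)%R & forall u g, admissible u g ->
  zsum (fun k => \sum_(l <oo) shell_energy g k l) <= C%:E * \int[mu]_x (g x `^ p).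
Proof.
have L0 : (0 < 12 * A)%R by rewrite mulr_gt0.
have [N1 HN1] := net_overlap L0; have [N2 HN2] := scale_count tau_gt0 L0.
pose C1 := Num.max N1 1%R; pose C2 := Num.max N2 1%R.
have C10 : (0 < C1)%R by rewrite lt_max ltr01 orbT.
have C20 : (0 < C2)%R by rewrite lt_max ltr01 orbT.
exists (C1 * C2)%R; first by rewrite mulr_gt0.
move=> u g Hug.
pose D k : set Omega := [set x | (tau * sc k < delta x)%R] `&` [set x | (delta x < 12 * A * sc k)%R].
have mD k : measurable (D k).
  apply: measurableI; first exact: measurable_delta_gt.
  (* A strict upper bound on [delta] is expressed through the sets [measurable_delta_gt] handles, as
     a complement of a countable intersection. *)
  rewrite (_ : [set x | _] = ~` \bigcap_n [set x | (12 * A * sc k - n.+1%:R^-1 < delta x)%R]).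
    by apply: measurableC; apply: bigcapT_measurable => n; exact: measurable_delta_gt.
  apply/seteqP; split => x /=.
    move=> lt H; have [n /= nlt] := @ltr_add_invr R _ _ lt.
    by have := H n Logic.I; rewrite /= ltrBlDr ltNge (ltW nlt).
  move=> H; rewrite ltNge; apply/negP => ge; apply: H => n _ /=.
  by apply: lt_le_trans ge; rewrite ltrBlDr ltrDl invr_gt0.
have mg := admissible_pow_measurable Hug.
have g0 x : 0 <= g x `^ p by exact: poweR_ge0.
rewrite EFinM -muleA; apply: (@le_trans _ _ (zsum (fun k => C1%:E * \int[mu]_(x in D k) (g x `^ p)))).
  apply: le_zsum => k; first by apply: nneseries_ge0 => l _ _; exact: shell_energy_ge0.
  apply: overlap_sum => //.
  - exact: measurable_shell.
  - move=> l x [xs dx]; split => //=; move: xs; rewrite /= ballEmdist/= metric_sym.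
    exact/le_lt_trans/delta_le.
  move=> x n Dx; rewrite le_max; apply/orP; left.
  apply: le_trans (HN1 (sc k) (y k) (i x) n (sc_gt0 k) (y_sep k)).
  apply: ler_sum => l _; rewrite ler_nat.
  case: (boolP (x \in _)) => // /set_mem[]; rewrite /= ballEmdist/= metric_sym => -> _.
  by [].
rewrite zsumZl; last by move=> k; apply: integral_ge0.
apply: lee_wpmul2l; first by rewrite lee_fin ltW.
apply: (@overlap_sum _ _ _ mu setT (fun n => D (int_enum n)) C2) => //.
move=> x n _; rewrite le_max; apply/orP; left.
apply: le_trans (HN2 (delta x) 0%R n); apply: ler_sum => l _; rewrite ler_nat addr0.
by case: (boolP (x \in _)) => // /set_mem[] /= -> ->.
Qed.

(** Spreads weights on the net over the boundary: a measurable function that is at least [w l] near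
    [y k l] and whose integral is the weighted sum of ball measures. *)
Definition net_fun (w : nat -> \bar R) k b :=
  \sum_(l <oo) (w l * (\1_(ball (y k l) (sc k)) b)%:E).

Section net_functions.
Variables (w : nat -> \bar R) (k : int).
Hypothesis w0 : forall l, 0 <= w l.

Let term0 l b : 0 <= w l * (\1_(ball (y k l) (sc k)) b)%:E.
Proof. by rewrite mule_ge0. Qed.

Let termm l : measurable_fun setT (fun b => w l * (\1_(ball (y k l) (sc k)) b)%:E).
Proof.
apply: emeasurable_funM; first exact: measurable_cst.
by apply/measurable_EFinP; apply: measurable_indic; exact: measurable_mball.
Qed.

Lemma net_fun_ge0 b : 0 <= net_fun w k b.
Proof. by apply: nneseries_ge0 => l _ _; exact: term0. Qed.

Lemma measurable_net_fun : measurable_fun setT (net_fun w k).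
Proof. exact: (@ge0_emeasurable_sum _ _ R setT _ xpredT). Qed.

Lemma net_fun_ge l b : (mdist (y k l) b < sc k)%R -> w l <= net_fun w k b.
Proof.
move=> yb; apply: le_trans (nneseries_ge_term l (term0 ^~ b)).
by rewrite indicE mem_set ?mule1// ballEmdist.
Qed.

Lemma integral_net_fun :
  \int[nu]_b net_fun w k b = \sum_(l <oo) (w l * (V (y k l) (sc k))%:E).
Proof.
rewrite integral_nneseries//; apply: eq_eseriesr => l _.
rewrite ge0_integralZl//; last first.
  by apply/measurable_EFinP; apply: measurable_indic; exact: measurable_mball.
rewrite integral_indic ?setIT; [|exact: measurableT|exact: measurable_mball].
by rewrite VE ?sc_gt0.
Qed.

End net_functions.

(** * Discrete traces and their limit *)

Definition idx k b : nat := ex_minn (y_cov k b).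

Lemma idxP k b : (mdist (y k (idx k b)) b < sc k)%R.
Proof. by rewrite /idx; case: ex_minnP. Qed.

(** Because [idx] is the least admissible index, its level sets are balls minus the balls of smaller
    index. *)
Lemma measurable_idx k : measurable_fun setT (idx k).
Proof.
move=> _ Y _; rewrite setTI.
rewrite (_ : _ @^-1` Y = \bigcup_(l in Y) (ball (y k l) (sc k) `\`
    \bigcup_(l' in [set l' | (l' < l)%N]) ball (y k l') (sc k))).
  apply: bigcup_measurable => l _; apply: measurableD; first exact: measurable_mball.
  by apply: bigcup_measurable => l' _; exact: measurable_mball.
apply/seteqP; split => b /=.
  move=> Yb; exists (idx k b) => //; split; first by rewrite ballEmdist/= idxP.
  move=> [l' /= l'l]; rewrite ballEmdist/= => yl'; move: l'l.
  by rewrite /idx; case: ex_minnP => m _ /(_ l' yl'); rewrite leqNgt => /negP.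
move=> [l Yl [yl nl]]; rewrite (_ : idx k b = l)//.
move: yl; rewrite ballEmdist/= => yl; rewrite /idx; case: ex_minnP => m ym mmin.
apply/eqP; rewrite eqn_leq mmin// leqNgt; apply/negP => ml; apply: nl.
by exists m => //; rewrite ballEmdist.
Qed.

Definition tr u k b : R := cm u k (idx k b).

Lemma measurable_tr u k : measurable_fun setT (tr u k).
Proof. by apply: (measurableT_comp (f := cm u k)) => //; exact: measurable_idx. Qed.

Definition jump (g : Omega -> \bar R) k b : \bar R :=
  net_fun (fun l => (dens k l)%:E * shell_energy g k l) k b.

Lemma jump_term_ge0 g k l : 0 <= (dens k l)%:E * shell_energy g k l.
Proof. by rewrite mule_ge0 ?shell_energy_ge0// lee_fin ltW// dens_gt0. Qed.

Lemma jump_ge0 g k b : 0 <= jump g k b.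
Proof. by apply: net_fun_ge0 => l; exact: jump_term_ge0. Qed.

Lemma integral_jump g k :
  \int[nu]_b jump g k b = (sc k `^ (al * p))%:E * \sum_(l <oo) shell_energy g k l.
Proof.
rewrite integral_net_fun; last by move=> l; exact: jump_term_ge0.
rewrite -nneseriesZl; last by move=> l _; exact: shell_energy_ge0.
apply: eq_eseriesr => l _; rewrite muleAC -EFinM; congr (_%:E * _).
by rewrite /dens mulfVK// gt_eqF// V_gt0// sc_gt0.
Qed.

Lemma tr_jump : exists2 C : R, (0 < C)%R & forall u g, admissible u g ->
  forall k k' b b', k' = k \/ k' = (k + 1)%R -> (mdist b b' <= sc k)%R ->
  (`|tr u k b - tr u k' b'| `^ p)%:E <= C%:E * jump g k b.
Proof.
have [C C0 HC] := jump_bound; exists C => // u g Hug k k' b b' kk' bb'.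
have yb := idxP k b; have yb' := idxP k' b'.
have sk2 : (sc k' <= 2 * sc k :> R)%R.
  by have s0 := sc_gt0 (R := R) k; case: kk' => ->; rewrite ?scS; lra.
have H : (mdist (y k (idx k b)) (y k' (idx k' b')) <= 4 * sc k)%R.
  have := metric_triangle (y k (idx k b)) b (y k' (idx k' b')).
  have := metric_triangle b b' (y k' (idx k' b')); rewrite (metric_sym b').
  by lra.
apply: le_trans (HC u g Hug _ _ _ _ kk' H) _.
rewrite EFinM -muleA; apply: lee_wpmul2l; first by rewrite lee_fin ltW.
by apply: net_fun_ge => // l; exact: jump_term_ge0.
Qed.

Lemma powR_exprn (a r : R) m : (0 <= a)%R -> ((a ^+ m) `^ r = (a `^ r) ^+ m)%R.
Proof.
by move=> a0; rewrite -(powR_mulrn m a0) -(powR_mulrn m (powR_ge0 a r)) -!powRrM mulrC.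
Qed.

(** Half of the decay $2^{-\alpha p m}$ of the scale factors: $q^m$ pays for the Hardy inequality
    and $q^{-m}$ is left over for summation. *)
Definition qq : R := (2 `^ (al * p / 2))%R.

Lemma qq_gt1 : (1 < qq)%R.
Proof.
have h0 : (0 < al * p / 2)%R by rewrite divr_gt0// alp_gt0.
have : (1 `^ (al * p / 2) < qq)%R; last by rewrite powR1.
by apply: gt0_ltr_powR => //; rewrite ?nnegrE// ltr1n.
Qed.

Let q0 : (0 < qq)%R. Proof. exact: lt_trans qq_gt1. Qed.

Lemma sc_qq k m : (qq ^+ m * sc (k - m%:Z) `^ (al * p) = qq ^- m * sc k `^ (al * p))%R.
Proof.
have -> : (sc k = sc (k - m%:Z) * 2 ^+ m :> R)%R by rewrite -sc_nat -scD subrK.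
rewrite (powRM _ (ltW (sc_gt0 _))) ?exprn_ge0//.
have -> : ((2 ^+ m) `^ (al * p) = qq ^+ m * qq ^+ m)%R.
  rewrite /qq -!powR_mulrn ?powR_ge0// -!powRrM -powRD ?implybT//; last first.
    by apply/implyP => _; rewrite gt_eqF.
  by congr (_ `^ _)%R; field.
by field; rewrite gt_eqF// exprn_gt0.
Qed.

Definition tail_jump (g : Omega -> \bar R) k b : \bar R :=
  \sum_(m <oo) ((qq ^+ m)%:E * jump g (k - 1 - m%:Z)%R b).

Lemma tail_jump_term_ge0 g k b m : 0 <= (qq ^+ m)%:E * jump g (k - 1 - m%:Z)%R b.
Proof. by rewrite mule_ge0 ?jump_ge0// lee_fin exprn_ge0// ltW. Qed.

Lemma tail_jump_ge0 g k b : 0 <= tail_jump g k b.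
Proof. by apply: nneseries_ge0 => m _ _; exact: tail_jump_term_ge0. Qed.

Lemma measurable_jump g k : measurable_fun setT (jump g k).
Proof. by apply: measurable_net_fun => l; exact: jump_term_ge0. Qed.

Lemma measurable_tail_jump g k : measurable_fun setT (tail_jump g k).
Proof.
apply: (@ge0_emeasurable_sum _ _ R setT _ xpredT) => [m b _ _|m _].
  exact: tail_jump_term_ge0.
by apply: emeasurable_funM => //; exact: measurable_jump.
Qed.

(* [tail_jump] weighs the jumps geometrically, so its finiteness at one scale
   forces the averages to converge. *)
Lemma tr_cvg : exists2 C : R, (0 < C)%R & forall u g, admissible u g -> forall k b,
  tail_jump g k b < +oo -> exists2 c, tr u (- n%:Z) b @[n --> \oo] --> c &
  (`|c - tr u k b| `^ p)%:E <= C%:E * tail_jump g k b.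
Proof.
have [C C0 HC] := tr_jump; have [K K0 HK] := powR_sum_le p1 qq_gt1.
exists (K * C)%R; first by rewrite mulr_gt0.
move=> u g Hug k b Ffin; set F := tail_jump g k b in Ffin *.
have F0 : 0 <= F by exact: tail_jump_ge0.
have FE : F = (fine F)%:E by rewrite fineK// ge0_fin_numE.
have f0 : (0 <= fine F)%R by rewrite fine_ge0.
pose a m := tr u (k - m%:Z)%R b; pose bb m := `|a m - a m.+1|%R.
have J m : (bb m `^ p)%:E <= C%:E * jump g (k - 1 - m%:Z)%R b.
  have E1 : (k - m%:Z = k - 1 - m%:Z + 1)%R by rewrite addrAC subrK.
  have E2 : (k - m.+1%:Z = k - 1 - m%:Z)%R by rewrite -add1n PoszD opprD addrA.
  have d0 : (mdist b b <= sc (k - 1 - m%:Z))%R by rewrite mdistxx ltW// sc_gt0.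
  rewrite /bb /a E2 E1 distrC; exact: (HC u g Hug _ _ b b (or_intror erefl) d0).
have sumle n : (\sum_(m < n) qq ^+ m * bb m `^ p <= C * fine F)%R.
  rewrite -lee_fin EFinM -FE /F -nneseriesZl//; last by move=> m _; exact: tail_jump_term_ge0.
  apply: le_trans (nneseries_lim_ge n _); last first.
    by move=> m _ _; rewrite mule_ge0 ?tail_jump_term_ge0// lee_fin ltW.
  rewrite big_mkord -sumEFin; apply: lee_sum => m _.
  rewrite EFinM muleCA; apply: lee_wpmul2l => //.
  by rewrite lee_fin exprn_ge0// ltW.
have CF0 : (0 <= C * fine F)%R by rewrite mulr_ge0// ltW.
(* The weighted sum bounds $q^m$ times the p-th power of the m-th step, so the steps decay like
   $q^{-m/p}$. *)
pose rho := (qq^-1 `^ p^-1)%R.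
have rho01 : (0 <= rho < 1)%R.
  rewrite powR_ge0/=; have : (rho < 1 `^ p^-1)%R; last by rewrite powR1.
  apply: gt0_ltr_powR.
  - by rewrite invr_gt0.
  - by rewrite nnegrE invr_ge0 ltW.
  - by rewrite nnegrE.
  - by rewrite invf_lt1// qq_gt1.
have bbm m : (bb m <= (C * fine F) `^ p^-1 * rho ^+ m)%R.
  have H : (bb m `^ p <= C * fine F * qq^-1 ^+ m)%R.
    rewrite exprVn ler_pdivlMr ?exprn_gt0// mulrC; apply: le_trans (sumle m.+1).
    rewrite big_ord_recr/= lerDr; apply: sumr_ge0 => l _.
    by rewrite mulr_ge0 ?powR_ge0// exprn_ge0// ltW.
  have : ((bb m `^ p) `^ p^-1 <= (C * fine F * qq^-1 ^+ m) `^ p^-1)%R.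
    by apply: le_powR; rewrite ?powR_ge0 ?invr_ge0 ?(ltW p0).
  rewrite -powRrM mulfV ?gt_eqF// powRr1 ?normr_ge0// => /le_trans; apply.
  have qi0 : (0 <= qq^-1)%R by rewrite invr_ge0 ltW.
  by rewrite (powRM _ CF0) ?exprn_ge0// powR_exprn.
have ca : cvgn a.
  apply: (@geometric_steps_cvg _ a ((C * fine F) `^ p^-1)%R rho rho01) => m.
  by rewrite distrC; exact: bbm.
exists (limn a); first exact: (@cvg_int_shift _ (fun l => tr u l b) k _ ca).
rewrite FE -EFinM lee_fin.
have an n : (`|a n - tr u k b| <= (K * C * fine F) `^ p^-1)%R.
  have -> : tr u k b = a 0%N by rewrite /a subr0.
  have H : (`|a n - a 0%N| <= \sum_(m < n) bb m)%R.
    elim: n => [|n ih]; first by rewrite subrr normr0 big_ord0.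
    rewrite big_ord_recr/=; apply: le_trans (lerD ih (lexx _)).
    rewrite /bb (distrC (a n) (a n.+1)) (_ : a n.+1 - a 0%N = (a n - a 0%N) + (a n.+1 - a n))%R; last by ring.
    exact: ler_normD.
  have H2 : (`|a n - a 0%N| `^ p <= K * C * fine F)%R.
    apply: le_trans (le_powR (ltW p0) _ H) _ => //.
    apply: le_trans (HK n bb (fun m => normr_ge0 _)) _.
    by rewrite -mulrA ler_pM2l.
  have : ((`|a n - a 0%N| `^ p) `^ p^-1 <= (K * C * fine F) `^ p^-1)%R.
    by apply: le_powR; rewrite ?powR_ge0 ?invr_ge0 ?(ltW p0).
  by rewrite -powRrM mulfV ?gt_eqF// powRr1 ?normr_ge0.
have KC0 : (0 <= K * C * fine F)%R by rewrite !mulr_ge0 ?(ltW K0) ?(ltW C0).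
have lim_le : (`|limn a - tr u k b| <= (K * C * fine F) `^ p^-1)%R.
  apply/ler_addgt0Pr => e e0; move/cvgrPdist_lt: (ca) => /(_ e e0) [N _ HN].
  have := HN N (leqnn N); have := an N => h1 h2.
  rewrite (_ : limn a - tr u k b = (a N - tr u k b) + (limn a - a N))%R; last by ring.
  by apply: le_trans (ler_normD _ _) _; rewrite lerD// ltW.
apply: le_trans (le_powR (ltW p0) (normr_ge0 _) lim_le) _.
by rewrite -powRrM mulVf ?gt_eqF// powRr1.
Qed.

(* The limit exists almost everywhere; the upper limit makes the trace
   measurable. *)
Definition trace (u : Omega -> \bar R) b : R :=
  fine (limn_esup (fun n => (tr u (- n%:Z)%R b)%:E)).

Lemma measurable_trace u : measurable_fun setT (trace u).
Proof.
apply: measurableT_comp => //; apply: measurable_fun_limn_esup => n.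
by apply/measurable_EFinP; exact: measurable_tr.
Qed.

Lemma trace_lim u b c : (tr u (- n%:Z)%R b @[n --> \oo] --> c) -> trace u b = c.
Proof.
move=> H; rewrite /trace.
have /cvg_limn_einf_sup[_ ->]// : (tr u (- n%:Z)%R b)%:E @[n --> \oo] --> c%:E.
by apply: cvg_EFin => //; exact: nearW.
Qed.

Lemma trace_dist : exists2 C : R, (0 < C)%R & forall u g, admissible u g -> forall k b,
  (`|trace u b - tr u k b| `^ p)%:E <= C%:E * tail_jump g k b.
Proof.
have [C C0 HC] := tr_cvg; exists C => // u g Hug k b.
have [Ffin|Foo] := ltP (tail_jump g k b) +oo.
  by have [c /trace_lim -> H] := HC u g Hug k b Ffin.
by move: Foo; rewrite leye_eq => /eqP ->; rewrite gt0_muley ?lte_fin// leey.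
Qed.

Lemma integral_tail_jump g k : \int[nu]_b tail_jump g k b =
  (sc (k - 1) `^ (al * p))%:E *
  \sum_(m <oo) ((qq ^- m)%:E * \sum_(l <oo) shell_energy g (k - 1 - m%:Z)%R l).
Proof.
have S0 m : 0 <= \sum_(l <oo) shell_energy g (k - 1 - m%:Z)%R l.
  by apply: nneseries_ge0 => l _ _; exact: shell_energy_ge0.
have qm0 m : 0 <= (qq ^- m)%:E by rewrite lee_fin invr_ge0 exprn_ge0// ltW.
rewrite integral_nneseries//; last 2 first.
- by move=> m; apply: emeasurable_funM => //; exact: measurable_jump.
- by move=> m b _; exact: tail_jump_term_ge0.
rewrite -nneseriesZl; last by move=> m _; rewrite mule_ge0.
apply: eq_eseriesr => m _; rewrite ge0_integralZl_EFin//; last 3 first.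
- by move=> b _; exact: jump_ge0.
- exact: measurable_jump.
- by rewrite exprn_ge0// ltW.
by rewrite integral_jump !muleA -!EFinM sc_qq mulrC.
Qed.

(** The inner average of [H x] over [ball b r] is replaced by a larger net function of [b], whose
    integral is controlled by bounded overlap; this bounds the double integral by single ones. *)
Lemma osc_fun_majorant : exists2 C : R, (0 < C)%R & forall (f : bd -> R) (H : bd -> \bar R) k r D,
  (0 <= D)%R -> (sc (k - 1) < r <= sc k)%R -> measurable_fun setT H -> (forall b, 0 <= H b) ->
  (forall b x, (mdist b x < sc k)%R -> (`|f b - f x| `^ p)%:E <= D%:E * (H b + H x)) ->
  osc_fun f r <= (C * D * sc k `^ (- (al * p)))%:E * \int[nu]_b H b.
Proof.
have L40 : (0 < 4 :> R)%R by [].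
have [C3 C30 HC3] := V_doubling L40.
have L20 : (0 < 2 :> R)%R by [].
have [N HN] := net_overlap L20; pose N1 := Num.max N 1%R.
have N10 : (0 < N1)%R by rewrite lt_max ltr01 orbT.
exists (2 `^ (al * p) * (1 + C3 * N1))%R.
  by rewrite mulr_gt0 ?powR_gt0// addr_gt0// mulr_gt0.
move=> f H k r D D0 /andP[kr rk] mH H0 fH.
have s0 := sc_gt0 (R := R) k; have r0 : (0 < r)%R by apply: lt_trans kr; exact: sc_gt0.
have skr : (sc k < 2 * r)%R by rewrite [ltLHS]scB1 ltr_pM2l.
have I0 D' : 0 <= \int[nu]_(b in D') H b by exact: integral_ge0.
pose w l := (C3 / V (y k l) (sc k))%:E * \int[nu]_(x in ball (y k l) (2 * sc k)%R) H x.
have w0 l : 0 <= w l.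
  by rewrite mule_ge0// lee_fin divr_ge0 ?(ltW C30)// ltW// V_gt0.
have mw : measurable_fun setT (net_fun w k) by exact: measurable_net_fun.
have rp0 : (0 < r `^ (al * p))%R by rewrite powR_gt0.
have c0 : (0 <= D / r `^ (al * p))%R by rewrite divr_ge0// ltW.
have av b : ((V b r)^-1)%:E * \int[nu]_(x in ball b r) H x <= net_fun w k b.
  have [l lb] := y_cov k b; apply: le_trans (net_fun_ge w0 lb).
  have V0 := V_gt0 b r0; have V1 := V_gt0 (y k l) s0.
  apply: lee_pmul => //; first by rewrite lee_fin invr_ge0 ltW.
    rewrite lee_fin ler_pdivlMr// ler_pdivrMl// mulrC; apply: HC3 => //.
    by move: kr; lra.
  apply: ge0_subset_integral; side.
    exact: measurable_funTS.
  by apply: subset_mball; lra.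
have step b : osc_int f r b <= (D / r `^ (al * p))%:E * (H b + net_fun w k b).
  have V0 := V_gt0 b r0.
  rewrite /osc_int (averageE _ V0 (VE b r0)).
  apply: (@le_trans _ _ (((V b r)^-1)%:E *
      \int[nu]_(x in ball b r) ((D / r `^ (al * p))%:E * (H b + H x)))).
    apply: lee_wpmul2l; first by rewrite lee_fin invr_ge0 ltW.
    apply: le_lower_integral => x; first by rewrite lee_fin divr_ge0// powR_ge0.
    rewrite ballEmdist/= => bx; rewrite mulrC EFinM (mulrC D) EFinM -muleA.
    apply: lee_wpmul2l; first by rewrite lee_fin invr_ge0 ltW.
    by apply: fH; exact: lt_le_trans bx rk.
  rewrite ge0_integralZl_EFin//; side; last first.
    by apply: emeasurable_funD => //; exact: measurable_funTS.
  rewrite muleCA; apply: lee_wpmul2l; first by rewrite lee_fin.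
  rewrite ge0_integralD//; side; last exact: measurable_funTS.
  rewrite ge0_muleDr//; last by exact: integral_ge0.
  apply: leeD; last exact: av.
  rewrite integral_cst; last exact: measurable_mball.
  by rewrite [X in _ * (_ * X)](VE b r0) muleCA -EFinM mulVf ?mule1// gt_eqF.
apply: (@le_trans _ _ (\int[nu]_b ((D / r `^ (al * p))%:E * (H b + net_fun w k b)))).
  by apply: le_lower_integral => b _; [exact: osc_int_ge0|exact: step].
rewrite ge0_integralZl_EFin//; last 2 first.
- by move=> b _; rewrite adde_ge0// net_fun_ge0.
- exact: emeasurable_funD.
rewrite ge0_integralD//; last by move=> b _; exact: net_fun_ge0.
have nf : \int[nu]_b net_fun w k b <= (C3 * N1)%:E * \int[nu]_b H b.
  rewrite integral_net_fun//.
  apply: (@le_trans _ _ (\sum_(l <oo) (C3%:E * \int[nu]_(x in ball (y k l) (2 * sc k)%R) H x))).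
    apply: lee_nneseries => l _; first by move=> _; rewrite mule_ge0// lee_fin ltW// V_gt0.
    rewrite /w muleAC -EFinM mulfVK ?gt_eqF ?V_gt0//.
  rewrite nneseriesZl; last by move=> l _; exact: I0.
  rewrite EFinM -muleA; apply: lee_wpmul2l; first by rewrite lee_fin ltW.
  apply: overlap_sum => //; first by move=> l; exact: measurable_mball.
  move=> x n _; rewrite le_max; apply/orP; left.
  apply: le_trans (HN (sc k) (y k) (j x) n (sc_gt0 k) (y_sep k)).
  apply: ler_sum => l _; rewrite ler_nat.
  by case: (boolP (x \in _)) => // /set_mem; rewrite ballEmdist/= iso_j metric_sym => ->.
apply: (@le_trans _ _ ((D / r `^ (al * p))%:E * ((1 + C3 * N1)%:E * \int[nu]_b H b))).
  apply: lee_wpmul2l; first by rewrite lee_fin.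
  rewrite EFinD ge0_muleDl ?mul1e ?leeD2l//.
  by rewrite lee_fin mulr_ge0 ?(ltW C30) ?(ltW N10).
rewrite muleA -EFinM; apply: lee_wpmul2r; first exact: I0.
rewrite lee_fin.
have -> : (2 `^ (al * p) * (1 + C3 * N1) * D * sc k `^ (- (al * p)) =
   D * (2 `^ (al * p) * sc k `^ (- (al * p))) * (1 + C3 * N1))%R by ring.
apply: ler_wpM2r; first by rewrite addr_ge0// mulr_ge0 ?(ltW C30) ?(ltW N10).
apply: ler_wpM2l => //; rewrite powRN ler_pdivlMr ?powR_gt0// ler_pdivrMl//.
rewrite -(powRM _ (ltW r0))//; apply: le_powR; [exact: ltW alp_gt0|exact: ltW|].
by rewrite mulrC; exact: ltW.
Qed.

Lemma trace_pair : exists2 D : R, (0 < D)%R & forall u g, admissible u g ->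
  forall k b x, (mdist b x < sc k)%R -> (`|trace u b - trace u x| `^ p)%:E <=
  D%:E * ((tail_jump g k b + jump g k b) + (tail_jump g k x + jump g k x)).
Proof.
have [C1 C10 HC1] := tr_jump; have [C2 C20 HC2] := trace_dist.
pose C := (C1 + C2)%R; have C0 : (0 < C)%R by rewrite addr_gt0.
exists (2 `^ p * 2 `^ p * C)%R; first by rewrite !mulr_gt0 ?powR_gt0.
move=> u g Hug k b x bx.
have t1 := HC2 u g Hug k b; have t2 := HC2 u g Hug k x.
have t3 := HC1 u g Hug k k b x (or_introl erefl) (ltW bx).
have Fb := tail_jump_ge0 g k b; have Fx := tail_jump_ge0 g k x.
have Jb := jump_ge0 g k b; have Jx := jump_ge0 g k x.
move: (trace u b) (trace u x) (tr u k b) (tr u k x) t1 t2 t3 => a1 a4 a2 a3 t1 t2 t3.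
have two : (1 <= 2 `^ p :> R)%R.
  have : (1 `^ p <= 2 `^ p :> R)%R; last by rewrite powR1.
  by apply: le_powR; rewrite ?ler1n// ltW.
have H : (`|a1 - a4| `^ p <= 2 `^ p * 2 `^ p * (`|a1 - a2| `^ p + `|a2 - a3| `^ p + `|a4 - a3| `^ p))%R.
  have e1 : (`|a1 - a4| <= `|a1 - a2| + (`|a2 - a3| + `|a4 - a3|))%R.
    rewrite (distrC a4) (_ : a1 - a4 = (a1 - a2) + ((a2 - a3) + (a3 - a4)))%R; last by ring.
    by apply: le_trans (ler_normD _ _) _; rewrite lerD2l ler_normD.
  apply: le_trans (le_powR (ltW p0) (normr_ge0 _) e1) _.
  apply: le_trans (powRD_le p1 _ _) _; rewrite ?addr_ge0//.
  rewrite -mulrA ler_pM2l ?powR_gt0// -addrA [leRHS]mulrDr; apply: lerD.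
    by rewrite ler_peMl// powR_ge0.
  by apply: powRD_le.
apply: (@le_trans _ _ ((2 `^ p * 2 `^ p)%:E *
   ((`|a1 - a2| `^ p)%:E + (`|a2 - a3| `^ p)%:E + (`|a4 - a3| `^ p)%:E))).
  by rewrite -!EFinD -EFinM lee_fin.
have c20 : (0 <= 2 `^ p * 2 `^ p :> R)%R by rewrite mulr_ge0 ?powR_ge0.
move: c20 {H}; set c2 := (2 `^ p * 2 `^ p)%R => c20.
rewrite (EFinM c2) -muleA; apply: lee_wpmul2l; first by rewrite lee_fin.
have CJ e : 0 <= e -> C1%:E * e <= C%:E * e.
  by move=> e0; apply: lee_wpmul2r => //; rewrite lee_fin lerDl ltW.
have CF e : 0 <= e -> C2%:E * e <= C%:E * e.
  by move=> e0; apply: lee_wpmul2r => //; rewrite lee_fin lerDr ltW.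
move: (tail_jump g k b) (tail_jump g k x) (jump g k b) (jump g k x) Fb Fx Jb Jx t1 t2 t3.
move=> fb fx jb jx Fb Fx Jb Jx t1 t2 t3.
rewrite (ge0_muleDr _ (adde_ge0 Fb Jb) (adde_ge0 Fx Jx)) (ge0_muleDr _ Fb Jb).
apply: leeD; first by apply: leeD; [exact: le_trans t1 (CF _ Fb)|exact: le_trans t3 (CJ _ Jb)].
rewrite (ge0_muleDr _ Fx Jx); apply: le_trans t2 _; apply: le_trans (CF _ Fx) _.
by rewrite leeDl// mule_ge0// lee_fin ltW.
Qed.

Lemma nneseries_qq : \sum_(m <oo) (qq ^- m)%:E <= ((1 - qq^-1)^-1)%:E.
Proof.
under eq_eseriesr do rewrite -exprVn.
by apply: nneseries_geometric_le; rewrite invr_ge0 (ltW q0) invf_lt1// qq_gt1.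
Qed.

(** At scale [k] the oscillation is bounded by the shell energy there plus a convolution of shell
    energies with the geometric sequence $q^{-m}$, and such a convolution is bounded on summable
    sequences. *)
Lemma trace_energy : exists2 C : R, (0 < C)%R & forall u g, admissible u g ->
  besov_energy (trace u) <= C%:E * \int[mu]_x (g x `^ p).
Proof.
have [C1 C10 HC1] := osc_fun_majorant; have [D D0 HD] := trace_pair.
have [C2 C20 HC2] := shell_energy_sum.
pose Q := ((1 - qq^-1)^-1)%R.
have Q0 : (0 < Q)%R by rewrite invr_gt0 subr_gt0 invf_lt1// qq_gt1.
exists (C1 * D * ((Q + 1) * C2))%R; first by rewrite !mulr_gt0// addr_gt0.
move=> u g Hug.
pose tot k := \sum_(l <oo) shell_energy g k l.
have tot0 k : 0 <= tot k by apply: nneseries_ge0 => l _ _; exact: shell_energy_ge0.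
have qm0 m : 0 <= (qq ^- m)%:E by rewrite lee_fin invr_ge0 exprn_ge0// ltW.
pose S k := \sum_(m <oo) ((qq ^- m)%:E * tot (k - 1 - m%:Z)%R).
have S0 k : 0 <= S k by apply: nneseries_ge0 => m _ _; rewrite mule_ge0.
have CD0 : (0 <= C1 * D)%R by rewrite mulr_ge0 ?(ltW C10) ?(ltW D0).
apply: (@le_trans _ _ (zsum (fun k => (C1 * D)%:E * (S k + tot k)))).
  apply: dyadic_upper; first by move=> r; exact: osc_fun_ge0.
    by move=> k; rewrite mule_ge0// adde_ge0.
  move=> k r kr.
  have H := HC1 (trace u) (fun b => tail_jump g k b + jump g k b) k r D (ltW D0) kr.
  apply: le_trans (H _ _ _) _.
  - by apply: emeasurable_funD; [exact: measurable_tail_jump|exact: measurable_jump].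
  - by move=> b; rewrite adde_ge0 ?tail_jump_ge0 ?jump_ge0.
  - by move=> b x bx; exact: HD.
  rewrite EFinM -muleA; apply: lee_wpmul2l; first by rewrite lee_fin.
  rewrite ge0_integralD//; last 4 first.
  - by move=> b _; exact: tail_jump_ge0.
  - exact: measurable_tail_jump.
  - by move=> b _; exact: jump_ge0.
  - exact: measurable_jump.
  rewrite integral_tail_jump integral_jump ge0_muleDr; last 2 first.
  - by rewrite mule_ge0 ?lee_fin ?powR_ge0//; exact: S0.
  - by rewrite mule_ge0 ?lee_fin ?powR_ge0//; exact: tot0.
  have sp : (0 < sc k `^ (al * p) :> R)%R by rewrite powR_gt0// sc_gt0.
  apply: leeD.
    rewrite muleA -EFinM -[leRHS]mul1e; apply: lee_wpmul2r; first exact: S0.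
    rewrite lee_fin powRN ler_pdivrMl// mulr1; apply: le_powR; [exact: ltW alp_gt0|exact: ltW (sc_gt0 _)|].
    by apply: sc_le; rewrite gerBl.
  by rewrite muleA -EFinM powRN mulVf ?mul1e// gt_eqF.
rewrite zsumZl; last by move=> k; rewrite adde_ge0.
move: CD0; set c := (C1 * D)%R => c0; set I := \int[mu]_x _.
have -> : (c * ((Q + 1) * C2))%:E * I = c%:E * (((Q + 1) * C2)%:E * I).
  by rewrite muleA -EFinM.
apply: lee_wpmul2l; first by rewrite lee_fin.
have tt : zsum tot <= C2%:E * \int[mu]_x (g x `^ p) by exact: HC2 u g Hug.
have zt0 : 0 <= zsum tot by exact: zsum_ge0.
rewrite EFinM -muleA; apply: le_trans (lee_wpmul2l _ tt); last first.
  by rewrite lee_fin addr_ge0// ltW.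
clearbody tot; rewrite EFinD ge0_muleDl ?lee_fin ?(ltW Q0)// mul1e.
rewrite /zsum nneseriesD//; apply: leeD => //.
(* Summing first over [k], each shift by [m] leaves the total unchanged and only the geometric
   series remains. *)
rewrite nneseries_interchange; last by move=> a b; rewrite mule_ge0.
apply: (@le_trans _ _ (\sum_(m <oo) ((qq ^- m)%:E * zsum tot))).
  apply: lee_nneseries => m _; first by move=> _; apply: nneseries_ge0 => n _ _; rewrite mule_ge0.
  rewrite nneseriesZl; last by move=> n _; exact: tot0.
  apply: (lee_wpmul2l (qm0 m)).
  rewrite -(zsum_shift (- 1 - m%:Z)%R tot0) /zsum.
  have eqt n : tot (int_enum n - 1 - m%:Z)%R = tot (int_enum n + (- 1 - m%:Z))%R by rewrite addrA.
  by rewrite (eq_eseriesr (fun n _ => eqt n)).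
rewrite -/(zsum tot); under eq_eseriesr do rewrite muleC.
have [zf|zoo] := ltP (zsum tot) +oo; last first.
  move: zoo; rewrite leye_eq => /eqP ->; rewrite gt0_muley ?leey// lte_fin.
have zE : zsum tot = (fine (zsum tot))%:E by rewrite fineK// ge0_fin_numE.
rewrite zE nneseriesZl// muleC; apply: lee_wpmul2r; last exact: nneseries_qq.
by rewrite lee_fin fine_ge0.
Qed.

Lemma ex_admissible u : dirichlet mu p u -> exists g, admissible u g.
Proof.
move=> du; have [_ [g [wg gfin]]] := du.
have [g' [ug' H]] := weak_upper_gradient_approx p1 mu_open ltr01 wg gfin.
exists g'; split => //; apply: le_lt_trans H _.
have g0 : forall x, 0 <= g x by case: wg.
apply: lte_add_pinfty; last exact: ltry.
by apply: lte_mul_pinfty => //; exact/Lnorm_lty.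
Qed.

(** The energy bound for genuine upper gradients extends to weak ones by approximation, hence to the
    minimal one; the approximation costs the factor $2^p$. *)
Lemma trace_norm : exists2 C : R, (0 < C)%R & forall u, dirichlet mu p u ->
  besov nu p al (trace u) /\
  (besov_norm nu p al (trace u) <= C%:E * dirichlet_norm mu p u)%E.
Proof.
have [C C0 HC] := trace_energy.
pose D := (C * 2 `^ p)%R; have D0 : (0 < D)%R by rewrite mulr_gt0 ?powR_gt0.
exists (D `^ p^-1)%R; first by rewrite powR_gt0.
move=> u du; have mT := measurable_trace u.
have Et := besov_energy_ge0 (trace u).
have key g : weak_upper_gradient mu p u g -> 'N[mu]_p%:E[g] < +oo ->
    besov_energy (trace u) <= D%:E * \int[mu]_x (g x `^ p).
  move=> wg gfin; have g0 : forall x, 0 <= g x by case: wg.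
  have gp : \int[mu]_x (g x `^ p) < +oo by apply/Lnorm_lty.
  have I0 : 0 <= \int[mu]_x (g x `^ p) by apply: integral_ge0 => x _; exact: poweR_ge0.
  apply/lee_addgt0Pr => e e0.
  have eC : (0 < e / C)%R by rewrite divr_gt0.
  have [g' [ug' H]] := weak_upper_gradient_approx p1 mu_open eC wg gfin.
  have ad : admissible u g'.
    split => //; apply: le_lt_trans H _.
    apply: lte_add_pinfty; last exact: ltry.
    by apply: lte_mul_pinfty => //; rewrite lee_fin powR_ge0.
  apply: le_trans (HC u g' ad) _.
  apply: le_trans (lee_wpmul2l _ H) _; first by rewrite lee_fin ltW.
  rewrite ge0_muleDr ?mule_ge0 ?lee_fin ?powR_ge0 ?(ltW eC)//.
  by rewrite muleA -!EFinM (mulrC C (e / C)%R) mulfVK ?gt_eqF.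
have [_ [g1 [wg1 fg1]]] := du.
have g10 : forall x, 0 <= g1 x by case: wg1.
have Efin : besov_energy (trace u) < +oo.
  apply: le_lt_trans (key _ wg1 fg1) _; rewrite lte_mul_pinfty ?lee_fin ?(ltW D0)//.
  by apply/Lnorm_lty.
split.
  split; last by rewrite besov_normE; exact: poweR_lty.
  split => // b; exists 1%R; split => //; exact: besov_Lp_ball.
rewrite besov_normE /dirichlet_norm /minimal_wug; case: xgetP => [g _ [wg gfin _]|no].
  have g0 : forall x, 0 <= g x by case: wg.
  rewrite LnormE// -poweR_EFin -poweRM ?lee_fin ?(ltW D0)//; last first.
    by apply: integral_ge0 => x _; exact: poweR_ge0.
  by apply: lee_poweR => //; rewrite ?invr_ge0 ?(ltW p0)//; exact: key.
(* Without a minimizer, [minimal_wug] is the default value [cst +oo]. *)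
rewrite LnormE//; last by move=> x; exact: leey.
have -> : \int[mu]_x ((cst +oo : Omega -> \bar R) x `^ p) = +oo.
  under eq_integral do rewrite poweRyr ?gt_eqF//.
  rewrite integral_cst// gt0_mulye//.
  apply: (@lt_le_trans _ _ (mu (ball point 1))); first by case/andP: (mu_ball point ltr01).
  by apply: le_measure; rewrite ?inE//; exact: measurable_Mball.
by rewrite poweRyr ?invr_eq0 ?gt_eqF// gt0_muley ?leey// lte_fin powR_gt0.
Qed.

(** Scale 0 is an arbitrary starting point: finiteness there already makes the averages converge as
    the scale tends to $-\infty$. *)
Lemma tail_jump_ae u g : admissible u g -> {ae nu, forall b, tail_jump g 0 b < +oo}.
Proof.
move=> Hug; have [C C0 HC] := shell_energy_sum.
have [_ _ gfin] := Hug.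
pose tot k := \sum_(l <oo) shell_energy g k l.
have tot0 k : 0 <= tot k by apply: nneseries_ge0 => l _ _; exact: shell_energy_ge0.
have zt : zsum tot < +oo.
  by apply: le_lt_trans (HC u g Hug) _; rewrite lte_mul_pinfty ?lee_fin ?(ltW C0).
have zE : zsum tot = (fine (zsum tot))%:E by rewrite fineK// ge0_fin_numE// zsum_ge0.
have qm0 m : 0 <= (qq ^- m)%:E by rewrite lee_fin invr_ge0 exprn_ge0// ltW.
have fin : \int[nu]_b tail_jump g 0 b < +oo.
  rewrite integral_tail_jump lte_mul_pinfty ?lee_fin ?powR_ge0//.
  apply: (@le_lt_trans _ _ (\sum_(m <oo) ((fine (zsum tot))%:E * (qq ^- m)%:E))).
    apply: lee_nneseries => m _; first by move=> _; rewrite mule_ge0//; exact: tot0.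
    by rewrite muleC -zE; apply: lee_wpmul2r => //; exact: zsum_ge_term.
  rewrite nneseriesZl// lte_mul_pinfty ?lee_fin ?fine_ge0 ?zsum_ge0//.
  by apply: le_lt_trans nneseries_qq _; rewrite ltey.
have it : nu.-integrable setT (tail_jump g 0).
  apply/integrableP; split; first exact: measurable_tail_jump.
  by under eq_integral do rewrite gee0_abs ?tail_jump_ge0//.
have := integrable_ae measurableT it; apply: filterS => b /(_ Logic.I) bf.
by rewrite -ge0_fin_numE// tail_jump_ge0.
Qed.

Lemma umeanD u v a b g h s r : admissible u g -> admissible v h -> (0 < r)%R ->
  umean (fun x => a%:E * u x + b%:E * v x) s r = (a * umean u s r + b * umean v s r)%R.
Proof.
move=> Hu Hv r0; have [iu _] := poincare_ball s Hu r0; have [iv _] := poincare_ball s Hv r0.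
have mB := measurable_Mball s r.
rewrite /umean integralD//; try exact: integrableZl.
rewrite !integralZl// fineD ?fineM ?fin_numM ?(integrable_fin_num mB iu) ?(integrable_fin_num mB iv)//.
by rewrite /=; ring.
Qed.

(** An upper limit is not additive, but almost everywhere the limits for [u] and [v] both exist. *)
Lemma trace_linear a b u v : dirichlet mu p u -> dirichlet mu p v ->
  {ae nu, forall zeta, trace (fun x => a%:E * u x + b%:E * v x) zeta =
     (a * trace u zeta + b * trace v zeta)%R}.
Proof.
move=> du dv; have [g Hu] := ex_admissible du; have [h Hv] := ex_admissible dv.
have [C C0 HC] := tr_cvg.
have := tail_jump_ae Hu; have := tail_jump_ae Hv; apply: filterS2 => zeta fv fu.
have [c cu _] := HC _ _ Hu _ _ fu; have [d cv _] := HC _ _ Hv _ _ fv.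
rewrite (trace_lim cu) (trace_lim cv); apply: trace_lim.
rewrite (_ : (fun n => _) = (fun n : nat => a * tr u (- n%:Z) zeta + b * tr v (- n%:Z) zeta)%R); last first.
  by apply/funext => n; exact: (umeanD a b _ Hu Hv (rad_gt0 _)).
by apply: cvgD; apply: cvgMr.
Qed.

(** * Lebesgue points of the trace *)

Lemma sc_neg_pow (n : nat) : (sc (- n%:Z) `^ (al * p) = (2 `^ (- (al * p))) ^+ n :> R)%R.
Proof.
by rewrite sc_powR powRN -(exprz_inv (2 `^ (al * p))%R n%:Z).
Qed.

Lemma sc_decay_lt1 : (0 <= (2 `^ (- (al * p)) : R) < 1)%R.
Proof.
rewrite powR_ge0/= powRN invf_lt1 ?powR_gt0//.
have : (1 `^ (al * p) < 2 `^ (al * p) :> R)%R; last by rewrite powR1.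
by apply: gt0_ltr_powR; rewrite ?alp_gt0 ?nnegrE// ltr1n.
Qed.

Definition lebesgue_energy (g : Omega -> \bar R) k l :=
  \int[mu]_(x in ball (z k l) (lam * (4 * sc k))%R) (g x `^ p).

Lemma lebesgue_term_ge0 g k l : 0 <= (dens k l)%:E * lebesgue_energy g k l.
Proof.
apply: mule_ge0; first by rewrite lee_fin ltW// dens_gt0.
by apply: integral_ge0 => x _; exact: poweR_ge0.
Qed.

(** A ball of radius [4 * sc k] about the corkscrew point contains the boundary-centred ball.
    Poincare there compares [u] with its mean on the large ball, and that mean with [tr u k b], the
    mean on the small ball of radius [rad k]. *)
Lemma lebesgue_average : exists2 C : R, (0 < C)%R & forall u g, admissible u g ->
  forall k b r c, (sc (k - 1) < r <= sc k)%R ->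
  average mu (i @^-1` ball (j b) r) (fun x => `|u x - c%:E|) <=
  C%:E * (net_fun (fun l => (dens k l)%:E * lebesgue_energy g k l) k b) `^ p^-1 +
  C%:E * (`|tr u k b - c|)%:E.
Proof.
(* The centres are within [5 / 2 * sc k] and [sc k < 2 * r], so the large ball needs the factor
   $2\,(5/2+4)=13$. *)
have [D D0 HD] := mM_doubling 13.
have [D2 D20 HD2] := mM_doubling 1.
have kap0 := kap_gt0.
have [D3 D30 HD3] := mM_doubling (4 / kap).
have Cc0 : (0 < Cc)%R by exact: lt_le_trans Cc1.
pose C1 := (D * ((1 + D3) * (Cp * 4)) * (D2 * Cc) `^ p^-1)%R.
have C10 : (0 < C1)%R by rewrite !mulr_gt0 ?powR_gt0 ?mulr_gt0// addr_gt0.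
exists (C1 + D)%R; first by rewrite addr_gt0.
move=> u g Hug k b r c /andP[kr rk].
have s0 := sc_gt0 (R := R) k; have r0 : (0 < r)%R by apply: lt_trans kr; exact: sc_gt0.
have skr : (sc k < 2 * r)%R by rewrite [ltLHS]scB1 ltr_pM2l.
set l := idx k b; have yb : (mdist (y k l) b < sc k)%R := idxP k b.
have zn := z_near k l; set s := z k l in zn *.
have s40 : (0 < 4 * sc k :> R)%R by rewrite mulr_gt0.
have ls40 : (0 < lam * (4 * sc k) :> R)%R by rewrite mulr_gt0.
have lsk : (sc k <= lam * sc k)%R by rewrite ler_peMl// ltW.
have bz : (mdist (j b) (i s) <= 5 / 2 * sc k)%R.
  have := metric_triangle (j b) (j (y k l)) (i s).
  rewrite iso_j (metric_sym b (y k l)) (metric_sym (j (y k l)) (i s)); lra.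
have sub : i @^-1` ball (j b) r `<=` ball s (4 * sc k)%R.
  by rewrite -preimage_i_ball; apply: preimage_subset; apply: subset_mball; rewrite metric_sym; lra.
have M1 : (mM (i s) (4 * sc k) <= D * mM (j b) r)%R.
  by apply: HD => //; rewrite metric_sym; lra.
have Mb := (mME (j b) r0).2; have Mbe := (mME (j b) r0).1.
have M4 := M_gt0 (i s) s40; have Ml := M_gt0 (i s) ls40.
have [iu PI] := poincare_ball s Hug s40.
set m := umean u s (4 * sc k) in PI.
set H := lebesgue_energy g k l.
have H0 : 0 <= H by apply: integral_ge0 => x _; exact: poweR_ge0.
rewrite -/(lebesgue_energy g k l) -/H in PI.
set Y := ((mM (i s) (lam * (4 * sc k)))^-1)%:E * H in PI.
have Y0 : 0 <= Y by rewrite mule_ge0// lee_fin invr_ge0 ltW.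
have ipge : (0 <= p^-1)%R by rewrite invr_ge0 ltW.
have mu_c : measurable_fun setT (fun x => `|u x - c%:E|).
  apply: measurableT_comp => //; apply: emeasurable_funB; last exact: measurable_cst.
  by case: Hug => -[].
have rad4 : (rad k <= 4 * sc k)%R.
  apply: (@le_trans _ _ (1 * sc k)%R); first by rewrite ler_pM2r// kap_le1.
  by rewrite mul1r; lra.
have r00 := rad_gt0 k.
have J : (`|tr u k b - m|)%:E <= (D3 * Cp * (4 * sc k))%:E * Y `^ p^-1.
  have subr : ball s (rad k) `<=` ball s (4 * sc k)%R by apply: subset_mball; rewrite mdistxx add0r.
  have MD : (mM (i s) (4 * sc k) <= D3 * mM (i s) (rad k))%R.
    apply: HD3 => //; rewrite mdistxx add0r /rad mulrA mulfVK ?gt_eqF//.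
  have := umean_jump Hug s40 r00 subr D30 MD; rewrite -/m -/(cm u k l) -/(tr u k b).
  rewrite -/(lebesgue_energy g k l) -/H -/Y => HJ.
  have := lee_poweR ipge _ HJ; rewrite lee_fin powR_ge0 => /(_ isT).
  rewrite poweR_EFin -powRrM mulfV ?gt_eqF// powRr1// => /le_trans; apply.
  rewrite poweRM// ?lee_fin ?powR_ge0// poweR_EFin -powRrM mulfV ?gt_eqF// powRr1//.
  by apply: mulr_ge0; [apply: mulr_ge0; exact: ltW|exact: ltW].
have YP : (sc k)%:E * Y `^ p^-1 <= ((D2 * Cc) `^ p^-1)%:E *
    (net_fun (fun l => (dens k l)%:E * lebesgue_energy g k l) k b) `^ p^-1.
  have V0 := V_gt0 (y k l) s0.
  have Minv : (sc k `^ p * (mM (i s) (lam * (4 * sc k)))^-1 <= D2 * Cc * dens k l)%R.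
    have [c1 _] := codimE (y k l) s0.
    have Mlo : (mM (j (y k l)) (sc k) <= D2 * mM (i s) (lam * (4 * sc k)))%R.
      by apply: HD2 => //; rewrite metric_sym; lra.
    have cc0 : (0 <= Cc * sc k `^ (- theta))%R by rewrite mulr_ge0 ?powR_ge0// ltW.
    have c2 := le_trans c1 (ler_wpM2l cc0 Mlo); rewrite -/(V _ _) in c2.
    rewrite ler_pdivrMr// /dens -powR_dens.
    have e1 : (sc k `^ p = sc k `^ p / V (y k l) (sc k) * V (y k l) (sc k))%R.
      by rewrite mulfVK ?gt_eqF.
    rewrite [leLHS]e1; apply: le_trans (ler_wpM2l _ c2) _.
      by rewrite divr_ge0 ?powR_ge0// ltW.
    by rewrite le_eqVlt; apply/orP; left; apply/eqP; ring.
  have e2 : (sc k)%:E * Y `^ p^-1 = ((sc k `^ p)%:E * Y) `^ p^-1.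
    rewrite poweRM ?lee_fin ?powR_ge0// poweR_EFin -powRrM mulfV ?gt_eqF// powRr1//.
    exact: ltW.
  rewrite e2 -(poweR_EFin (D2 * Cc)%R) -poweRM; last 2 first.
  - by rewrite lee_fin mulr_ge0// ltW.
  - by apply: net_fun_ge0 => l'; exact: lebesgue_term_ge0.
  apply: lee_poweR => //; first by rewrite mule_ge0// lee_fin powR_ge0.
  apply: (@le_trans _ _ ((D2 * Cc)%:E * ((dens k l)%:E * H))).
    rewrite /Y !muleA -!EFinM; apply: lee_wpmul2r => //.
  apply: lee_wpmul2l; first by rewrite lee_fin mulr_ge0// ltW.
  by apply: (net_fun_ge _ yb) => l'; exact: lebesgue_term_ge0.
set P := net_fun _ k b `^ p^-1 in YP *.
have P0 : 0 <= P by exact: poweR_ge0.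
rewrite (averageE _ Mb Mbe).
apply: (@le_trans _ _ (D%:E * (((mM (i s) (4 * sc k))^-1)%:E *
    \int[mu]_(x in ball s (4 * sc k)%R) `|u x - c%:E|))).
  rewrite muleA -EFinM; apply: lee_pmul.
  - by rewrite lee_fin invr_ge0 ltW.
  - exact: integral_ge0.
  - by rewrite lee_fin ler_pdivlMr// ler_pdivrMl// (mulrC _ D).
  - apply: ge0_subset_integral => //; [exact: measurable_i_ball|exact: measurable_Mball|].
    exact: measurable_funTS.
have mum : measurable_fun (ball s (4 * sc k)%R) (fun x => `|u x - m%:E|).
  apply: measurableT_comp => //; apply: emeasurable_funB; last exact: measurable_cst.
  by apply: measurable_funTS; case: Hug => -[].
have tri : ((mM (i s) (4 * sc k))^-1)%:E * \int[mu]_(x in ball s (4 * sc k)%R) `|u x - c%:E| <=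
    (Cp * (4 * sc k))%:E * Y `^ p^-1 + (`|m - c|)%:E.
  apply: (@le_trans _ _ (((mM (i s) (4 * sc k))^-1)%:E *
     \int[mu]_(x in ball s (4 * sc k)%R) (`|u x - m%:E| + (`|m - c|)%:E))).
    apply: lee_wpmul2l; first by rewrite lee_fin invr_ge0 ltW.
    apply: le_lower_integral => // x _; case: (u x) => [v||] //=.
    rewrite -EFinD lee_fin (_ : v - c = (v - m) + (m - c))%R ?ler_normD//; ring.
  rewrite ge0_integralD//; last exact: measurable_Mball.
  rewrite integral_cst; last exact: measurable_Mball.
  rewrite ge0_muleDr ?integral_ge0 ?mule_ge0//; apply: leeD; first exact: PI.
  by rewrite [X in _ * (_ * X)](ME s s40) -!EFinM mulrCA mulVf ?mulr1 ?gt_eqF.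
apply: le_trans (lee_wpmul2l _ tri) _; first by rewrite lee_fin ltW.
have mc : (`|m - c|)%:E <= (D3 * Cp * (4 * sc k))%:E * Y `^ p^-1 + (`|tr u k b - c|)%:E.
  apply: le_trans (leeD J (lexx _)); rewrite -EFinD lee_fin (distrC _ m).
  by rewrite (_ : m - c = (m - tr u k b) + (tr u k b - c))%R ?ler_normD//; ring.
have Yp0 : 0 <= Y `^ p^-1 by exact: poweR_ge0.
apply: (@le_trans _ _ (D%:E * (((1 + D3) * (Cp * 4))%:E * ((sc k)%:E * Y `^ p^-1) +
    (`|tr u k b - c|)%:E))).
  apply: lee_wpmul2l; first by rewrite lee_fin ltW.
  apply: le_trans (leeD (lexx _) mc) _; rewrite addeA; apply: leeD => //.
  rewrite muleA -EFinM -ge0_muleDl ?lee_fin ?mulr_ge0 ?(ltW D30) ?(ltW Cp0) ?(ltW s0)//.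
  by rewrite -EFinD; apply: lee_wpmul2r => //; rewrite lee_fin le_eqVlt; apply/orP; left; apply/eqP; ring.
rewrite ge0_muleDr ?mule_ge0 ?lee_fin ?mulr_ge0 ?addr_ge0 ?(ltW D30) ?(ltW Cp0) ?(ltW s0)//.
apply: leeD; last by apply: lee_wpmul2r => //; rewrite lee_fin lerDr ltW.
apply: (@le_trans _ _ (C1%:E * P)); last first.
  by apply: lee_wpmul2r => //; rewrite lee_fin lerDl ltW.
have DD0 : (0 <= D * ((1 + D3) * (Cp * 4)))%R.
  by rewrite !mulr_ge0 ?addr_ge0 ?(ltW D0) ?(ltW D30) ?(ltW Cp0).
rewrite muleA -EFinM /C1; move: DD0; set e := (D * _)%R => e0.
by rewrite (EFinM e) -muleA; apply: lee_wpmul2l.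
Qed.

(** At each scale the balls overlap boundedly, so the integral is at most a constant times the total
    energy times $2^{-n\alpha p}$. These bounds are summable, so the terms tend to 0 almost
    everywhere. *)
Lemma lebesgue_ae u g : admissible u g -> {ae nu, forall b,
  net_fun (fun l => (dens (- n%:Z) l)%:E * lebesgue_energy g (- n%:Z) l) (- n%:Z)%R b
    @[n --> \oo] --> 0}.
Proof.
move=> Hug; have [_ _ gfin] := Hug.
have L0 : (0 < 4 * lam + 2)%R by rewrite addr_gt0// mulr_gt0.
have [N HN] := net_overlap L0; pose N1 := Num.max N 1%R.
have N10 : (0 < N1)%R by rewrite lt_max ltr01 orbT.
pose h n b := net_fun (fun l => (dens (- n%:Z) l)%:E * lebesgue_energy g (- n%:Z) l) (- n%:Z)%R b.
have t0 k l : 0 <= (dens k l)%:E * lebesgue_energy g k l by exact: lebesgue_term_ge0.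
have h0 n b : 0 <= h n b by exact: net_fun_ge0.
have mh n : measurable_fun setT (h n) by exact: measurable_net_fun.
have e0 k l : 0 <= lebesgue_energy g k l by apply: integral_ge0 => x _; exact: poweR_ge0.
pose I := \int[mu]_x (g x `^ p).
have I0 : 0 <= I by apply: integral_ge0 => x _; exact: poweR_ge0.
have IE : I = (fine I)%:E by rewrite fineK// ge0_fin_numE.
have int n : \int[nu]_b h n b <= (N1 * fine I)%:E * ((2 `^ (- (al * p))) ^+ n)%:E.
  rewrite integral_net_fun//.
  apply: (@le_trans _ _ ((sc (- n%:Z) `^ (al * p))%:E * \sum_(l <oo) lebesgue_energy g (- n%:Z)%R l)).
    rewrite -nneseriesZl; last by move=> l _; exact: e0.
    apply: lee_nneseries => l _; first by move=> _; rewrite mule_ge0// lee_fin ltW// V_gt0// sc_gt0.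
    rewrite muleAC -EFinM; apply: lee_wpmul2r => //.
    by rewrite lee_fin /dens mulfVK// gt_eqF// V_gt0// sc_gt0.
  rewrite sc_neg_pow muleC EFinM -IE; apply: lee_wpmul2r.
    by rewrite lee_fin exprn_ge0// powR_ge0.
  apply: overlap_sum => //.
  - by move=> l; exact: measurable_Mball.
  - exact: admissible_pow_measurable Hug.
  - by move=> x; exact: poweR_ge0.
  move=> x m _; rewrite le_max; apply/orP; left.
  apply: le_trans (HN (sc (- n%:Z)) (y (- n%:Z)%R) (i x) m (sc_gt0 _) (y_sep (- n%:Z)%R)).
  apply: ler_sum => l _; rewrite ler_nat; case: (boolP (x \in _)) => // /set_mem.
  rewrite ballEmdist/= => zx.
  suff -> : (mdist (i x) (j (y (- n%:Z) l)) < (4 * lam + 2) * sc (- n%:Z))%R by [].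
  have := metric_triangle (i x) (i (z (- n%:Z) l)) (j (y (- n%:Z) l)).
  have := z_near (- n%:Z) l; have := sc_gt0 (R := R) (- n%:Z).
  rewrite iso_i (metric_sym x); lra.
have sumfin : \sum_(n <oo) \int[nu]_b h n b < +oo.
  have /andP[rho0 _] := sc_decay_lt1.
  apply: le_lt_trans (lee_nneseries _ (fun n _ => int n)) _.
    by move=> n _ _; exact: integral_ge0.
  rewrite nneseriesZl; last by move=> n _; rewrite lee_fin exprn_ge0.
  rewrite lte_mul_pinfty ?lee_fin ?mulr_ge0 ?(ltW N10) ?fine_ge0//.
  exact: le_lt_trans (nneseries_geometric_le sc_decay_lt1) (ltry _).
have := ae_summable mh h0 sumfin; apply: filterS => b.
by move=> hb; exact: (nneseries_cvg0 (h0 ^~ b) hb).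
Qed.

Lemma trace_lebesgue u : dirichlet mu p u -> {ae nu, forall zeta,
  average mu (i @^-1` ball (j zeta) r) (fun x => `|u x - (trace u zeta)%:E|)
    @[r --> 0^'+] --> 0}.
Proof.
move=> du; have [g Hug] := ex_admissible du.
have [C C0 HC] := lebesgue_average; have [C' _ HC'] := tr_cvg.
have := lebesgue_ae Hug; have := tail_jump_ae Hug; apply: filterS2 => zeta fz cv.
have [c cu _] := HC' _ _ Hug _ _ fz; rewrite (trace_lim cu).
apply: cvge_at_right0 => [r|e e0].
  by rewrite /average mule_ge0 ?inve_ge0//; apply: integral_ge0.
have e1 : (0 < (e / 2 / C) `^ p)%R by rewrite powR_gt0// !divr_gt0.
have e2 : (0 < e / 2 / C)%R by rewrite !divr_gt0.
move/fine_cvgP: cv => [[N1 _ H1] /cvgrPdist_lt/(_ _ e1)[N2 _ H2]].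
move/cvgrPdist_lt: cu => /(_ _ e2)[N3 _ H3].
pose N := maxn N1 (maxn N2 N3); exists (sc (- N%:Z)); first exact: sc_gt0.
move=> r r0 rN; have [k /andP[kr rk]] := ex_scale_oc r0.
have kN : (k <= - N%:Z)%R.
  have : (sc (k - 1) < sc ((- N%:Z - 1) + 1) :> R)%R by rewrite subrK (lt_trans kr).
  by move=> /sc_lt_inj; rewrite lerD2r.
have [n [nN kE]] : exists n, (N <= n)%N /\ k = (- n%:Z)%R.
  by clear -kN; exists `|k|%N; lia.
subst k; have k12 : (sc (- n%:Z - 1) < r <= sc (- n%:Z))%R by rewrite kr.
apply: le_trans (HC u g Hug (- n%:Z)%R zeta r c k12) _.
have n1 : (N1 <= n)%N by rewrite (leq_trans _ nN)// leq_maxl.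
have n2 : (N2 <= n)%N by rewrite (leq_trans _ nN)// !leq_max leqnn !orbT.
have n3 : (N3 <= n)%N by rewrite (leq_trans _ nN)// !leq_max leqnn !orbT.
have := H1 n n1; have := H2 n n2; have := H3 n n3; rewrite /=.
set Q := net_fun _ _ _; rewrite sub0r normrN => h3 h2 h1.
have Q0 : 0 <= Q by apply: net_fun_ge0 => l; exact: lebesgue_term_ge0.
have Qe : Q `^ p^-1 <= (e / 2 / C)%:E.
  have : Q <= ((e / 2 / C) `^ p)%:E.
    by rewrite -(fineK h1) lee_fin ltW// (le_lt_trans _ h2)// ler_norm.
  move=> /(lee_poweR (_ : (0 <= p^-1)%R) Q0); rewrite invr_ge0 (ltW p0) => /(_ isT) /le_trans; apply.
  by rewrite poweR_EFin -powRrM mulfV ?gt_eqF// powRr1// ltW.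
apply: (@le_trans _ _ (C%:E * (e / 2 / C)%:E + C%:E * (e / 2 / C)%:E)).
  apply: leeD; apply: lee_wpmul2l; rewrite ?lee_fin ?(ltW C0)//.
  by rewrite distrC ltW.
rewrite -!EFinM -EFinD lee_fin (mulrC C) mulfVK ?gt_eqF//.
by rewrite -splitr.
Qed.

(** * The trace of the extension *)

Lemma tr_ext : exists2 C : R, (0 < C)%R & forall f, besov_adm f -> forall k b,
  (`|tr (EFin \o ext f) k b - cmean f k (idx k b)| `^ p)%:E <=
  C%:E * (((V (y k (idx k b)) (16 * sc k))^-1)%:E * net_osc f k (idx k b)).
Proof.
(* Points of the ball of radius [rad k] about a corkscrew point keep at least half of its depth
   [sc k / A]. *)
have A20 : (0 < (2 * A)^-1)%R by rewrite invr_gt0 mulr_gt0.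
have [C C0 HC] := ext_dist A20; have [D D0 HD] := ext_dirichlet.
exists (C `^ p * 2 `^ p)%R; first by rewrite mulr_gt0 ?powR_gt0.
move=> f Hf k b; set l := idx k b; set c := cmean f k l.
have s0 := sc_gt0 (R := R) k; have r0 := rad_gt0 k.
have [du _] := HD f Hf; have [g Hug] := ex_admissible du.
have [iu _] := poincare_ball (z k l) Hug r0.
have M0 := M_gt0 (i (z k l)) r0; have mB := measurable_Mball (z k l) (rad k).
have zn := z_near k l; have zd := z_delta k l.
have V0 := V_gt0 (y k l) (sc16 k).
have rA : (rad k <= sc k / A / 8)%R.
  rewrite /rad /kap (_ : sc k / A / 8 = (8 * A)^-1 * sc k)%R; last by field; rewrite gt_eqF.
  rewrite ler_pM2r// lef_pV2 ?posrE ?mulr_gt0 ?exprn_gt0// -mulrA ler_pM2l//.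
  rewrite expr2 -mulrA ler_peMr ?(ltW A0)//; exact: mulr_ege1.
have sA : (sc k / A <= sc k)%R by rewrite ler_pdivrMr// ler_peMr// ltW.
have near_z x : ball (z k l) (rad k) x -> `|(ext f x)%:E - c%:E| <= (C * dev f c k l)%:E.
  rewrite ballEmdist/= => zx.
  suff: (`|ext f x - c| <= C * dev f c k l)%R by rewrite -lee_fin.
  apply: HC => //.
    have -> : ((2 * A)^-1 * sc k = sc k / A / 2)%R by field; rewrite gt_eqF.
    have := delta_lip (z k l) x; lra.
  have dx : (mdist (i x) (j (y k l)) <= 13 / 8 * sc k)%R.
    have := metric_triangle (i x) (i (z k l)) (j (y k l)).
    rewrite iso_i (metric_sym x); lra.
  split; last by lra.
  by apply: le_trans (delta_le x (y k l)) _; lra.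
have H := mean_dist c mB M0 (ME (z k l) r0) iu.
have H1 : (`|tr (EFin \o ext f) k b - c|)%:E <= (C * dev f c k l)%:E.
  apply: le_trans H _; rewrite lee_pdivrMl//.
  apply: (@le_trans _ _ (\int[mu]_(x in ball (z k l) (rad k)) (C * dev f c k l)%:E)).
    exact: le_lower_integral.
  by rewrite integral_cst// (ME (z k l) r0) muleC.
have {}H1 : (`|tr (EFin \o ext f) k b - c| `^ p)%:E <= ((C * dev f c k l) `^ p)%:E.
  by rewrite lee_fin; apply: le_powR; rewrite ?(ltW p0)// -lee_fin.
apply: le_trans H1 _; rewrite powRM ?(ltW C0) ?dev_ge0//.
(* With [CE = 1] and after cancelling the powers of [sc k], this is the Jensen bound of [dev] by
   [net_osc]. *)
have := slope_pow k l Hf ltr01; rewrite /slope mul1r -/c mulr1 => H2.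
have {}H2 : (dev f c k l `^ p * V (y k l) (16 * sc k))%:E <= (2 `^ p)%:E * net_osc f k l.
  have sp0 : (0 < sc k `^ p)%R by rewrite powR_gt0.
  have := lee_wpmul2l (_ : 0 <= (sc k `^ p)%:E) H2.
  rewrite lee_fin powR_ge0 => /(_ isT); rewrite -EFinM muleA -EFinM.
  rewrite powRM ?dev_ge0 ?invr_ge0 ?(ltW s0)// -powR_inv1 ?(ltW s0)// -powRrM mulN1r powRN.
  rewrite (_ : sc k `^ p * (dev f c k l `^ p * (sc k `^ p)^-1 * _) =
    dev f c k l `^ p * V (y k l) (16 * sc k))%R; last by field; rewrite gt_eqF.
  by rewrite (_ : sc k `^ p * (2 `^ p * (sc k `^ p)^-1) = 2 `^ p)%R//; field; rewrite gt_eqF.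
rewrite !EFinM -muleA; apply: lee_wpmul2l; first by rewrite lee_fin powR_ge0.
have := lee_wpmul2l (_ : 0 <= ((V (y k l) (16 * sc k))^-1)%:E) H2.
rewrite lee_fin invr_ge0 ltW// => /(_ isT); rewrite -EFinM mulrC mulfK ?gt_eqF//.
by rewrite muleCA.
Qed.

(** Almost everywhere the weighted oscillations are summable over all scales, so at scale $-n$ both
    [f] and the average of the extension differ from [cmean] by a quantity whose p-th power is
    $O(2^{-n\alpha p})$. *)
Lemma trace_ext f : besov_adm f ->
  {ae nu, forall zeta, trace (EFin \o ext f) zeta = f zeta}.
Proof.
move=> Hf; have [C C0 HC] := tr_ext; have [C' C'0 HC'] := scale_osc_energy.
pose w k l := ((V (y k l) (16 * sc k))^-1)%:E * net_osc f k l.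
have w0 k l : 0 <= w k l.
  by rewrite mule_ge0 ?net_osc_ge0// lee_fin invr_ge0 ltW// V_gt0// sc16.
pose q k l b := (`|f b - cmean f k l| `^ p)%:E * (\1_(ball (y k l) (sc k)) b)%:E.
have q0' k l b : 0 <= q k l b by rewrite mule_ge0// lee_fin powR_ge0.
have mq k l : measurable_fun setT (q k l).
  apply: emeasurable_funM; first exact: measurable_diff_pow Hf.1 _ _.
  by apply/measurable_EFinP; apply: measurable_indic; exact: measurable_mball.
(* The first summand controls the distance from the average of the extension to [cmean], the second
   that from [f] to [cmean]. *)
pose Hs k b := net_fun (w k) k b + \sum_(l <oo) q k l b.
have sq0 k b : 0 <= \sum_(l <oo) q k l b by exact: nneseries_ge0.
have Hs0 k b : 0 <= Hs k b by rewrite adde_ge0// net_fun_ge0.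
have mHs k : measurable_fun setT (Hs k).
  apply: emeasurable_funD; first exact: measurable_net_fun.
  exact: (@ge0_emeasurable_sum _ _ R setT _ xpredT).
have intHs k : \int[nu]_b Hs k b <= 2%:E * scale_osc f k.
  rewrite ge0_integralD//; last 3 first.
  - by move=> b _; exact: net_fun_ge0.
  - exact: measurable_net_fun.
  - exact: (@ge0_emeasurable_sum _ _ R setT _ xpredT).
  have s0 := sc_gt0 (R := R) k.
  rewrite (_ : 2%:E * scale_osc f k = scale_osc f k + scale_osc f k); last first.
    by rewrite mule_natl mule2n.
  apply: leeD.
    rewrite integral_net_fun//; apply: lee_nneseries => l _.
      by move=> _; rewrite mule_ge0// lee_fin ltW// V_gt0.
    rewrite /w muleAC -EFinM -[leRHS]mul1e; apply: lee_wpmul2r; first exact: net_osc_ge0.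
    rewrite lee_fin mulrC ler_pdivrMr ?V_gt0 ?sc16// mul1r.
    by apply: le_nN => //; rewrite mdistxx; lra.
  rewrite integral_nneseries//; apply: lee_nneseries => l _.
    by move=> _; exact: integral_ge0.
  have -> : \int[nu]_b q k l b = \int[nu]_(b in ball (y k l) (sc k)) (`|f b - cmean f k l| `^ p)%:E.
    rewrite [RHS]integral_mkcond; apply: eq_integral => b _.
    by rewrite patchE /q indicE; case: (b \in _); rewrite ?mule1 ?mule0.
  apply: ge0_subset_integral; side; first exact: measurable_diff_pow Hf.1 _ _.
  by apply: subset_mball; rewrite mdistxx; lra.
pose h n b := (sc (int_enum n) `^ (- (al * p)))%:E * Hs (int_enum n) b.
have h0 n b : 0 <= h n b by rewrite mule_ge0// lee_fin powR_ge0.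
have mh n : measurable_fun setT (h n) by exact: emeasurable_funM.
have sumfin : \sum_(n <oo) \int[nu]_b h n b < +oo.
  apply: (@le_lt_trans _ _ (2%:E * zsum (fun k => (sc k `^ (- (al * p)))%:E * scale_osc f k))).
    rewrite -zsumZl; last by move=> k; rewrite mule_ge0 ?scale_osc_ge0// lee_fin powR_ge0.
    apply: lee_nneseries => n _; first by move=> _; exact: integral_ge0.
    rewrite ge0_integralZl_EFin//; last exact: powR_ge0.
    by rewrite muleCA; apply: lee_wpmul2l; rewrite ?lee_fin ?powR_ge0.
  apply: lte_mul_pinfty => //; apply: le_lt_trans (HC' f Hf) _.
  by apply: lte_mul_pinfty; rewrite ?lee_fin ?(ltW C'0)//; case: Hf.
have := ae_summable mh h0 sumfin; apply: filterS => b Sb; apply: trace_lim.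
set S := \sum_(n <oo) h n b in Sb.
have S0 : 0 <= S by exact: nneseries_ge0.
have SE : S = (fine S)%:E by rewrite fineK// ge0_fin_numE.
pose M := (2 `^ p * (C + 1) * fine S)%R.
have M0 : (0 <= M)%R by rewrite !mulr_ge0 ?powR_ge0 ?fine_ge0// addr_ge0// ltW.
have key (n : nat) : (`|f b - tr (EFin \o ext f) (- n%:Z)%R b| `^ p <= M * (2 `^ (- (al * p))) ^+ n)%R.
  rewrite -sc_neg_pow; move: (- n%:Z)%R => k.
  have spk : (0 < sc k `^ (al * p) :> R)%R by rewrite powR_gt0// sc_gt0.
  have HsS : Hs k b <= (sc k `^ (al * p) * fine S)%:E.
    have [m mk] := int_enum_surj k.
    have := nneseries_ge_term m (h0 ^~ b); rewrite -/S /h mk SE powRN => H.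
    have := lee_wpmul2l (_ : 0 <= (sc k `^ (al * p))%:E) H; rewrite lee_fin ltW// => /(_ isT).
    by rewrite muleA -!EFinM mulfV ?gt_eqF// mul1e.
  have t1 := HC f Hf k b; have ib := idxP k b.
  set l := idx k b in t1 ib; set a := tr _ k b in t1 *; set c := cmean f k l in t1.
  have t2 : w k l <= Hs k b.
    by apply: le_trans (net_fun_ge (w0 k) ib) _; rewrite leeDl.
  have t3 : (`|f b - c| `^ p)%:E <= Hs k b.
    apply: (@le_trans _ _ (q k l b)).
      by rewrite /q indicE mem_set ?mule1// ballEmdist.
    apply: le_trans (nneseries_ge_term l (fun l => q0' k l b)) _.
    by rewrite leeDr// net_fun_ge0.
  rewrite -lee_fin; apply: (@le_trans _ _ ((2 `^ p)%:E * ((`|f b - c| `^ p)%:E + (`|a - c| `^ p)%:E))).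
    rewrite -EFinD -EFinM lee_fin (distrC a); apply: le_trans (powRD_le p1 _ _) => //.
    apply: le_powR => //; first exact: ltW.
    by rewrite (_ : f b - a = (f b - c) + (c - a))%R ?ler_normD//; ring.
  have -> : (M * sc k `^ (al * p) = 2 `^ p * (sc k `^ (al * p) * fine S + C * (sc k `^ (al * p) * fine S)))%R.
    by rewrite /M; ring.
  rewrite (EFinM (2 `^ p)%R); apply: lee_wpmul2l; first by rewrite lee_fin powR_ge0.
  rewrite EFinD; apply: leeD; first exact: le_trans t3 HsS.
  apply: le_trans t1 _; rewrite (EFinM C); apply: lee_wpmul2l; first by rewrite lee_fin ltW.
  exact: le_trans t2 HsS.
apply/cvgrPdist_lt => e e0; have /andP[rho0 rho1] := sc_decay_lt1.
have ep0 : (0 < e `^ p)%R by rewrite powR_gt0.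
have rhon : (`|2 `^ (- (al * p)) : R| < 1)%R by rewrite ger0_norm.
move/cvgrPdist_lt: (cvg_geometric M rhon) => /(_ _ ep0)[N _ HN].
exists N => // n Nn /=; rewrite ltNge; apply/negP => ge.
have := HN n Nn; rewrite /= sub0r normrN (ger0_norm (mulr_ge0 M0 (exprn_ge0 n rho0))).
apply/negP; rewrite -leNgt.
apply: le_trans (key n); apply: le_powR => //; exact: ltW.
Qed.

(** * Linearity of the extension and conclusion *)

Lemma kern_mul_integrable f x : besov_adm f ->
  nu.-integrable setT (EFin \o (fun b => kern x b * f b)%R).
Proof.
move=> Hf; have [k [l [kd dk kl]]] := ex_anchored x.
have s0 := sc_gt0 (R := R) k.
have an : anchored k l x by move: dk; rewrite scS /anchored => dk; split; lra.
have i1 : nu.-integrable (nball k l) (EFin \o f) by apply: besov_Lp => //; exact: sc16.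
have := kern_integrable x i1.
rewrite (integrable_mkcond _ (measurable_mball (y k l) (16 * sc k))).
apply: eq_integrable => // b _; rewrite patchE; case: ifPn => // /negP nb.
by rewrite /= (anchored_out an) ?mul0r// => /mem_set.
Qed.

Lemma ext_linear a c f h x : besov_adm f -> besov_adm h ->
  ext (fun b => a * f b + c * h b)%R x = (a * ext f x + c * ext h x)%R.
Proof.
move=> Hf Hh; have i1 := kern_mul_integrable x Hf; have i2 := kern_mul_integrable x Hh.
have i1' : nu.-integrable setT (EFin \o (fun b => a * (kern x b * f b))%R).
  by have := integrableZl measurableT a i1; apply: eq_integrable.
have i2' : nu.-integrable setT (EFin \o (fun b => c * (kern x b * h b))%R).
  by have := integrableZl measurableT c i2; apply: eq_integrable.
rewrite /ext !mulrA -mulrDl; congr (_ / _)%R.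
rewrite -!RintegralZl// -RintegralD//.
by apply: eq_Rintegral => b _; ring.
Qed.

Lemma ext_ae_eq f h x : besov_adm f -> besov_adm h ->
  {ae nu, forall b, f b = h b} -> ext f x = ext h x.
Proof.
move=> Hf Hh fh; rewrite /ext; congr (_ / _)%R; rewrite /Rintegral; congr fine.
apply: ae_eq_integral => //.
- by have /integrableP[] := kern_mul_integrable x Hf.
- by have /integrableP[] := kern_mul_integrable x Hh.
by apply: filterS fh => b -> _.
Qed.

Lemma besov_admissible f : besov nu p al f -> besov_adm f.
Proof.
move=> [[mf _] fin]; split => //.
by rewrite besov_energyE; exact: poweR_lty.
Qed.

Local Close Scope ereal_scope.

Lemma trace_extension :
  exists T : (Omega -> \bar R) -> (bd -> R),
    [/\ forall u, dirichlet mu p u -> besov nu p (1 - theta / p) (T u),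
        forall (a b : R) u v, dirichlet mu p u -> dirichlet mu p v ->
          {ae nu, forall zeta,
             T (fun x => a%:E * u x + b%:E * v x)%E zeta =
             a * T u zeta + b * T v zeta},
        exists C : R, forall u, dirichlet mu p u ->
          (besov_norm nu p (1 - theta / p) (T u)
             <= C%:E * dirichlet_norm mu p u)%E,
        forall u, dirichlet mu p u ->
          {ae nu, forall zeta,
             average mu (i @^-1` ball (j zeta) r)
               (fun x => `|u x - (T u zeta)%:E|)%E
             @[r --> 0^'+] --> 0%E} &
        exists E : (bd -> R) -> (Omega -> \bar R),
          [/\ forall f, besov nu p (1 - theta / p) f -> dirichlet mu p (E f),
              forall f g, besov nu p (1 - theta / p) f ->
                besov nu p (1 - theta / p) g ->
                {ae nu, forall zeta, f zeta = g zeta} -> E f = E g,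
              forall (a b : R) f g, besov nu p (1 - theta / p) f ->
                besov nu p (1 - theta / p) g ->
                E (fun zeta => a * f zeta + b * g zeta) =
                (fun x => a%:E * E f x + b%:E * E g x)%E,
              exists C : R, forall f, besov nu p (1 - theta / p) f ->
                (dirichlet_norm mu p (E f)
                   <= C%:E * besov_norm nu p (1 - theta / p) f)%E &
              forall f, besov nu p (1 - theta / p) f ->
                {ae nu, forall zeta, T (E f) zeta = f zeta}]].
Proof.
have [C C0 HC] := trace_norm; have [D D0 HD] := ext_dirichlet.
exists trace; split.
- by move=> u /HC[].
- by move=> a b u v; exact: trace_linear.
- by exists C => u /HC[].
- exact: trace_lebesgue.
exists (fun f => EFin \o ext f); split.
- by move=> f /(besov_admissible (f := f)) /HD[].
- by move=> f g /besov_admissible Hf /besov_admissible Hg fg; apply/funext => x; congr EFin; exact: ext_ae_eq.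
- move=> a b f g /besov_admissible Hf /besov_admissible Hg; apply/funext => x.
  by rewrite /= ext_linear.
- by exists D => f /besov_admissible /HD[].
- by move=> f /besov_admissible; exact: trace_ext.
Qed.

End geometry.

(* X is the completion of Omega via i, and j identifies bd with X \ Omega. *)
Theorem theorem1p1 (R : realType) (d1 d2 : measure_display) (p theta : R)
    (Omega : metricMeasurableType d1 R) (X : metricType R)
    (bd : metricMeasurableType d2 R)
    (i : Omega -> X) (j : bd -> X)
    (mu : {measure set Omega -> \bar R}) (nu : {measure set bd -> \bar R}) :
  1 <= p ->
  unbounded_space Omega ->
  locally_compact [set: Omega] ->
  ~ complete_space Omega ->
  borel_regular mu ->
  positive_finite_balls mu ->
  doubling mu ->
  poincare mu p ->
  is_completion i ->
  uniform_domain i ->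
  isometric j -> range j = bdry i ->
  unbounded_space bd ->
  borel_regular nu ->
  nonatomic nu ->
  0 < theta < p ->
  codimensional i j mu nu theta ->
  exists T : (Omega -> \bar R) -> (bd -> R),
    [/\ forall u, dirichlet mu p u -> besov nu p (1 - theta / p) (T u),
        forall (a b : R) u v, dirichlet mu p u -> dirichlet mu p v ->
          {ae nu, forall zeta,
             T (fun x => a%:E * u x + b%:E * v x)%E zeta =
             a * T u zeta + b * T v zeta},
        exists C : R, forall u, dirichlet mu p u ->
          (besov_norm nu p (1 - theta / p) (T u)
             <= C%:E * dirichlet_norm mu p u)%E,
        forall u, dirichlet mu p u ->
          {ae nu, forall zeta,
             average mu (i @^-1` ball (j zeta) r)
               (fun x => `|u x - (T u zeta)%:E|)%E
             @[r --> 0^'+] --> 0%E} &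
        exists E : (bd -> R) -> (Omega -> \bar R),
          [/\ forall f, besov nu p (1 - theta / p) f -> dirichlet mu p (E f),
              forall f g, besov nu p (1 - theta / p) f ->
                besov nu p (1 - theta / p) g ->
                {ae nu, forall zeta, f zeta = g zeta} -> E f = E g,
              forall (a b : R) f g, besov nu p (1 - theta / p) f ->
                besov nu p (1 - theta / p) g ->
                E (fun zeta => a * f zeta + b * g zeta) =
                (fun x => a%:E * E f x + b%:E * E g x)%E,
              exists C : R, forall f, besov nu p (1 - theta / p) f ->
                (dirichlet_norm mu p (E f)
                   <= C%:E * besov_norm nu p (1 - theta / p) f)%E &
              forall f, besov nu p (1 - theta / p) f ->
                {ae nu, forall zeta, T (E f) zeta = f zeta}]].
Proof.
move=> p1 unbO lc _ [mu_open _] mball [Cm [Cm1 dbl]] [Cp [lam [Cp0 lam1 poin]]].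
move=> [isoi densei _] [A [A1 unif]] isoj rangej unbb [nu_open _] _ /andP[theta0 thetap] [Cc [Cc1 codim]].
have unif' (x y : Omega) : exists c : curve Omega,
    [/\ joins c x y, (curve_length c <= (A * mdist x y)%:E)%E &
        forall t, t \in `[cbeg c, cend c] ->
          (Order.min (path_length c (cbeg c) t) (path_length c t (cend c))
           <= A%:E * dist_bdry i (c t))%E].
  have [c [c1 c2 c3]] := unif x y; exists c; split => // t tc.
  exact: (c3 t t tc tc erefl).
have net k := ex_net isoi isoj densei mu_open nu_open mball Cm1 dbl Cc1 codim unbb (sc_gt0 k).
have [y Hy] := choice net.
have cork kl := ex_corkscrew isoi densei rangej A1 unif' unbO (y kl.1 kl.2) (sc_gt0 kl.1).
have [z Hz] := choice cork.
have ysep k := (Hy k).1; have ycov k := (Hy k).2.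
have znear k l := (Hz (k, l)).1; have zdelta k l := (Hz (k, l)).2.
exact: (trace_extension isoi isoj densei rangej mu_open nu_open mball Cm1 dbl Cc1 codim
  lc A1 unif' p1 thetap ysep ycov Cp0 lam1 poin znear zdelta).
Qed.
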